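(* Let $Q(z)$ be holomorphic on (a branch cut of) the open unit disk, save for a set of isolated singularities, and suppose $Q$ is holomorphic at $z=0$ with $Q(0)=1$. Let $r$ be the smallest magnitude of a singularity of $Q(z)$, and let $\mathcal{Q}(s)=\prod_p Q(p^{-s})$ (product over all rational primes $p$) be the corresponding Euler product. Then: (i) There exists a sequence of complex numbers $b_n=b_n(Q)$, $n\ge 1$, such that $$\log Q(z) = -\sum_{n=1}^\infty b_n\log(1-z^n)$$ as formal power series centered at $z=0$. (ii) For each $\epsilon>0$, $$\mathcal{Q}(s)\prod_{p\le r^{-1/\epsilon}}Q(p^{-s})^{-1}\prod_{n\le 1/\epsilon}\zeta(ns)^{-b_n}$$ is an absolutely convergent Dirichlet series (and so holomorphic) on the right half-plane $\mathrm{Re}(s)>\epsilon$.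
   Context: $\zeta$ is the Riemann zeta function. Here $\log Q(z)\in z\mathbb{C}[[z]]$ denotes the formal logarithm of the Taylor series of $Q$ at $0$, which has constant term $1$, and $-\log(1-z^n)=\sum_{k\ge1} z^{kn}/k$. Complex powers are $w^{\alpha}=e^{\alpha\log w}$ for a branch of the logarithm; for Euler factors, $(1-p^{-ns})^{b}$ with $\mathrm{Re}(s)>0$ is given by the binomial series. ''A branch cut of'' a domain means the domain with curves (cuts) removed that start at singularities and prevent loops around singularities of non-integral order. The cuts are taken to start at singularities of $Q$ and run outward, so that they do not meet the disk $|z|<r$; thus $Q$ is holomorphic on $|z|<\min(r,1)$ and equal to its Taylor series there. If $Q$ has no singularity in the open unit disk, then $r$ is understood to be $\ge 1$, so that the product over $p\le r^{-1/\epsilon}$ is empty. The expression in (ii) is understood as an Euler product, multiplied prime by prime: $\zeta(ns)^{-b}=\prod_p(1-p^{-ns})^{b}$, and multiplying by $Q(p^{-s})^{-1}$ cancels the factor of $\mathcal{Q}(s)$ at $p$. *)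

(* Defs.v *)
From Stdlib Require Import Reals.
From mathcomp Require Import ssreflect ssrfun ssrbool eqtype ssrnat seq.
From mathcomp Require Import fintype bigop prime.
From Coquelicot Require Import Coquelicot.

Set Implicit Arguments.
Unset Strict Implicit.
Unset Printing Implicit Defensive.

Local Open Scope R_scope.
Local Open Scope C_scope.

(** * Complex functions *)

Definition Cexp (z : C) : C :=
  (exp (Re z) * cos (Im z), exp (Re z) * sin (Im z))%R.

(* [n ^ s] for a positive integer [n]; the value at [n = 0] is meaningless. *)
Definition nat_cpow (n : nat) (s : C) : C := Cexp (s * RtoC (ln (INR n))).

(* Sum of a convergent complex series (Coquelicot's [Series] is real). *)
Definition CSeries (u : nat -> C) : C :=
  (Series (fun k => Re (u k)), Series (fun k => Im (u k))).

Definition Cbinom (b : C) (k : nat) : C :=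
  (\big[Cmult/RtoC 1]_(i < k) (b - RtoC (INR i))) / RtoC (INR k`!).

(* [(1 - w) ^ b], for [|w| < 1], by the binomial series. *)
Definition pow1m (w b : C) : C :=
  CSeries (fun k => Cbinom b k * Cpow (- w) k).

Definition complex_derivable (f : C -> C) (z : C) : Prop :=
  @ex_derive C_AbsRing C_NormedModule f z.

Definition holomorphic_on (D : C -> Prop) (f : C -> C) : Prop :=
  forall z : C, D z -> complex_derivable f z.

Definition holomorphic_at (f : C -> C) (z : C) : Prop :=
  locally z (complex_derivable f).

Definition taylor_coef (f : C -> C) (k : nat) : C :=
  iter k C_derive f (RtoC 0) / RtoC (INR k`!).

(** * The cut unit disk *)

(* The curve is [gamma] restricted to [0, +oo): this allows cuts that approach
   the unit circle without converging.  A cut that ends is a curve that is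
   eventually constant, or that leaves the unit disk. *)
Definition outward_cut (Sing : C -> Prop) (gamma : R -> C) : Prop :=
  [/\ Sing (gamma 0%R),
      forall t : R, (0 <= t)%R ->
        filterlim gamma (within (fun u : R => (0 <= u)%R) (locally t))
          (locally (gamma t))
    & forall t : R, (0 <= t)%R -> (Cmod (gamma 0%R) <= Cmod (gamma t))%R].

Definition isolated_points (Sing : C -> Prop) : Prop :=
  forall z : C, Sing z -> exists2 d : R, (0 < d)%R &
    forall w : C, Sing w -> (Cmod (w - z) < d)%R -> w = z.

Definition cut_disk (Sing : C -> Prop) (cuts : (R -> C) -> Prop) (z : C) :
    Prop :=
  [/\ (Cmod z < 1)%R, ~ Sing z
    & forall gamma : R -> C, cuts gamma ->
        forall t : R, (0 <= t)%R -> z <> gamma t].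

(* Monodromy needs no separate hypothesis: [Q] is a single-valued function,
   so it can be holomorphic on the cut disk only if the cuts are sufficient. *)
Definition holomorphic_on_cut_disk
    (Q : C -> C) (Sing : C -> Prop) (cuts : (R -> C) -> Prop) : Prop :=
  [/\ forall z : C, Sing z -> (Cmod z < 1)%R,
      isolated_points Sing,
      forall gamma : R -> C, cuts gamma -> outward_cut Sing gamma
    & holomorphic_on (cut_disk Sing cuts) Q].

Definition smallest_magnitude (Sing : C -> Prop) (r : R) : Prop :=
  (exists z : C, [/\ Sing z, Cmod z = r &
     forall w : C, Sing w -> (r <= Cmod w)%R])
  \/ ((forall z : C, ~ Sing z) /\ (1 <= r)%R).

(** * Formal power series, as coefficient sequences *)

Definition fps_mul (a b : nat -> C) (m : nat) : C :=
  sum_n (fun i => a i * b (m - i)%N) m.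

Definition fps_one (m : nat) : C := if m == 0%N then RtoC 1 else RtoC 0.

Definition fps_pow (a : nat -> C) (k : nat) : nat -> C :=
  iter k (fps_mul a) fps_one.

(* Logarithm of a series [a] with constant term 1: with [u = a - 1], it is the
   sum over [k >= 1] of [(-1)^(k+1) u^k / k].  Since [u] has no constant term,
   only the [k <= m] contribute to the coefficient of [z^m]. *)
Definition fps_log (a : nat -> C) (m : nat) : C :=
  let u := fun i => if i == 0%N then RtoC 0 else a i in
  sum_n_m (fun k => RtoC ((-1) ^ k.+1 / INR k) * fps_pow u k m) 1 m.

(* [1 - z^n], for [n >= 1] *)
Definition fps_1mXn (n m : nat) : C :=
  if m == 0%N then RtoC 1 else if m == n then - RtoC 1 else RtoC 0.

(* [g] is the sum over [n >= 1] of the series [F n], in the z-adic topology. *)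
Definition is_fps_sum (F : nat -> nat -> C) (g : nat -> C) : Prop :=
  forall m : nat,
    eventually (fun N => sum_n_m (fun n => F n m) 1 N = g m).

(** * Euler products and Dirichlet series *)

Definition is_euler_product (F : nat -> C) (l : C) : Prop :=
  filterlim (fun N : nat => \big[Cmult/RtoC 1]_(p < N.+1 | prime p) F p)
    eventually (locally l).

(* The term of index [n] is the one for the integer [n + 1]. *)
Definition dirichlet_term (c : nat -> C) (s : C) (n : nat) : C :=
  c n.+1 * nat_cpow n.+1 (- s).

Definition abs_convergent_dirichlet_series_on (H : C -> Prop) (D : C -> C) :
    Prop :=
  exists c : nat -> C, forall s : C, H s ->
    ex_series (fun n => Cmod (dirichlet_term c s n)) /\
    @is_series C_AbsRing C_NormedModule (dirichlet_term c s) (D s).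

(* Factor at [p] of the Euler product [zeta(n s)^(- b) = prod_p (1 - p^(-n s))^b];
   it makes sense for [Re s > 0], although that product by itself need not
   converge there. *)
Definition zeta_pow_factor (n : nat) (b s : C) (p : nat) : C :=
  pow1m (nat_cpow p (- (RtoC (INR n) * s))) b.

(* Factor at [p] of
     (prod_p Q(p^-s)) * prod_{p <= r^(-1/eps)} Q(p^-s)^-1
       * prod_{1 <= n <= 1/eps} zeta(n s)^(- b_n),
   in which the first two pieces cancel when [p <= r^(-1/eps)], even if
   [Q] vanishes or is not defined at [p^-s]. *)
Definition euler_factor (Q : C -> C) (r : R) (b : nat -> C) (eps : R) (s : C)
    (p : nat) : C :=
  (if Rle_dec (INR p) (Rpower r (- (1 / eps)))
   then RtoC 1 else Q (nat_cpow p (- s)))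
  * \big[Cmult/RtoC 1]_(1 <= n < (Z.to_nat (Int_part (1 / eps))).+1)
      zeta_pow_factor n (b n) s p.

(* Main.v *)
Require Import Defs.
From Stdlib Require Import Reals Lra Lia FunctionalExtensionality Classical ClassicalEpsilon.
From HB Require Import structures.
From mathcomp Require Import ssreflect ssrfun ssrbool eqtype ssrnat seq.
From mathcomp Require Import div fintype bigop prime zify.
From Coquelicot Require Import Coquelicot.

(** The formal identity in (i) is a triangular system: comparing coefficients
    of [z^m] after applying [theta = z d/dz], it says that [m] times the [m]-th
    coefficient of [log Q] is the sum of [n b_n] over the divisors [n] of [m]
    ([divisor_sum_solution], [log_fps_sum]).

    For (ii), let [M] be the integer part of [1/eps].  The factor at a prime
    [p > r^(-1/eps)] is [F(p^-s)], where
    [F(z) = Q(z) * prod_(n <= M) (1 - z^n)^(b_n)].  By (i), [log F] only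
    involves the powers [z^k] with [k > M], so [F(z) = 1 + O(z^(M+1))]
    ([fps_remainder_vanishes]; it is proved through the logarithmic derivative
    [theta F / F], which is additive, instead of through the logarithm).
    If [Re s > eps] then [|p^-s| < min(r, 1)] for these [p], where the Taylor
    series of [F] converges, and [(M + 1) Re s > 1], so the sum over [p] of the
    absolute deviations of the factors from [1] converges
    ([local_excess_bound]).  The remaining finitely many factors are the
    products of the [(1 - p^(-n s))^(b_n)] alone, which are power series in
    [p^-s] of radius [1].  Multiplying out, the Euler product is the Dirichlet
    series whose coefficients form the multiplicative function with value at
    [p^k] the [k]-th coefficient of the factor at [p]; the bound on the
    deviations gives absolute convergence, and the finite Euler products differ
    from the sum by a tail of it ([euler_product_converges]).  Such a series
    can be differentiated term by term ([dirichlet_series_derivable]).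

    The analytic input is that a function complex-differentiable on a disk
    is the sum of its Taylor series there ([holomorphic_disk_taylor]).  As
    differentiability is only pointwise, this is
    obtained from Goursat's bisection, carried out in the parameter rectangle
    of a homotopy contracting a circle to a point inside it
    ([cauchy_homotopy_to_point]), applied to the slope
    [(f w - f z) / (w - z)]. *)

Set Implicit Arguments.
Unset Strict Implicit.
Unset Printing Implicit Defensive.

Local Open Scope R_scope.
Local Open Scope C_scope.

(** * Complex sums and series *)

HB.instance Definition _ := Monoid.isComLaw.Build C (RtoC 0) Cplus
  Cplus_assoc Cplus_comm Cplus_0_l.
HB.instance Definition _ := Monoid.isComLaw.Build C (RtoC 1) Cmult
  Cmult_assoc Cmult_comm Cmult_1_l.
HB.instance Definition _ := Monoid.isMulLaw.Build C (RtoC 0) Cmult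
  Cmult_0_l Cmult_0_r.
HB.instance Definition _ := Monoid.isAddLaw.Build C Cmult Cplus
  (fun x y z => Cmult_plus_distr_r x y z) (fun x y z => Cmult_plus_distr_l x y z).
HB.instance Definition _ := Monoid.isComLaw.Build R 0%R Rplus
  (fun x y z => esym (Rplus_assoc x y z)) Rplus_comm Rplus_0_l.

Notation is_Cseries := (@is_series C_AbsRing C_NormedModule).

Definition abs_summable (u : nat -> C) : Prop := ex_series (fun k => Cmod (u k)).

Lemma sum_n_Cbig (u : nat -> C) n :
  sum_n (u : nat -> C_NormedModule) n = \big[Cplus/RtoC 0]_(k < n.+1) u k.
Proof.
elim: n => [|n IH]; first by rewrite sum_O big_ord1.
by rewrite sum_Sn big_ord_recr /= -IH.
Qed.

Lemma sum_n_Rbig (u : nat -> R) n :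
  sum_n u n = \big[Rplus/0%R]_(k < n.+1) u k.
Proof.
elim: n => [|n IH]; first by rewrite sum_O big_ord1.
by rewrite sum_Sn big_ord_recr /= -IH.
Qed.

Lemma fps_mulE a b m :
  fps_mul a b m = \big[Cplus/RtoC 0]_(i < m.+1) (a i * b (m - i)%N).
Proof. exact: sum_n_Cbig. Qed.

Lemma Cmod_sum I (r : seq I) (P : pred I) (F : I -> C) :
  (Cmod (\big[Cplus/RtoC 0]_(i <- r | P i) F i) <=
   \big[Rplus/0%R]_(i <- r | P i) Cmod (F i))%R.
Proof.
elim/big_rec2: _ => [|i y x _ IH]; first by rewrite Cmod_0; lra.
have := Cmod_triangle (F i) x; lra.
Qed.

Lemma Cmod_prod I (r : seq I) (P : pred I) (F : I -> C) :
  Cmod (\big[Cmult/RtoC 1]_(i <- r | P i) F i) =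
   \big[Rmult/1%R]_(i <- r | P i) Cmod (F i).
Proof.
elim/big_rec2: _ => [|i y x _ IH]; first by rewrite Cmod_1.
by rewrite Cmod_mult IH.
Qed.

Lemma Rsum_le I (r : seq I) (P : pred I) (F G : I -> R) :
  (forall i, P i -> (F i <= G i)%R) ->
  (\big[Rplus/0%R]_(i <- r | P i) F i <= \big[Rplus/0%R]_(i <- r | P i) G i)%R.
Proof.
move=> FG; elim/big_rec2: _ => [|i y x Pi IH]; first lra.
have := FG i Pi; lra.
Qed.

Lemma Rsum_ge0 I (r : seq I) (P : pred I) (F : I -> R) :
  (forall i, P i -> (0 <= F i)%R) ->
  (0 <= \big[Rplus/0%R]_(i <- r | P i) F i)%R.
Proof.
move=> F0; elim/big_ind: _ => [|x y Hx Hy|i /F0 //]; lra.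
Qed.

Lemma is_series_big (u : nat -> R) l :
  is_series u l <-> is_lim_seq (fun n => \big[Rplus/0%R]_(k < n) u k) l.
Proof.
split.
  move=> H; apply/is_lim_seq_incr_1.
  have H' : is_lim_seq (sum_n u) l by [].
  by apply: is_lim_seq_ext H' => n; rewrite sum_n_Rbig.
move/is_lim_seq_incr_1 => H.
suff : is_lim_seq (sum_n u) l by [].
by apply: is_lim_seq_ext H => n; rewrite sum_n_Rbig.
Qed.

Lemma filterlim_C_eps T (F : (T -> Prop) -> Prop) (FF : Filter F) (u : T -> C) (l : C) :
  filterlim u F (locally l) <->
  forall eps : R, (0 < eps)%R -> F (fun x => (Cmod (u x - l) < eps)%R).
Proof.
have E x : minus (x : C_NormedModule) l = (x - l) by [].
split.
  move/filterlim_locally => H eps e0.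
  have e1 : (0 < eps / sqrt 2)%R by apply: Rdiv_lt_0_compat => //; apply: Rlt_sqrt2_0.
  apply: filter_imp (H (mkposreal _ e1)) => x /= Hb.
  have := C_NormedModule_mixin_compat2 _ _ (mkposreal _ e1) Hb.
  rewrite E /= => Hx; have s2 := Rlt_sqrt2_0.
  by replace eps with (sqrt 2 * (eps / sqrt 2))%R; [|field; lra].
move=> H; apply/filterlim_locally => eps.
apply: filter_imp (H eps (cond_pos eps)) => x Hx.
by apply: C_NormedModule_mixin_compat1; rewrite E.
Qed.

Lemma filterlim_C_ReIm T (F : (T -> Prop) -> Prop) (FF : Filter F) (u : T -> C) (l : C) :
  filterlim u F (locally l) <->
  filterlim (fun x => Re (u x)) F (locally (Re l)) /\
  filterlim (fun x => Im (u x)) F (locally (Im l)).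
Proof.
split.
  move=> H; split; apply/filterlim_locally => eps;
    move/filterlim_locally: H => H; apply: filter_imp (H eps) => x [h1 h2].
    exact: h1.
  exact: h2.
move=> [/filterlim_locally h1 /filterlim_locally h2].
apply/filterlim_locally => eps.
by apply: filter_imp (filter_and _ _ (h1 eps) (h2 eps)) => x [? ?]; split.
Qed.

Lemma Re_sum I (r : seq I) (P : pred I) (F : I -> C) :
  Re (\big[Cplus/RtoC 0]_(i <- r | P i) F i) = \big[Rplus/0%R]_(i <- r | P i) Re (F i).
Proof. by elim/big_rec2: _ => // i y x _ <-. Qed.

Lemma Im_sum I (r : seq I) (P : pred I) (F : I -> C) :
  Im (\big[Cplus/RtoC 0]_(i <- r | P i) F i) = \big[Rplus/0%R]_(i <- r | P i) Im (F i).
Proof. by elim/big_rec2: _ => // i y x _ <-. Qed.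

Lemma is_Cseries_ReIm (u : nat -> C) l :
  is_Cseries u l <->
  is_series (fun k => Re (u k)) (Re l) /\ is_series (fun k => Im (u k)) (Im l).
Proof.
rewrite /is_series filterlim_C_ReIm.
have e1 n : Re (sum_n (u : nat -> C_NormedModule) n) = sum_n (fun k => Re (u k)) n.
  by rewrite sum_n_Cbig sum_n_Rbig Re_sum.
have e2 n : Im (sum_n (u : nat -> C_NormedModule) n) = sum_n (fun k => Im (u k)) n.
  by rewrite sum_n_Cbig sum_n_Rbig Im_sum.
split=> [] [h1 h2]; split.
- exact: filterlim_ext e1 h1.
- exact: filterlim_ext e2 h2.
- exact: filterlim_ext (fun n => esym (e1 n)) h1.
- exact: filterlim_ext (fun n => esym (e2 n)) h2.
Qed.

Lemma is_Cseries_big (u : nat -> C) (l : C) :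
  is_Cseries u l <->
  filterlim (fun n => \big[Cplus/RtoC 0]_(k < n) u k) eventually (locally l).
Proof.
rewrite is_Cseries_ReIm filterlim_C_ReIm !is_series_big.
have e1 n : Re (\big[Cplus/RtoC 0]_(k < n) u k) = \big[Rplus/0%R]_(k < n) Re (u k).
  exact: Re_sum.
have e2 n : Im (\big[Cplus/RtoC 0]_(k < n) u k) = \big[Rplus/0%R]_(k < n) Im (u k).
  exact: Im_sum.
split=> [] [h1 h2]; split.
- exact: (filterlim_ext _ _ (fun n => esym (e1 n)) h1).
- exact: (filterlim_ext _ _ (fun n => esym (e2 n)) h2).
- exact: (filterlim_ext _ _ e1 h1).
- exact: (filterlim_ext _ _ e2 h2).
Qed.

Lemma CSeries_unique u l : is_Cseries u l -> CSeries u = l.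
Proof.
move/is_Cseries_ReIm => [h1 h2].
by rewrite /CSeries (is_series_unique _ _ h1) (is_series_unique _ _ h2); case: (l).
Qed.

Lemma Im_le_Cmod c : (Rabs (Im c) <= Cmod c)%R.
Proof. by apply: Rle_trans (Rmax_Cmod c); apply: Rmax_r. Qed.

Lemma abs_summable_Re u : abs_summable u -> ex_series (fun k => Rabs (Re (u k))).
Proof.
apply: (@ex_series_le R_AbsRing R_CompleteNormedModule) => n.
by rewrite /norm /= /abs /= Rabs_Rabsolu; apply: re_le_Cmod.
Qed.

Lemma abs_summable_Im u : abs_summable u -> ex_series (fun k => Rabs (Im (u k))).
Proof.
apply: (@ex_series_le R_AbsRing R_CompleteNormedModule) => n.
by rewrite /norm /= /abs /= Rabs_Rabsolu; apply: Im_le_Cmod.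
Qed.

Lemma CSeries_correct u : abs_summable u -> is_Cseries u (CSeries u).
Proof.
move=> H; apply/is_Cseries_ReIm; split; apply: Series_correct.
  exact: ex_series_Rabs (abs_summable_Re H).
exact: ex_series_Rabs (abs_summable_Im H).
Qed.

Lemma abs_summable_le u (v : nat -> R) :
  (forall k, (Cmod (u k) <= v k)%R) -> ex_series v -> abs_summable u.
Proof.
move=> H; apply: (@ex_series_le R_AbsRing R_CompleteNormedModule) => n.
rewrite /norm /= /abs /= Rabs_pos_eq //; exact: Cmod_ge_0.
Qed.

Lemma filterlim_Cmod_le (u : nat -> C) (l : C) M :
  filterlim u eventually (locally l) -> eventually (fun n => (Cmod (u n) <= M)%R) ->
  (Cmod l <= M)%R.
Proof.
move=> /filterlim_C_eps H B; apply: le_epsilon => e e0.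
have [N HN] := filter_and _ _ (H _ e0) B.
have [h1 h2] := HN N (le_n _).
have := Cmod_triangle (u N) (l - u N).
replace (u N + (l - u N)) with l by ring.
rewrite -(Cmod_opp (l - _)); replace (- (l - u N)) with (u N - l) by ring; lra.
Qed.

Lemma Rsum_le_Series (v : nat -> R) n :
  (forall k, (0 <= v k)%R) -> ex_series v -> (\big[Rplus/0%R]_(k < n) v k <= Series v)%R.
Proof.
move=> v0 /Series_correct /is_series_big H.
apply: (is_lim_seq_le_loc (fun=> \big[Rplus/0%R]_(k < n) v k) _ _ _ _ (is_lim_seq_const _) H).
exists n => m; elim: m / => [|m _ IH]; first exact: Rle_refl.
rewrite (big_ord_recr m) /=; move: IH; have := v0 m; move: (bigop _ _ _) (bigop _ _ _) => x y; lra.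
Qed.

Lemma ex_series_bounded (v : nat -> R) M :
  (forall k, (0 <= v k)%R) -> (forall n, (\big[Rplus/0%R]_(k < n) v k <= M)%R) -> ex_series v.
Proof.
move=> v0 H.
have [l hl] : ex_finite_lim_seq (fun n => \big[Rplus/0%R]_(k < n) v k).
  apply: (ex_finite_lim_seq_incr _ M) => // n.
  by rewrite big_ord_recr /=; have := v0 n; lra.
by exists l; apply/is_series_big.
Qed.

Lemma Cmod_CSeries_le u (v : nat -> R) :
  (forall k, (Cmod (u k) <= v k)%R) -> ex_series v -> (Cmod (CSeries u) <= Series v)%R.
Proof.
move=> uv ev; have /is_Cseries_big H := CSeries_correct (abs_summable_le uv ev).
apply: (filterlim_Cmod_le H); exists 0%N => n _.
apply: Rle_trans (Cmod_sum _ _ _) _.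
apply: (Rle_trans _ (\big[Rplus/0%R]_(k < n) v k)); first exact: Rsum_le.
apply: Rsum_le_Series => // k; exact: Rle_trans (Cmod_ge_0 _) (uv k).
Qed.

(** * Integrals along curves in the complex plane *)

(** [ring] and [field] recognize [C] under its own name only, not as the
    carrier of a normed module. *)
Ltac Ceq := match goal with |- @eq _ ?a ?b => change (@eq C a b) end.

Lemma Cmod_le_sum (c : C) : (Cmod c <= Rabs (Re c) + Rabs (Im c))%R.
Proof.
have -> : c = (Re c, 0%R) + Ci * (Im c, 0%R).
  by case: c => a b; rewrite /Cmult /Cplus /=; congr (_, _); ring.
apply: Rle_trans (Cmod_triangle _ _) _.
rewrite Cmod_mult Cmod_Ci Rmult_1_l !Cmod_R /=.
have -> : (Re c + (0 * Im c - 1 * 0) = Re c)%R by ring.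
have -> : (0 + (0 * 0 + 1 * Im c) = Im c)%R by ring.
exact: Rle_refl.
Qed.

(** The epsilon form hides that source and target carry different but
    equivalent uniform structures. *)
Lemma is_C_derive_eps (f : C -> C) (z l : C) :
  @is_derive C_AbsRing C_NormedModule f z l <->
  forall eps : R, (0 < eps)%R -> exists2 d : R, (0 < d)%R &
    forall w, (Cmod (w - z) < d)%R ->
      (Cmod (f w - f z - l * (w - z)) <= eps * Cmod (w - z))%R.
Proof.
split.
  move=> [_ H] eps e0.
  have [//|d Hd] := H z _ (mkposreal _ e0).
  exists d; first exact: cond_pos.
  move=> w Hw; have := Hd w Hw.
  change (Cmod (f w - f z - (w - z) * l) <= eps * Cmod (w - z) ->
    Cmod (f w - f z - l * (w - z)) <= eps * Cmod (w - z))%R.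
  by rewrite (Cmult_comm l).
move=> H; split; first exact: is_linear_scal_l.
move=> y Hy eps.
have -> : y = z.
  by apply/esym; apply: (@is_filter_lim_locally_unique C_AbsRing (AbsRing_NormedModule C_AbsRing)).
have [d d0 Hd] := H eps (cond_pos eps).
exists (mkposreal d d0) => w Hw.
have := Hd w Hw.
change (Cmod (f w - f z - l * (w - z)) <= eps * Cmod (w - z) ->
  Cmod (f w - f z - (w - z) * l) <= eps * Cmod (w - z))%R.
by rewrite (Cmult_comm l).
Qed.

Lemma complex_derivable_continuous (f : C -> C) (z : C) :
  complex_derivable f z -> @continuous C_UniformSpace C_UniformSpace f z.
Proof.
have FF : Filter (@locally C_UniformSpace z) := @filter_filter _ _ (locally_filter _).
move=> [l /is_C_derive_eps H]; apply/filterlim_C_eps => eps e0.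
have [d d0 Hd] := H 1%R Rlt_0_1.
set M := (2 + Cmod l)%R.
have M0 : (0 < M)%R by rewrite /M; have := Cmod_ge_0 l; lra.
have dM : (0 < Rmin d (eps / M))%R by apply: Rmin_pos => //; apply: Rdiv_lt_0_compat.
have HL := (proj1 (filterlim_C_eps _ id z) (filterlim_id _ _) _ dM).
apply: (@filter_imp _ _ FF _ _ _ (HL FF)) => w Hw.
have h1 : (Cmod (w - z) < d)%R by apply: Rlt_le_trans Hw _; apply: Rmin_l.
have h2 : (Cmod (w - z) < eps / M)%R by apply: Rlt_le_trans Hw _; apply: Rmin_r.
have h3 := Hd w h1.
have := Cmod_triangle (f w - f z - l * (w - z)) (l * (w - z)).
rewrite Cmod_mult; replace (f w - f z - l * (w - z) + l * (w - z)) with (f w - f z) by ring.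
move=> h4; apply: (Rle_lt_trans _ (M * Cmod (w - z))).
  rewrite /M; have := Cmod_ge_0 (w - z); nra.
have := Rmult_lt_compat_l _ _ _ M0 h2.
by replace (M * (eps / M))%R with eps; [|field; lra].
Qed.

Notation is_derive_RC f t l := (@is_derive R_AbsRing C_R_NormedModule f t l).
Notation continuous_RC f t := (@continuous R_UniformSpace C_UniformSpace f t).
Notation RIntC := (@RInt C_R_CompleteNormedModule).
Notation ex_RIntC := (@ex_RInt C_R_NormedModule).

Lemma is_derive_RC_ReIm (f : R -> C) t (l : C) :
  is_derive_RC f t l <->
  is_derive (fun x => Re (f x)) t (Re l) /\ is_derive (fun x => Im (f x)) t (Im l).
Proof.
split.
  move=> [_ H]; split; (split; first exact: is_linear_scal_l);
    move=> y Hy eps; apply: filter_imp (H y Hy eps) => w;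
    rewrite -Cmod_norm => Hw; apply: Rle_trans Hw; set X := (X in Cmod X);
    [exact: (re_le_Cmod X) | exact: (Im_le_Cmod X)].
move=> [h1 h2].
split; first exact: is_linear_scal_l.
move=> y Hy eps.
have -> : y = t by apply/esym; apply: (@is_filter_lim_locally_unique R_AbsRing (AbsRing_NormedModule R_AbsRing)).
have tt : is_filter_lim (locally t) t by [].
have e2 : (0 < eps / 2)%R by have := cond_pos eps; lra.
have [d Hd] := filter_and _ _ (proj2 h1 t tt (mkposreal _ e2)) (proj2 h2 t tt (mkposreal _ e2)).
exists d => w /Hd [H1 H2].
rewrite -Cmod_norm; apply: (Rle_trans _ _ _ (Cmod_le_sum _)).
have E2 : (eps : R) = (eps / 2 + eps / 2)%R by field.
rewrite E2 Rmult_plus_distr_r; exact: Rplus_le_compat H1 H2.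
Qed.

Lemma is_derive_RC_mult (f g : R -> C) t (f' g' : C) :
  is_derive_RC f t f' -> is_derive_RC g t g' ->
  is_derive_RC (fun x => f x * g x) t (f' * g t + f t * g').
Proof.
move=> /is_derive_RC_ReIm [h1 h2] /is_derive_RC_ReIm [h3 h4].
have cm (n m : R_AbsRing) : mult n m = mult m n by exact: Rmult_comm.
apply/is_derive_RC_ReIm; split.
  have := @is_derive_minus R_AbsRing R_NormedModule _ _ _ _ _
    (is_derive_mult _ _ _ _ _ h1 h3 cm) (is_derive_mult _ _ _ _ _ h2 h4 cm).
  set l := (X in is_derive _ _ X) => h.
  suff -> : Re (f' * g t + f t * g') = l by exact: h.
  change (Re (f' * g t + f t * g') =
    (Re f' * Re (g t) + Re (f t) * Re g') - (Im f' * Im (g t) + Im (f t) * Im g'))%R.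
  by rewrite /= /Re /Im; ring.
have := @is_derive_plus R_AbsRing R_NormedModule _ _ _ _ _
  (is_derive_mult _ _ _ _ _ h1 h4 cm) (is_derive_mult _ _ _ _ _ h2 h3 cm).
set l := (X in is_derive _ _ X) => h.
suff -> : Im (f' * g t + f t * g') = l by exact: h.
change (Im (f' * g t + f t * g') =
  (Re f' * Im (g t) + Re (f t) * Im g') + (Im f' * Re (g t) + Im (f t) * Re g'))%R.
by rewrite /= /Re /Im; ring.
Qed.

Lemma is_derive_RC_plus (f g : R -> C) t (f' g' : C) :
  is_derive_RC f t f' -> is_derive_RC g t g' ->
  is_derive_RC (fun x => f x + g x) t (f' + g').
Proof. exact: (@is_derive_plus _ C_R_NormedModule). Qed.

Lemma is_derive_RC_const (c : C) t : is_derive_RC (fun _ : R => c) t (RtoC 0).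
Proof. exact: (@is_derive_const _ C_R_NormedModule). Qed.

Lemma is_derive_RtoC t : is_derive_RC RtoC t (RtoC 1).
Proof.
by apply/is_derive_RC_ReIm; split => /=; [exact: is_derive_id | exact: is_derive_const].
Qed.

Lemma is_derive_RC_continuous (f : R -> C) t l :
  is_derive_RC f t l -> continuous_RC f t.
Proof. by move=> H; apply: (@ex_derive_continuous _ C_R_NormedModule); exists l. Qed.

Lemma continuous_RC_ReIm (f : R -> C) t :
  continuous_RC f t <->
  continuous (fun x => Re (f x)) t /\ continuous (fun x => Im (f x)) t.
Proof. exact: filterlim_C_ReIm. Qed.

Lemma continuous_RC_mult (f g : R -> C) t :
  continuous_RC f t -> continuous_RC g t -> continuous_RC (fun x => f x * g x) t.
Proof.
move=> /continuous_RC_ReIm [h1 h2] /continuous_RC_ReIm [h3 h4].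
apply/continuous_RC_ReIm; split => /=.
  apply: (@continuous_minus _ _ R_NormedModule).
    exact: (@continuous_mult _ R_AbsRing).
  exact: (@continuous_mult _ R_AbsRing).
apply: (@continuous_plus _ _ R_NormedModule).
  exact: (@continuous_mult _ R_AbsRing).
exact: (@continuous_mult _ R_AbsRing).
Qed.

Lemma continuous_RC_const (c : C) t : continuous_RC (fun _ => c) t.
Proof. exact: continuous_const. Qed.

Lemma continuous_Cmod (f : R -> C) t : continuous_RC f t -> continuous (fun x => Cmod (f x)) t.
Proof.
move/filterlim_C_eps => H; apply/filterlim_locally => eps.
apply: filter_imp (H eps (cond_pos eps)) => x Hx.
apply: Rle_lt_trans Hx.
have h1 := Cmod_triangle (f x - f t) (f t).
have h2 := Cmod_triangle (f t - f x) (f x).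
have e1 : f x - f t + f t = f x by ring.
have e2 : f t - f x + f x = f t by ring.
rewrite e1 in h1; rewrite e2 in h2.
rewrite -(Cmod_opp (f t - f x)) in h2.
have e3 : - (f t - f x) = f x - f t by ring.
rewrite e3 in h2.
rewrite /abs /= /minus /plus /opp /=; apply: Rabs_le; lra.
Qed.

Lemma continuous_comp_RC (g : C -> C) (f : R -> C) t :
  continuous_RC f t -> complex_derivable g (f t) -> continuous_RC (fun x => g (f x)) t.
Proof.
move=> h1 /complex_derivable_continuous h2; exact: (continuous_comp f g t h1 h2).
Qed.

Lemma Cmod_RInt_le (f : R -> C) a b M : (a <= b)%R ->
  (forall t, (a <= t <= b)%R -> (Cmod (f t) <= M)%R) ->
  (forall t, (a <= t <= b)%R -> continuous_RC f t) ->
  (Cmod (RIntC f a b) <= M * (b - a))%R.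
Proof.
move=> ab H cf; rewrite Cmod_norm Rmult_comm.
apply: (@norm_RInt_le_const C_R_NormedModule f a b _ M ab).
  by move=> x Hx; rewrite -Cmod_norm; apply: H.
apply: (@RInt_correct C_R_CompleteNormedModule); apply: (@ex_RInt_continuous C_R_CompleteNormedModule) => z.
by rewrite Rmin_left // Rmax_right //; apply: cf.
Qed.

Lemma ex_RIntC_continuous (f : R -> C) a b : (a <= b)%R ->
  (forall t, (a <= t <= b)%R -> continuous_RC f t) -> ex_RIntC f a b.
Proof.
move=> ab cf; apply: (@ex_RInt_continuous C_R_CompleteNormedModule) => z.
by rewrite Rmin_left // Rmax_right //; apply: cf.
Qed.

Lemma Cmod_RInt_le_Rint (f : R -> C) a b : (a <= b)%R ->
  (forall t, (a <= t <= b)%R -> continuous_RC f t) ->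
  (Cmod (RIntC f a b) <= RInt (fun t => Cmod (f t)) a b)%R.
Proof.
move=> ab cf; rewrite Cmod_norm.
apply: (@norm_RInt_le C_R_NormedModule f (fun t => Cmod (f t)) a b _ _ ab).
- by move=> x Hx; rewrite -Cmod_norm; exact: Rle_refl.
- by apply: (@RInt_correct C_R_CompleteNormedModule); apply: ex_RIntC_continuous.
apply: (@RInt_correct R_CompleteNormedModule); apply: (@ex_RInt_continuous R_CompleteNormedModule) => z.
by rewrite Rmin_left // Rmax_right // => Hz; apply/continuous_Cmod/cf.
Qed.

Lemma RIntC_derive (f df : R -> C) a b : (a <= b)%R ->
  (forall t, (a <= t <= b)%R -> is_derive_RC f t (df t)) ->
  (forall t, (a <= t <= b)%R -> continuous_RC df t) ->
  RIntC df a b = f b - f a.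
Proof.
move=> ab h1 h2; apply: is_RInt_unique.
apply: (@is_RInt_derive C_R_CompleteNormedModule) => x;
  rewrite Rmin_left // Rmax_right //; [exact: h1 | exact: h2].
Qed.

(** The local step of Goursat's argument: an affine function has the
    primitive [P], so its integral along a curve depends only on the end
    points, and only the deviation from the affine function costs anything.
    The curve is [f], and [A + D (z - z0)] will be the first-order expansion
    of [g] at [z0]. *)
Lemma path_integral_near_affine (g : C -> C) (f df : R -> C) (a b : R) (A D z0 : C) (E L : R) :
  (a <= b)%R -> (0 <= E)%R ->
  (forall t, (a <= t <= b)%R -> is_derive_RC f t (df t)) ->
  (forall t, (a <= t <= b)%R -> continuous_RC df t) ->
  (forall t, (a <= t <= b)%R -> (Cmod (df t) <= L)%R) ->
  (forall t, (a <= t <= b)%R -> complex_derivable g (f t)) ->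
  (forall t, (a <= t <= b)%R -> (Cmod (g (f t) - A - D * (f t - z0)) <= E)%R) ->
  let P z := (A * z + D * ((z - z0) * (z - z0)) / 2) in
  (Cmod (RIntC (fun t => (g (f t) * df t)%C) a b - (P (f b) - P (f a))) <= E * L * (b - a))%R.
Proof.
move=> ab E0 Hd cd dL gd gE P.
have cf t : (a <= t <= b)%R -> continuous_RC f t.
  by move=> /Hd; apply: is_derive_RC_continuous.
have HP t : (a <= t <= b)%R ->
    is_derive_RC (fun x => P (f x)) t ((A + D * (f t - z0)) * df t).
  move=> /Hd ht.
  have hc := is_derive_RC_plus ht (is_derive_RC_const (- z0) t).
  have h := is_derive_RC_plus (is_derive_RC_mult (is_derive_RC_const A t) ht)
    (is_derive_RC_mult (is_derive_RC_const (D / 2) t) (is_derive_RC_mult hc hc)).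
  set l := (X in is_derive_RC _ _ X) in h.
  have -> : (A + D * (f t - z0)) * df t = l by rewrite /l; field.
  apply: (@is_derive_ext _ C_R_NormedModule _ _ _ _ _ h) => x.
  by rewrite /P; Ceq; field.
have caff t : (a <= t <= b)%R -> continuous_RC (fun x => (A + D * (f x - z0)) * df x) t.
  move=> ht; apply: continuous_RC_mult; last exact: cd.
  apply: (@continuous_plus _ _ C_R_NormedModule); first exact: continuous_RC_const.
  apply: continuous_RC_mult; first exact: continuous_RC_const.
  apply: (@continuous_minus _ _ C_R_NormedModule); [exact: cf | exact: continuous_RC_const].
have cg t : (a <= t <= b)%R -> continuous_RC (fun x => g (f x) * df x) t.
  move=> ht; apply: continuous_RC_mult; last exact: cd.
  by apply: continuous_comp_RC; [exact: cf | exact: gd].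
rewrite -(RIntC_derive ab HP caff).
rewrite -[_ - _]/(minus (_ : C_R_NormedModule) _).
rewrite -(@RInt_minus C_R_CompleteNormedModule); try exact: ex_RIntC_continuous.
apply: Cmod_RInt_le => // t ht.
  have -> : minus (g (f t) * df t : C_R_NormedModule) ((A + D * (f t - z0)) * df t) =
     (g (f t) - A - D * (f t - z0)) * df t.
    by rewrite /minus /plus /opp /=; change (g (f t) * df t - ((A + D * (f t - z0)) * df t) = (g (f t) - A - D * (f t - z0)) * df t); ring.
  rewrite Cmod_mult; apply: Rmult_le_compat; try exact: Cmod_ge_0.
    exact: gE.
  exact: dL.
by apply: (@continuous_minus _ _ C_R_NormedModule); [exact: cg | exact: caff].
Qed.

(** * Goursat's bisection argument *)

Lemma nested_intervals (u w : nat -> R) :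
  (forall n, (u n <= u n.+1)%R) -> (forall n, (w n.+1 <= w n)%R) ->
  (forall n, (u n <= w n)%R) -> exists x, forall n, (u n <= x <= w n)%R.
Proof.
move=> iu dw uw.
have mu n k : (u n <= u (n + k)%N)%R.
  elim: k => [|k IH]; first by rewrite addn0; apply: Rle_refl.
  by rewrite addnS; apply: Rle_trans IH (iu _).
have mw n k : (w (n + k)%N <= w n)%R.
  elim: k => [|k IH]; first by rewrite addn0; apply: Rle_refl.
  by rewrite addnS; apply: Rle_trans (dw _) IH.
have um m n : (u m <= w n)%R.
  apply: Rle_trans (mu m n) _; apply: Rle_trans (uw _) _.
  by rewrite addnC; apply: mw.
have [|//|x [hx1 hx2]] := completeness (fun r => exists n, r = u n).
- by exists (w 0%N) => _ [n ->].
- by exists (u 0%N), 0%N.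
exists x => n; split; first by apply: hx1; exists n.
by apply: hx2 => _ [m ->].
Qed.

(** Goursat's argument without the integrals. If [B] is nonzero on the whole
    rectangle, one of its four quarters carries at least a quarter of the
    value, and so on; the nested rectangles shrink to a point [(X, Y)], near
    which [B] is required to be [o(diameter^2)], a contradiction.  The bound
    concerns rectangles containing the point, which is what pointwise
    differentiability gives. *)
Lemma additive_rectangle_function_eq0 (B : R -> R -> R -> R -> C) (a b c d : R) :
  (a < b)%R -> (c < d)%R ->
  (forall x0 x1 x2 y0 y1, (a <= x0 <= x1)%R -> (x1 <= x2 <= b)%R ->
     (c <= y0 <= y1)%R -> (y1 <= d)%R ->
     B x0 x2 y0 y1 = B x0 x1 y0 y1 + B x1 x2 y0 y1) ->
  (forall x0 x1 y0 y1 y2, (a <= x0 <= x1)%R -> (x1 <= b)%R ->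
     (c <= y0 <= y1)%R -> (y1 <= y2 <= d)%R ->
     B x0 x1 y0 y2 = B x0 x1 y0 y1 + B x0 x1 y1 y2) ->
  (forall x y, (a <= x <= b)%R -> (c <= y <= d)%R -> forall e, (0 < e)%R ->
     exists2 dl, (0 < dl)%R & forall x0 x1 y0 y1,
       (a <= x0 <= x)%R -> (x <= x1 <= b)%R -> (c <= y0 <= y)%R -> (y <= y1 <= d)%R ->
       (x1 - x0 + (y1 - y0) < dl)%R ->
       (Cmod (B x0 x1 y0 y1) <= e * (x1 - x0 + (y1 - y0)) ^ 2)%R) ->
  B a b c d = 0.
Proof.
move=> ab cd addx addy loc.
apply: Cmod_eq_0; apply: NNPP => B0.
have {}B0 : (0 < Cmod (B a b c d))%R by have := Cmod_ge_0 (B a b c d); lra.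
pose h := (b - a)%R; pose k := (d - c)%R.
have h0 : (0 < h)%R by rewrite /h; lra.
have k0 : (0 < k)%R by rewrite /k; lra.
have hk0 : (0 < (h + k) ^ 2)%R by apply: pow_lt; lra.
(* Half of the mean value of |B| relative to (h + k)^2, so that the bound
   [bad] holds strictly at the start. *)
pose e := (Cmod (B a b c d) / (2 * (h + k) ^ 2))%R.
have e0 : (0 < e)%R by apply: Rdiv_lt_0_compat => //; lra.
pose s n := ((/ 2) ^ n)%R.
have s0 n : (0 < s n)%R by apply: pow_lt; lra.
have sS n : (s n = s n.+1 + s n.+1)%R by rewrite /s /=; lra.
pose bad n (p : R * R) := [/\ (a <= p.1)%R, (p.1 + h * s n <= b)%R,
  (c <= p.2)%R, (p.2 + k * s n <= d)%R &
  (e * ((h + k) * s n) ^ 2 < Cmod (B p.1 (p.1 + h * s n) p.2 (p.2 + k * s n)))%R].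
pose next n (p q : R * R) := [/\ bad n.+1 q, (p.1 <= q.1)%R,
  (q.1 + h * s n.+1 <= p.1 + h * s n)%R, (p.2 <= q.2)%R &
  (q.2 + k * s n.+1 <= p.2 + k * s n)%R].
have step n p : bad n p -> exists q, next n p q.
  case: p => x y [/= h1 h2 h3 h4 h5].
  apply: NNPP => nex.
  have hs := Rmult_lt_0_compat _ _ h0 (s0 n.+1).
  have ks := Rmult_lt_0_compat _ _ k0 (s0 n.+1).
  have hsS : (h * s n = h * s n.+1 + h * s n.+1)%R by rewrite (sS n); ring.
  have ksS : (k * s n = k * s n.+1 + k * s n.+1)%R by rewrite (sS n); ring.
  have small q : (x <= q.1)%R -> (q.1 + h * s n.+1 <= x + h * s n)%R ->
      (y <= q.2)%R -> (q.2 + k * s n.+1 <= y + k * s n)%R ->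
      (Cmod (B q.1 (q.1 + h * s n.+1) q.2 (q.2 + k * s n.+1))
        <= e * ((h + k) * s n.+1) ^ 2)%R.
    move=> q1 q2 q3 q4; apply: Rnot_lt_le => q5; apply: nex; exists q.
    by split=> //=; split => //=; lra.
  have := small (x, y); have := small (x, y + k * s n.+1)%R.
  have := small (x + h * s n.+1, y)%R; have := small (x + h * s n.+1, y + k * s n.+1)%R.
  rewrite /= => S1 S2 S3 S4.
  have {S1} := S1 ltac:(lra) ltac:(lra) ltac:(lra) ltac:(lra).
  have {S2} := S2 ltac:(lra) ltac:(lra) ltac:(lra) ltac:(lra).
  have {S3} := S3 ltac:(lra) ltac:(lra) ltac:(lra) ltac:(lra).
  have {S4} := S4 ltac:(lra) ltac:(lra) ltac:(lra) ltac:(lra).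
  move=> S4 S3 S2 S1.
  move: h5; rewrite (addx x (x + h * s n.+1)%R); try lra.
  rewrite (addy _ _ y (y + k * s n.+1)%R); try lra.
  rewrite (addy _ _ y (y + k * s n.+1)%R (y + k * s n)%R); try lra.
  have -> : (x + h * s n = x + h * s n.+1 + h * s n.+1)%R by rewrite hsS; ring.
  have -> : (y + k * s n = y + k * s n.+1 + k * s n.+1)%R by rewrite ksS; ring.
  set b1 := B _ _ _ _; set b2 := B _ _ _ _; set b3 := B _ _ _ _; set b4 := B _ _ _ _.
  have t1 := Cmod_triangle (b1 + b2) (b3 + b4).
  have t2 := Cmod_triangle b1 b2.
  have t3 := Cmod_triangle b3 b4.
  have -> : (e * ((h + k) * s n) ^ 2 = 4 * (e * ((h + k) * s n.+1) ^ 2))%R.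
    by rewrite (sS n) /=; ring.
  rewrite -/b1 in S4; rewrite -/b2 in S3; rewrite -/b3 in S2; rewrite -/b4 in S1.
  lra.
pose f := fix f n := if n is m.+1 then epsilon (inhabits (a, c)) (next m (f m)) else (a, c).
have bad_f n : bad n (f n).
  elim: n => [|n IH].
    rewrite /bad /= /s /=.
    have -> : (a + h * 1 = b)%R by rewrite /h; ring.
    have -> : (c + k * 1 = d)%R by rewrite /k; ring.
    split; try lra.
    have -> : (e * ((h + k) * 1 * ((h + k) * 1 * 1)) = Cmod (B a b c d) / 2)%R.
      by rewrite /e /=; field; rewrite /= in hk0; lra.
    lra.
  by have [] := epsilon_spec (inhabits (a, c)) _ (step n _ IH).
have next_f n : next n (f n) (f n.+1) by apply: (epsilon_spec (inhabits (a, c)) _ (step n _ (bad_f n))).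
have [X HX] : exists x, forall n, ((f n).1 <= x <= (f n).1 + h * s n)%R.
  apply: nested_intervals => n; try by case: (next_f n).
  by have := Rmult_lt_0_compat _ _ h0 (s0 n); lra.
have [Y HY] : exists x, forall n, ((f n).2 <= x <= (f n).2 + k * s n)%R.
  apply: nested_intervals => n; try by case: (next_f n).
  by have := Rmult_lt_0_compat _ _ k0 (s0 n); lra.
have HXb := HX 0%N; have HYb := HY 0%N.
rewrite /= /s /= !Rmult_1_r in HXb HYb.
have [dl dl0 Hdl] := loc X Y ltac:(rewrite /h in HXb; lra) ltac:(rewrite /k in HYb; lra) e e0.
have [n Hn] := pow_lt_1_zero (/ 2) ltac:(rewrite Rabs_pos_eq; lra) (dl / (h + k)) ltac:(apply: Rdiv_lt_0_compat; lra).
have := Hn n (le_n n); rewrite -/(s n) Rabs_pos_eq; last exact: Rlt_le.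
move=> Hs.
have hs : ((h + k) * s n < dl)%R.
  have := Rmult_lt_compat_l (h + k) _ _ ltac:(lra) Hs.
  by have -> : ((h + k) * (dl / (h + k)) = dl)%R by field; lra.
have [g1 g2 g3 g4 g5] := bad_f n.
have E : ((f n).1 + h * s n - (f n).1 + ((f n).2 + k * s n - (f n).2) = (h + k) * s n)%R by ring.
have := Hdl (f n).1 ((f n).1 + h * s n)%R (f n).2 ((f n).2 + k * s n)%R.
rewrite E; have := HX n; have := HY n => HYn HXn H.
have := H ltac:(lra) ltac:(lra) ltac:(lra) ltac:(lra) hs; lra.
Qed.

(** * Contracting a closed curve to a point *)

(** The closed curve [gam] is contracted to [z0] along straight lines by
    [Phi x t = z0 + x (gam t - z0)].  Integrating [g] over the boundary of
    the image of a parameter rectangle gives an additive rectangle function,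
    which vanishes by bisection.  On [[a, 1] x [0, T]] the sides [t = 0] and
    [t = T] cancel, so the integral over [gam] equals the one over the curve
    shrunk by the factor [a], which is [O(a)] because [g] is bounded near
    [z0].  Boundedness near [z0] is what a slope [(f w - f z0) / (w - z0)]
    offers there. *)
Section Homotopy.
Variables (g : C -> C) (z0 : C) (gam dgam : R -> C) (T L M eta : R).
Hypothesis T0 : (0 < T)%R.
Hypothesis L0 : (0 < L)%R.
Hypothesis eta0 : (0 < eta)%R.
Hypothesis gamD : forall t, is_derive_RC gam t (dgam t).
Hypothesis dgamC : forall t, continuous_RC dgam t.
Hypothesis dgamL : forall t, (Cmod (dgam t) <= L)%R.
Hypothesis gamL : forall t, (Cmod (gam t - z0) <= L)%R.
Hypothesis gamT : gam 0%R = gam T.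
Hypothesis gD : forall x t, (0 < x <= 1)%R -> (0 <= t <= T)%R ->
  complex_derivable g (z0 + x * (gam t - z0)).
Hypothesis gM : forall z, (Cmod (z - z0) < eta)%R -> (Cmod (g z) <= M)%R.

Let Phi x t := z0 + RtoC x * (gam t - z0).
Let hside a b t : C := RIntC (fun x => g (Phi x t) * (gam t - z0)) a b.
Let vside x c d : C := RIntC (fun t => g (Phi x t) * (RtoC x * dgam t)) c d.
Let B a b c d := hside a b c + vside b c d - hside a b d - vside a c d.

Let Phi_dx x t : is_derive_RC (fun x => Phi x t) x (gam t - z0).
Proof.
have h := is_derive_RC_plus (is_derive_RC_const z0 x)
  (is_derive_RC_mult (is_derive_RtoC x) (is_derive_RC_const (gam t - z0) x)).
set l := (X in is_derive_RC _ _ X) in h.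
suff -> : gam t - z0 = l by [].
by rewrite /l; ring.
Qed.

Let Phi_dt x t : is_derive_RC (fun t => Phi x t) t (RtoC x * dgam t).
Proof.
have h := is_derive_RC_plus (is_derive_RC_const z0 t)
  (is_derive_RC_mult (is_derive_RC_const (RtoC x) t)
     (is_derive_RC_plus (gamD t) (is_derive_RC_const (- z0) t))).
set l := (X in is_derive_RC _ _ X) in h.
suff -> : RtoC x * dgam t = l by [].
by rewrite /l; ring.
Qed.

Let cont_h x t : (0 < x <= 1)%R -> (0 <= t <= T)%R ->
  continuous_RC (fun x => g (Phi x t) * (gam t - z0)) x.
Proof.
move=> hx ht; apply: continuous_RC_mult; last exact: continuous_RC_const.
apply: (@continuous_comp_RC g (fun x => Phi x t)); last exact: gD.
exact: is_derive_RC_continuous (Phi_dx x t).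
Qed.

Let cont_v x t : (0 < x <= 1)%R -> (0 <= t <= T)%R ->
  continuous_RC (fun t => g (Phi x t) * (RtoC x * dgam t)) t.
Proof.
move=> hx ht; apply: continuous_RC_mult; last first.
  by apply: continuous_RC_mult; [exact: continuous_RC_const | exact: dgamC].
apply: (@continuous_comp_RC g (fun t => Phi x t)); last exact: gD.
exact: is_derive_RC_continuous (Phi_dt x t).
Qed.

Let Cmod_RtoC_le x : (0 < x <= 1)%R -> (Cmod (RtoC x) <= 1)%R.
Proof. by move=> hx; rewrite Cmod_R Rabs_pos_eq; lra. Qed.

Let gam_lip t t' : (t <= t')%R -> (Cmod (gam t' - gam t) <= L * (t' - t))%R.
Proof.
move=> tt; rewrite -(RIntC_derive (df := dgam) tt); try by move=> *; auto.
by apply: Cmod_RInt_le => // *; auto.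
Qed.

Let Phi_lip x x' t t' : (0 < x <= 1)%R ->
  (Cmod (Phi x' t' - Phi x t) <= L * (Rabs (x' - x) + Rabs (t' - t)))%R.
Proof.
move=> hx.
have -> : Phi x' t' - Phi x t = RtoC (x' - x) * (gam t' - z0) + RtoC x * (gam t' - gam t).
  by rewrite /Phi RtoC_minus; ring.
apply: Rle_trans (Cmod_triangle _ _) _; rewrite !Cmod_mult Cmod_R.
have h1 := gamL t'; have h2 := Cmod_RtoC_le hx; have h3 := Cmod_ge_0 (gam t' - gam t).
have h4 := Cmod_ge_0 (RtoC x); have h5 := Rabs_pos (x' - x); have h6 := Rabs_pos (t' - t).
have h7 : (Cmod (gam t' - gam t) <= L * Rabs (t' - t))%R.
  case: (Rle_dec t t') => tt; first by rewrite (Rabs_pos_eq (t' - t)); [exact: gam_lip | lra].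
  have {}tt : (t' <= t)%R by lra.
  have -> : gam t' - gam t = - (gam t - gam t') by ring.
  rewrite Cmod_opp Rabs_minus_sym Rabs_pos_eq; [exact: gam_lip | lra].
rewrite Rmult_plus_distr_l; apply: Rplus_le_compat; first by rewrite Rmult_comm; apply: Rmult_le_compat_r.
rewrite -(Rmult_1_l (L * _)); apply: Rmult_le_compat => //.
Qed.

(** Each of the four sides is compared with the increments of the primitive
    of the first-order expansion of [g]; these increments telescope around
    the rectangle. *)
Let B_local x y : (0 < x <= 1)%R -> (0 <= y <= T)%R -> forall e, (0 < e)%R ->
  exists2 dl, (0 < dl)%R & forall x0 x1 y0 y1,
    (0 < x0 <= x)%R -> (x <= x1 <= 1)%R -> (0 <= y0 <= y)%R -> (y <= y1 <= T)%R ->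
    (x1 - x0 + (y1 - y0) < dl)%R ->
    (Cmod (B x0 x1 y0 y1) <= e * (x1 - x0 + (y1 - y0)) ^ 2)%R.
Proof.
move=> hx hy e e0.
have [D /is_C_derive_eps HD] := gD hx hy.
have LL : (0 < 2 * L * L)%R by nra.
have [dl dl0 Hdl] := HD (e / (2 * L * L))%R (Rdiv_lt_0_compat _ _ e0 LL).
exists (dl / L)%R; first exact: Rdiv_lt_0_compat.
move=> x0 x1 y0 y1 hx0 hx1 hy0 hy1 hs.
set S := (x1 - x0 + (y1 - y0))%R in hs *.
have S0 : (0 <= S)%R by rewrite /S; lra.
have LS : (L * S < dl)%R.
  have := Rmult_lt_compat_l L _ _ L0 hs.
  by have -> : (L * (dl / L) = dl)%R by field; lra.
set z := z0 + x * (gam y - z0) in HD Hdl.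
pose E := (e / (2 * L * L) * (L * S))%R.
have E0 : (0 <= E)%R.
  by apply: Rmult_le_pos; [apply/Rlt_le/Rdiv_lt_0_compat | nra].
have near u v : (x0 <= u <= x1)%R -> (y0 <= v <= y1)%R ->
    (Cmod (g (Phi u v) - g z - D * (Phi u v - z)) <= E)%R.
  move=> hu hv.
  have h1 : (Cmod (Phi u v - z) <= L * S)%R.
    apply: Rle_trans (Phi_lip u y v hx) _; apply: Rmult_le_compat_l; first lra.
    apply: Rplus_le_compat; apply: Rabs_le; lra.
  apply: Rle_trans (Hdl _ _) _; first lra.
  by apply: Rmult_le_compat_l => //; apply/Rlt_le/Rdiv_lt_0_compat.
pose P w := g z * w + D * ((w - z) * (w - z)) / 2.
have Hh v : (y0 <= v <= y1)%R ->
    (Cmod (hside x0 x1 v - (P (Phi x1 v) - P (Phi x0 v))) <= E * L * (x1 - x0))%R.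
  move=> hv.
  apply: (@path_integral_near_affine g (fun u => Phi u v) (fun=> gam v - z0) x0 x1 (g z) D z E L); try lra.
  - by move=> t ht; apply: Phi_dx.
  - by move=> t ht; apply: continuous_RC_const.
  - by move=> t ht; apply: gamL.
  - by move=> t ht; apply: gD; lra.
  - by move=> t ht; apply: near.
have Hv u : (x0 <= u <= x1)%R ->
    (Cmod (vside u y0 y1 - (P (Phi u y1) - P (Phi u y0))) <= E * L * (y1 - y0))%R.
  move=> hu.
  apply: (@path_integral_near_affine g (fun v => Phi u v) (fun v => RtoC u * dgam v) y0 y1 (g z) D z E L); try lra.
  - by move=> t ht; apply: Phi_dt.
  - by move=> t ht; apply: continuous_RC_mult; [exact: continuous_RC_const | exact: dgamC].
  - move=> t ht; rewrite Cmod_mult -(Rmult_1_l L).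
    by apply: Rmult_le_compat => //; try exact: Cmod_ge_0; apply: Cmod_RtoC_le; lra.
  - by move=> t ht; apply: gD; lra.
  - by move=> t ht; apply: near.
set r1 := hside x0 x1 y0 - (P (Phi x1 y0) - P (Phi x0 y0)).
set r2 := vside x1 y0 y1 - (P (Phi x1 y1) - P (Phi x1 y0)).
set r3 := hside x0 x1 y1 - (P (Phi x1 y1) - P (Phi x0 y1)).
set r4 := vside x0 y0 y1 - (P (Phi x0 y1) - P (Phi x0 y0)).
have -> : B x0 x1 y0 y1 = (r1 + r2) + (- r3 + - r4).
  by rewrite /B /r1 /r2 /r3 /r4; ring.
have t1 := Cmod_triangle (r1 + r2) (- r3 + - r4).
have t2 := Cmod_triangle r1 r2; have t3 := Cmod_triangle (- r3) (- r4).
rewrite !Cmod_opp in t3.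
have b1 : (Cmod r1 <= E * L * (x1 - x0))%R by apply: Hh; lra.
have b2 : (Cmod r2 <= E * L * (y1 - y0))%R by apply: Hv; lra.
have b3 : (Cmod r3 <= E * L * (x1 - x0))%R by apply: Hh; lra.
have b4 : (Cmod r4 <= E * L * (y1 - y0))%R by apply: Hv; lra.
have -> : (e * S ^ 2 = 2 * (E * L * S))%R by rewrite /E; field; lra.
have -> : (E * L * S = E * L * (x1 - x0) + E * L * (y1 - y0))%R by rewrite /S; ring.
lra.
Qed.

Let B_eq0 a : (0 < a < 1)%R -> B a 1 0 T = 0.
Proof.
move=> ha; apply: additive_rectangle_function_eq0 => //; first lra.
- move=> x0 x1 x2 y0 y1 h1 h2 h3 h4.
  have ch t : (0 <= t <= T)%R -> hside x0 x2 t = hside x0 x1 t + hside x1 x2 t.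
    move=> ht; symmetry; apply: (@RInt_Chasles C_R_CompleteNormedModule);
    by apply: ex_RIntC_continuous => [|u hu]; [lra | apply: cont_h; lra].
  by rewrite /B (ch y0) ?(ch y1); try lra; ring.
- move=> x0 x1 y0 y1 y2 h1 h2 h3 h4.
  have cv t : (0 < t <= 1)%R -> vside t y0 y2 = vside t y0 y1 + vside t y1 y2.
    move=> ht; symmetry; apply: (@RInt_Chasles C_R_CompleteNormedModule);
    by apply: ex_RIntC_continuous => [|u hu]; [lra | apply: cont_v; lra].
  by rewrite /B (cv x0) ?(cv x1); try lra; ring.
move=> x y hx hy e e0.
have [dl dl0 Hdl] := @B_local x y ltac:(lra) hy e e0.
by exists dl => // x0 x1 y0 y1 *; apply: Hdl => //; lra.
Qed.

Lemma cauchy_homotopy_to_point : (RIntC (fun t => g (gam t) * dgam t) 0 T : C) = 0.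
Proof.
have -> : (RIntC (fun t => g (gam t) * dgam t) 0 T : C) = vside 1 0 T.
  apply: (@RInt_ext C_R_CompleteNormedModule) => t _.
  rewrite /Phi; Ceq; congr (g _ * _); ring.
have Eh a : hside a 1 0 = hside a 1 T by rewrite /hside /Phi gamT.
have v_eq a : (0 < a < 1)%R -> vside 1 0 T = vside a 0 T.
  move=> /B_eq0; rewrite /B Eh => H.
  have -> : vside 1 0 T = (hside a 1 T + vside 1 0 T - hside a 1 T - vside a 0 T) + vside a 0 T by ring.
  by rewrite H; ring.
have M0 : (0 <= M)%R.
  have h := @gM z0; have z00 : z0 - z0 = 0 by ring.
  by rewrite z00 Cmod_0 in h; apply: Rle_trans (h eta0); apply: Cmod_ge_0.
apply: Cmod_eq_0; apply: Rle_antisym; last exact: Cmod_ge_0.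
apply: le_epsilon => e e0; rewrite Rplus_0_l.
have K0 : (0 < M * L * T + 1)%R by have := Rmult_le_pos _ _ (Rmult_le_pos _ _ M0 (Rlt_le _ _ L0)) (Rlt_le _ _ T0); lra.
pose a := Rmin (/ 2) (Rmin (eta / (2 * L)) (e / (M * L * T + 1))).
have a1 : (a <= / 2)%R by apply: Rmin_l.
have a2 : (a <= eta / (2 * L))%R by apply: Rle_trans (Rmin_r _ _) (Rmin_l _ _).
have a3 : (a <= e / (M * L * T + 1))%R by apply: Rle_trans (Rmin_r _ _) (Rmin_r _ _).
have a0 : (0 < a)%R.
  by apply: Rmin_pos; [lra | apply: Rmin_pos; apply: Rdiv_lt_0_compat; lra].
rewrite (v_eq a); last lra.
apply: (Rle_trans _ (M * (a * L) * (T - 0))).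
  apply: Cmod_RInt_le; [lra| |by move=> t ht; apply: cont_v; lra].
  move=> t ht; rewrite !Cmod_mult Cmod_R Rabs_pos_eq; last lra.
  apply: Rmult_le_compat; try exact: Cmod_ge_0.
  - by apply: Rmult_le_pos; [lra | exact: Cmod_ge_0].
  - apply: gM; rewrite /Phi.
    have -> : z0 + a * (gam t - z0) - z0 = a * (gam t - z0) by ring.
    rewrite Cmod_mult Cmod_R Rabs_pos_eq; last lra.
    have h : (a * L <= eta / 2)%R.
      have -> : (eta / 2 = eta / (2 * L) * L)%R by field; lra.
      by apply: Rmult_le_compat_r => //; lra.
    have := Rmult_le_compat_l a _ _ (Rlt_le _ _ a0) (gamL t); lra.
  by apply: Rmult_le_compat_l; [lra | exact: dgamL].
have := Rmult_le_compat_l (M * L * T + 1) _ _ (Rlt_le _ _ K0) a3.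
have -> : ((M * L * T + 1) * (e / (M * L * T + 1)) = e)%R by field; lra.
lra.
Qed.
End Homotopy.

(** * Slopes of complex-differentiable functions *)

Notation is_Cderive := (@is_derive C_AbsRing C_NormedModule).

Lemma is_Cderive_AbsRing (f : C -> C) (z l : C) :
  is_Cderive f z l <-> @is_derive C_AbsRing (AbsRing_NormedModule C_AbsRing) f z l.
Proof.
split=> -[_ H]; (split; first exact: is_linear_scal_l) => y Hy eps; exact: (H y Hy eps).
Qed.

Lemma is_Cderive_mult (f g : C -> C) (z f' g' : C) :
  is_Cderive f z f' -> is_Cderive g z g' ->
  is_Cderive (fun x => f x * g x) z (f' * g z + f z * g').
Proof.
move=> /is_Cderive_AbsRing h1 /is_Cderive_AbsRing h2; apply/is_Cderive_AbsRing.
have cm (n m : C_AbsRing) : mult n m = mult m n by exact: Cmult_comm.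
exact: (is_derive_mult _ _ _ _ _ h1 h2 cm).
Qed.

Lemma is_Cderive_inv (z0 z : C) : z <> z0 ->
  is_Cderive (fun x => / (x - z0)) z (- (/ (z - z0) * / (z - z0))).
Proof.
move=> zz0; set c := Cmod (z - z0).
have nz : z - z0 <> 0 by move=> h; apply: zz0; rewrite -(Cplus_0_r z0) -h; ring.
have c0 : (0 < c)%R by apply/Cmod_gt_0.
apply/is_C_derive_eps => e e0.
have c3 : (0 < c * c * c)%R by apply: Rmult_lt_0_compat => //; apply: Rmult_lt_0_compat.
exists (Rmin (c / 2) (e * (c * c * c) / 2))%R.
  by apply: Rmin_pos; [lra | apply: Rdiv_lt_0_compat; [apply: Rmult_lt_0_compat|lra]].
move=> w hw.
have h1 : (Cmod (w - z) < c / 2)%R by apply: Rlt_le_trans hw (Rmin_l _ _).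
have h2 : (Cmod (w - z) < e * (c * c * c) / 2)%R by apply: Rlt_le_trans hw (Rmin_r _ _).
have h3 : (c / 2 < Cmod (w - z0))%R.
  have := Cmod_triangle (w - z0) (- (w - z)); rewrite Cmod_opp.
  have -> : w - z0 + - (w - z) = z - z0 by ring.
  rewrite -/c; lra.
have nw : w - z0 <> 0 by apply/Cmod_gt_0; lra.
have -> : / (w - z0) - / (z - z0) - - (/ (z - z0) * / (z - z0)) * (w - z)
   = (w - z) * ((w - z) / ((w - z0) * ((z - z0) * (z - z0)))).
  by field.
have nn : (w - z0) * ((z - z0) * (z - z0)) <> 0 by do !apply: Cmult_neq_0.
rewrite Cmod_mult Rmult_comm; apply: Rmult_le_compat_r; first exact: Cmod_ge_0.
rewrite Cmod_div // !Cmod_mult -/c.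
have p1 : (0 < Cmod (w - z0) * (c * c))%R by apply: Rmult_lt_0_compat; [lra | nra].
apply: (Rmult_le_reg_r _ _ _ p1).
have -> : (Cmod (w - z) / (Cmod (w - z0) * (c * c)) * (Cmod (w - z0) * (c * c)) = Cmod (w - z))%R.
  by field; split; lra.
apply: (Rle_trans _ (e * (c * c * c) / 2)); first lra.
have -> : (e * (c * c * c) / 2 = e * (c / 2 * (c * c)))%R by field.
apply: Rmult_le_compat_l; first lra.
by apply: Rmult_le_compat_r; [nra | lra].
Qed.

Lemma complex_derivable_slope (f : C -> C) (z0 z : C) : z <> z0 ->
  complex_derivable f z -> complex_derivable (fun x => (f x - f z0) / (x - z0)) z.
Proof.
move=> zz0 [l Hl].
have h : is_Cderive (fun x => f x - f z0) z (l - 0).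
  exact: (@is_derive_minus _ C_NormedModule _ _ _ _ _ Hl (is_derive_const _ _)).
eexists; exact: is_Cderive_mult h (is_Cderive_inv zz0).
Qed.

Lemma slope_bounded (f : C -> C) (z0 : C) : complex_derivable f z0 ->
  exists M eta, (0 < eta)%R /\
    forall z, (Cmod (z - z0) < eta)%R -> (Cmod ((f z - f z0) / (z - z0)) <= M)%R.
Proof.
move=> [l /is_C_derive_eps H].
have [d d0 Hd] := H 1%R Rlt_0_1.
exists (Cmod l + 1)%R, d; split=> // z hz.
case: (Classical_Prop.classic (z = z0)) => [->|zz0].
  have -> : (f z0 - f z0) / (z0 - z0) = 0.
    have -> : f z0 - f z0 = 0 by ring.
    by rewrite /Cdiv Cmult_0_l.
  by rewrite Cmod_0; have := Cmod_ge_0 l; lra.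
have nz : z - z0 <> 0 by move=> h; apply: zz0; rewrite -(Cplus_0_r z0) -h; ring.
have p := proj1 (Cmod_gt_0 _) nz.
rewrite Cmod_div //; apply: (Rmult_le_reg_r _ _ _ p).
have -> : (Cmod (f z - f z0) / Cmod (z - z0) * Cmod (z - z0) = Cmod (f z - f z0))%R by field; lra.
have := Hd z hz.
have := Cmod_triangle (f z - f z0 - l * (z - z0)) (l * (z - z0)).
have -> : f z - f z0 - l * (z - z0) + l * (z - z0) = f z - f z0 by ring.
rewrite Cmod_mult; lra.
Qed.

Lemma is_RIntC_scal (c : C) (f : R -> C) a b (l : C) :
  @is_RInt C_R_NormedModule f a b l -> @is_RInt C_R_NormedModule (fun t => c * f t) a b (c * l).
Proof.
move=> H.
have H1 := is_RInt_fct_extend_fst (U := R_NormedModule) (V := R_NormedModule) _ _ _ _ H.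
have H2 := is_RInt_fct_extend_snd (U := R_NormedModule) (V := R_NormedModule) _ _ _ _ H.
apply: (is_RInt_fct_extend_pair (U := R_NormedModule) (V := R_NormedModule)).
  exact: (is_RInt_minus _ _ _ _ _ _ (is_RInt_scal _ _ _ (Re c) _ H1) (is_RInt_scal _ _ _ (Im c) _ H2)).
exact: (is_RInt_plus _ _ _ _ _ _ (is_RInt_scal _ _ _ (Re c) _ H2) (is_RInt_scal _ _ _ (Im c) _ H1)).
Qed.

Arguments is_RIntC_scal c {f a b l}.

(** * Taylor expansion of holomorphic functions *)

Section TaylorSeries.
Variables (f : C -> C) (rho R0 : R).
Hypothesis R00 : (0 < R0)%R.
Hypothesis R0rho : (R0 < rho)%R.
Hypothesis fD : forall z, (Cmod z < rho)%R -> complex_derivable f z.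

Let u (t : R) : C := (cos t, sin t).
Let gam (t : R) : C := RtoC R0 * u t.
Let E (k : nat) (t : R) : C := (cos (INR k * t), - sin (INR k * t))%R.
Let T := (2 * PI)%R.
Let T0 : (0 < T)%R. Proof. by rewrite /T; have := PI_RGT_0; lra. Qed.

Let u_derive t : is_derive_RC u t (Ci * u t).
Proof.
apply/is_derive_RC_ReIm; rewrite /u /=; split; auto_derive => //; ring.
Qed.

Let E_derive k t : is_derive_RC (E k) t (- Ci * RtoC (INR k) * E k t).
Proof.
apply/is_derive_RC_ReIm; rewrite /E; split; rewrite [X in is_derive X]/=; auto_derive => //=; ring.
Qed.

Let Cmod_u t : Cmod (u t) = 1%R.
Proof.
rewrite /Cmod /u /=; rewrite -[RHS]sqrt_1; congr sqrt.
have := sin2_cos2 t; rewrite /Rsqr; lra.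
Qed.

Let Cmod_E k t : Cmod (E k t) = 1%R.
Proof.
rewrite /Cmod /E /=; rewrite -[RHS]sqrt_1; congr sqrt.
have := sin2_cos2 (INR k * t); rewrite /Rsqr; lra.
Qed.

Let uE k t : u t * E k.+1 t = E k t.
Proof.
rewrite /u /E S_INR /Cmult /=; have -> : ((INR k + 1) * t = INR k * t + t)%R by ring.
rewrite cos_plus sin_plus; have := sin2_cos2 t; rewrite /Rsqr => h.
by congr (_, _); rewrite -[RHS]Rmult_1_r -h; ring.
Qed.

Let E0 t : E 0 t = 1.
Proof. by rewrite /E /= Rmult_0_l cos_0 sin_0 Ropp_0. Qed.

Let Cmod_gam t : Cmod (gam t) = R0.
Proof. by rewrite /gam Cmod_mult Cmod_u Cmod_R Rabs_pos_eq; lra. Qed.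

Let gam_derive t : is_derive_RC gam t (Ci * gam t).
Proof.
have h := is_derive_RC_mult (is_derive_RC_const (RtoC R0) t) (u_derive t).
set l := (X in is_derive_RC _ _ X) in h.
suff -> : Ci * gam t = l by [].
by rewrite /l /gam; ring.
Qed.

Let gam_cont t : continuous_RC gam t := is_derive_RC_continuous (gam_derive t).
Let E_cont k t : continuous_RC (E k) t := is_derive_RC_continuous (E_derive k t).

(** [E k] is [exp (- i k t)], and [Ci / k * E k] is a primitive of it. *)
Let E_int k : (RIntC (E k.+1) 0 T : C) = 0.
Proof.
have k0 : RtoC (INR k.+1) <> 0.
  by move=> h; have := RtoC_inj _ _ h; apply: not_0_INR.
pose F t := (Ci / RtoC (INR k.+1)) * E k.+1 t.
rewrite (@RIntC_derive F) //; [ | lra | ].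
  rewrite /F /E Rmult_0_r cos_0 sin_0.
  have -> : (INR k.+1 * T = 0 + 2 * INR k.+1 * PI)%R by rewrite /T; ring.
  rewrite cos_period sin_period cos_0 sin_0; ring.
move=> t _.
have h := is_derive_RC_mult (is_derive_RC_const (Ci / RtoC (INR k.+1)) t) (E_derive k.+1 t).
set l := (X in is_derive_RC _ _ X) in h.
suff -> : E k.+1 t = l by [].
have CC : Ci * Ci = - (1) by rewrite /Ci /Cmult /Copp /=; congr (_, _); ring.
have -> : l = - (Ci * Ci) * (RtoC (INR k.+1) / RtoC (INR k.+1)) * E k.+1 t by rewrite /l; field.
by rewrite CC; field.
Qed.

Let fgam_cont t : continuous_RC (fun t => f (gam t)) t.
Proof. by apply: continuous_comp_RC; [exact: gam_cont | apply: fD; rewrite Cmod_gam]. Qed.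

Definition cauchy_coef k : C := (RIntC (fun t => f (gam t) * E k t) 0 T : C) / (RtoC T * RtoC R0 ^ k).

Let RIntC_E_le (h : R -> C) k : (forall t, (0 <= t <= T)%R -> continuous_RC h t) ->
  (Cmod (RIntC (fun t => (h t * E k t)%C) 0 T) <= RInt (fun t => Cmod (h t)) 0 T)%R.
Proof.
move=> ch; apply: Rle_trans (Cmod_RInt_le_Rint _ _) _; first lra.
  by move=> t ht; apply: continuous_RC_mult; [exact: ch | exact: E_cont].
apply: Req_le; apply: RInt_ext => t _; by rewrite Cmod_mult Cmod_E Rmult_1_r.
Qed.

Let T_neq0 : RtoC T <> 0.
Proof. by move=> h; have := RtoC_inj _ _ h; lra. Qed.
Let R0_neq0 : RtoC R0 <> 0.
Proof. by move=> h; have := RtoC_inj _ _ h; lra. Qed.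

Lemma cauchy_coef_summable z : (Cmod z < R0)%R -> abs_summable (fun k => cauchy_coef k * z ^ k).
Proof.
move=> hz; pose q := (Cmod z / R0)%R.
have q0 : (0 <= q)%R.
  by rewrite /q /Rdiv; apply: Rmult_le_pos; [exact: Cmod_ge_0 | apply/Rlt_le/Rinv_0_lt_compat].
have q1 : (q < 1)%R.
  by apply: (Rmult_lt_reg_r R0) => //; rewrite /q /Rdiv Rmult_assoc Rinv_l; lra.
pose K := (RInt (fun t => Cmod (f (gam t))) 0 T / T)%R.
apply: (@abs_summable_le _ (fun k => scal K (q ^ k))%R); last first.
  by apply: (@ex_series_scal R_AbsRing R_NormedModule); apply: ex_series_geom; rewrite Rabs_pos_eq.
move=> k; have RK : RtoC R0 ^ k <> 0 by apply: Cpow_nz.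
rewrite Cmod_mult /cauchy_coef Cmod_div; last exact: Cmult_neq_0.
rewrite !Cmod_mult !Cmod_pow !Cmod_R (Rabs_pos_eq T) ?(Rabs_pos_eq R0); try lra.
have -> : scal K (q ^ k)%R = (RInt (fun t => Cmod (f (gam t))) 0 T / (T * R0 ^ k) * Cmod z ^ k)%R.
  rewrite /scal /= /mult /= /K /q /Rdiv Rpow_mult_distr -Rinv_pow; last lra.
  by field; split; [apply: pow_nonzero; lra | lra].
apply: Rmult_le_compat_r; first by apply/pow_le/Cmod_ge_0.
apply: Rmult_le_compat_r.
  by apply/Rlt_le/Rinv_0_lt_compat/Rmult_lt_0_compat => //; apply: pow_lt.
exact: RIntC_E_le.
Qed.

(** With [g w = (f w - f z) / (w - z)], [A k] and [W k] the integrals of [f]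
    and [g] against [exp (- i k t)], the identity
    [(gam - z) * g gam = f gam - f z] gives [A (k + 1) = R0 * W k - z * W (k + 1)],
    and the vanishing of the integral of [g] over the circle gives
    [A 0 = T f z - z * W 0].  Hence the partial sums of the Taylor series
    telescope to [f z] up to an error proportional to [W n * (z / R0) ^ n]. *)
Lemma cauchy_taylor z : (Cmod z < R0)%R -> is_Cseries (fun k => cauchy_coef k * z ^ k) (f z).
Proof.
move=> hz.
pose g w := (f w - f z) / (w - z).
have gamz t : gam t - z <> 0.
  have := Cmod_triangle (gam t - z) z.
  have -> : gam t - z + z = gam t by ring.
  by rewrite Cmod_gam => h; apply/Cmod_gt_0; lra.
have Hg t : (gam t - z) * g (gam t) = f (gam t) - f z by rewrite /g; field.
have g_cont t : continuous_RC (fun t => g (gam t)) t.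
  apply: continuous_comp_RC; first exact: gam_cont.
  apply: complex_derivable_slope; last by apply: fD; rewrite Cmod_gam.
  by move=> h; apply: (gamz t); rewrite h; ring.
pose A k : C := RIntC (fun t => f (gam t) * E k t) 0 T.
pose W k : C := RIntC (fun t => g (gam t) * E k t) 0 T.
have ex_W k : ex_RIntC (fun t => g (gam t) * E k t) 0 T.
  by apply: ex_RIntC_continuous; [lra | move=> t _; apply: continuous_RC_mult].
have ex_A k : ex_RIntC (fun t => f (gam t) * E k t) 0 T.
  by apply: ex_RIntC_continuous; [lra | move=> t _; apply: continuous_RC_mult].
have ex_E k : ex_RIntC (E k) 0 T.
  by apply: ex_RIntC_continuous; [lra | move=> t _; apply: E_cont].
have W0 : (RIntC (fun t => g (gam t) * gam t) 0 T : C) = 0.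
  have [M [eta [eta0 HM]]] := slope_bounded (fD (Rlt_trans _ _ _ hz R0rho)).
  have CC : - Ci * Ci = 1 by rewrite /Ci /Cmult /Copp /=; congr (_, _); ring.
  rewrite -(@cauchy_homotopy_to_point (fun w => - Ci * g w) z gam (fun t => Ci * gam t) T (R0 + R0) M eta T0) //.
  - apply: (@RInt_ext C_R_CompleteNormedModule) => t _; Ceq.
    by rewrite -(Cmult_1_l (g _ * _)) -CC; ring.
  - lra.
  - by move=> t; apply: continuous_RC_mult; [exact: continuous_RC_const | exact: gam_cont].
  - by move=> t; rewrite Cmod_mult Cmod_Ci Cmod_gam; lra.
  - move=> t; have := Cmod_triangle (gam t) (- z); rewrite Cmod_opp Cmod_gam /Cminus; lra.
  - rewrite /gam /u cos_0 sin_0 /T; have -> : (2 * PI = 0 + 2 * INR 1 * PI)%R by rewrite /=; ring.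
    by rewrite cos_period sin_period cos_0 sin_0.
  - move=> x t hx ht.
    have [l hl] : complex_derivable g (z + x * (gam t - z)).
      apply: complex_derivable_slope.
        move=> h; have : RtoC x * (gam t - z) <> 0.
          by apply: Cmult_neq_0 => // /RtoC_inj; lra.
        by apply; rewrite -[RHS](Cplus_opp_r z) -{2}h; ring.
      apply: fD; apply: Rle_lt_trans R0rho.
      have -> : z + x * (gam t - z) = (RtoC (1 - x) * z + RtoC x * gam t) by rewrite RtoC_minus; ring.
      apply: Rle_trans (Cmod_triangle _ _) _.
      rewrite (Cmod_mult _ (gam t)) (Cmod_mult _ z) !Cmod_R Cmod_gam !Rabs_pos_eq; nra.
    eexists; apply: is_Cderive_mult hl; exact: is_derive_const.
  - by move=> w hw; rewrite Cmod_mult Cmod_opp Cmod_Ci Rmult_1_l; apply: HM.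
have SE n : \big[Cplus/RtoC 0]_(k < n.+1) (A k * (z / R0) ^ k) =
   RtoC T * f z - z * (W n * (z / R0) ^ n).
  have step k : @is_RInt C_R_NormedModule (fun t => (f (gam t) - f z) * E k t) 0 T
      (A k - f z * (RIntC (E k) 0 T : C)).
    have h := is_RInt_minus _ _ _ _ _ _ (@RInt_correct C_R_CompleteNormedModule _ _ _ (ex_A k))
      (is_RIntC_scal (f z) (@RInt_correct C_R_CompleteNormedModule _ _ _ (ex_E k))).
    apply: (is_RInt_ext _ _ _ _ _ _ h) => t _.
    by change (f (gam t) * E k t - f z * E k t = (f (gam t) - f z) * E k t); ring.
  have step2 k : @is_RInt C_R_NormedModule (fun t => (f (gam t) - f z) * E k t) 0 T
      ((RIntC (fun t => g (gam t) * (gam t * E k t)) 0 T : C) - z * W k).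
    have ex2 : ex_RIntC (fun t => g (gam t) * (gam t * E k t)) 0 T.
      apply: ex_RIntC_continuous; first lra.
      by move=> t _; apply: continuous_RC_mult => //; apply: continuous_RC_mult.
    have h := is_RInt_minus _ _ _ _ _ _ (@RInt_correct C_R_CompleteNormedModule _ _ _ ex2)
      (is_RIntC_scal z (@RInt_correct C_R_CompleteNormedModule _ _ _ (ex_W k))).
    apply: (is_RInt_ext _ _ _ _ _ _ h) => t _; rewrite -Hg.
    by change (g (gam t) * (gam t * E k t) - z * (g (gam t) * E k t) =
      (gam t - z) * g (gam t) * E k t); ring.
  have step3 k : A k - f z * (RIntC (E k) 0 T : C) =
      (RIntC (fun t => g (gam t) * (gam t * E k t)) 0 T : C) - z * W k.
    have h1 := @is_RInt_unique C_R_CompleteNormedModule _ _ _ _ (step k).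
    have h2 := @is_RInt_unique C_R_CompleteNormedModule _ _ _ _ (step2 k).
    exact: etrans (esym h1) h2.
  elim: n => [|n IH].
    rewrite big_ord1 /= !Cmult_1_r.
    have e1 : (RIntC (E 0) 0 T : C) = RtoC T.
      have h := @RInt_const C_R_CompleteNormedModule 0 T (RtoC 1).
      have -> : (RIntC (E 0) 0 T : C) = scal (T - 0)%R (RtoC 1 : C_R_NormedModule).
        by rewrite -h; apply: (@RInt_ext C_R_CompleteNormedModule) => t _; rewrite E0.
      by rewrite /scal /= /prod_scal /= /scal /= /mult /= /RtoC; congr (_, _); ring.
    have e2 : (RIntC (fun t => g (gam t) * (gam t * E 0 t)) 0 T : C) = 0.
      rewrite -W0; apply: (@RInt_ext C_R_CompleteNormedModule) => t _; rewrite E0.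
      by rewrite Cmult_1_r.
    have := step3 0%N; rewrite e1 e2 => h.
    have -> : A 0%N = A 0%N - f z * T + f z * T by ring.
    by rewrite h; ring.
  rewrite big_ord_recr /= IH.
  have := step3 n.+1; rewrite E_int.
  have -> : (RIntC (fun t => g (gam t) * (gam t * E n.+1 t)) 0 T : C) = R0 * W n.
    rewrite -(@is_RInt_unique C_R_CompleteNormedModule _ _ _ _
      (is_RIntC_scal R0 (@RInt_correct C_R_CompleteNormedModule _ _ _ (ex_W n)))).
    apply: (@RInt_ext C_R_CompleteNormedModule) => t _; Ceq.
    by rewrite /gam -(Cmult_assoc R0) uE; ring.
  move=> h.
  have -> : A n.+1 = A n.+1 - f z * 0 by ring.
  by rewrite h; field.
pose K := (Cmod z / T * RInt (fun t => Cmod (g (gam t))) 0 T)%R.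
pose q := (Cmod z / R0)%R.
have q0 : (0 <= q)%R.
  by rewrite /q /Rdiv; apply: Rmult_le_pos; [exact: Cmod_ge_0 | apply/Rlt_le/Rinv_0_lt_compat].
have q1 : (q < 1)%R.
  by apply: (Rmult_lt_reg_r R0) => //; rewrite /q /Rdiv Rmult_assoc Rinv_l; lra.
have err n : (Cmod (sum_n ((fun k => (cauchy_coef k * z ^ k)%C) : nat -> C_NormedModule) n - f z) <= K * q ^ n)%R.
  have -> : sum_n ((fun k => cauchy_coef k * z ^ k) : nat -> C_NormedModule) n =
      / RtoC T * \big[Cplus/RtoC 0]_(k < n.+1) (A k * (z / R0) ^ k).
    rewrite sum_n_Cbig big_distrr /=; apply: eq_bigr => k _.
    have RK : RtoC R0 ^ k <> 0 by apply: Cpow_nz.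
    by rewrite /cauchy_coef -/(A k) /Cdiv Cpow_mult_l Cpow_inv //; field.
  rewrite SE.
  have -> : / RtoC T * (T * f z - z * (W n * (z / R0) ^ n)) - f z = - (z / T * (W n * (z / R0) ^ n)) by field.
  rewrite Cmod_opp Cmod_mult (Cmod_mult (W n)) Cmod_pow !Cmod_div // !Cmod_R !Rabs_pos_eq; try lra.
  rewrite -/q /K Rmult_assoc; apply: Rmult_le_compat_l.
    by rewrite /Rdiv; apply: Rmult_le_pos; [exact: Cmod_ge_0 | apply/Rlt_le/Rinv_0_lt_compat].
  by apply: Rmult_le_compat_r; [exact: pow_le | apply: RIntC_E_le].
have lim : is_lim_seq (fun n => (K * q ^ n)%R) 0%R.
  have := is_lim_seq_scal_l _ K _ (is_lim_seq_geom q ltac:(rewrite Rabs_pos_eq; lra)).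
  by rewrite /= Rmult_0_r.
apply/filterlim_C_eps => e e0.
have /is_lim_seq_spec /(_ (mkposreal _ e0)) [N HN] := lim.
exists N => n /HN /=; rewrite Rminus_0_r => h.
apply: Rle_lt_trans (err n) _; exact: Rle_lt_trans (Rle_abs _) h.
Qed.
End TaylorSeries.

(** * Termwise differentiation *)

(** A second-order bound on the terms, uniform near [z], sums to a
    second-order bound on the series.  It serves for power series and for
    Dirichlet series alike. *)
Lemma is_Cderive_series (u : nat -> C -> C) (v : nat -> C) (M : nat -> R) (F : C -> C) (z : C) (d : R) :
  (0 < d)%R ->
  (forall w, (Cmod (w - z) < d)%R -> is_Cseries (fun k => u k w) (F w)) ->
  abs_summable v -> ex_series M ->
  (forall k w, (Cmod (w - z) < d)%R ->
     (Cmod (u k w - u k z - v k * (w - z)) <= M k * Cmod (w - z) ^ 2)%R) ->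
  is_Cderive F z (CSeries v).
Proof.
move=> d0 HF Hv HM Hu.
have z0 : (Cmod (z - z) < d)%R by rewrite (_ : z - z = 0); [rewrite Cmod_0 | ring].
apply/is_C_derive_eps => e e0.
have S0 : (0 < Rabs (Series M) + 1)%R by have := Rabs_pos (Series M); lra.
exists (Rmin d (e / (Rabs (Series M) + 1))); first by apply: Rmin_pos => //; apply: Rdiv_lt_0_compat.
move=> w hw.
have h1 : (Cmod (w - z) < d)%R by apply: Rlt_le_trans hw (Rmin_l _ _).
have h2 : (Cmod (w - z) < e / (Rabs (Series M) + 1))%R by apply: Rlt_le_trans hw (Rmin_r _ _).
have hs : is_Cseries (fun k => u k w - u k z - v k * (w - z)) (F w - F z - CSeries v * (w - z)).
  apply: (@is_series_minus C_AbsRing C_NormedModule).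
    by apply: (@is_series_minus C_AbsRing C_NormedModule); apply: HF.
  have := @is_series_scal C_AbsRing C_NormedModule (w - z) _ _ (CSeries_correct Hv).
  have -> : scal (w - z : C_AbsRing) (CSeries v : C_NormedModule) = CSeries v * (w - z) by exact: Cmult_comm.
  by apply: is_series_ext => k; apply: Cmult_comm.
rewrite -(CSeries_unique hs).
have bd : (Cmod (CSeries (fun k => (u k w - u k z - v k * (w - z))%C)) <= Series (fun k => M k * Cmod (w - z) ^ 2))%R.
  by apply: Cmod_CSeries_le => [k|]; [exact: Hu | exact: ex_series_scal_r].
apply: Rle_trans bd _; rewrite Series_scal_r.
have -> : (Series M * Cmod (w - z) ^ 2 = (Series M * Cmod (w - z)) * Cmod (w - z))%R by ring.
apply: Rmult_le_compat_r; first exact: Cmod_ge_0.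
apply: (Rle_trans _ ((Rabs (Series M) + 1) * Cmod (w - z))).
  by apply: Rmult_le_compat_r; [exact: Cmod_ge_0 | have := Rle_abs (Series M); lra].
have := Rmult_lt_compat_l _ _ _ S0 h2.
have -> : ((Rabs (Series M) + 1) * (e / (Rabs (Series M) + 1)) = e)%R by field; lra.
lra.
Qed.

(** All coefficients of the remainder [((z + h) ^ k - z ^ k - k z ^ (k-1) h)]
    as a polynomial in [z] and [h] are nonnegative, and it is divisible by
    [h ^ 2]; so it is at most [(|h| / d) ^ 2] times its value at [(x, d)],
    which is at most [(x + d) ^ k]. *)
Lemma pow_remainder_le (z h : C) (x d : R) k : (0 < d)%R -> (Cmod z <= x)%R -> (Cmod h <= d)%R ->
  (Cmod ((z + h) ^ k - z ^ k - RtoC (INR k) * z ^ k.-1 * h) <= ((x + d) ^ k / d ^ 2) * Cmod h ^ 2)%R.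
Proof.
move=> d0 zx hd.
have x0 : (0 <= x)%R by apply: Rle_trans zx; exact: Cmod_ge_0.
pose P j := ((x + d) ^ j - x ^ j - INR j * x ^ j.-1 * d)%R.
have P0 j : (0 <= x ^ j)%R by exact: pow_le.
have I0 j : (0 <= INR j)%R by exact: pos_INR.
have hP : (Cmod ((z + h) ^ k - z ^ k - RtoC (INR k) * z ^ k.-1 * h) <= P k / d ^ 2 * Cmod h ^ 2)%R /\ (0 <= P k)%R.
  elim: k => [|k [IH IH0]].
    have -> : (z + h) ^ 0 - z ^ 0 - RtoC (INR 0) * z ^ 0.-1 * h = 0 by rewrite /=; ring.
    rewrite Cmod_0 /P /=.
    have -> : (1 - 1 - 0 * 1 * d = 0)%R by ring.
    by rewrite /Rdiv !Rmult_0_l; split; lra.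
  have PS : (P k.+1 = (x + d) * P k + INR k * x ^ k.-1 * d ^ 2)%R.
    rewrite /P S_INR; case: (k) => [|j] /=; ring.
  split; last first.
    rewrite PS; apply: Rplus_le_le_0_compat; first by apply: Rmult_le_pos => //; lra.
    by apply: Rmult_le_pos; [apply: Rmult_le_pos | apply: pow_le; lra].
  have -> : (z + h) ^ k.+1 - z ^ k.+1 - RtoC (INR k.+1) * z ^ k.+1.-1 * h =
     (z + h) * ((z + h) ^ k - z ^ k - RtoC (INR k) * z ^ k.-1 * h) + RtoC (INR k) * z ^ k.-1 * (h * h).
    rewrite S_INR RtoC_plus; case: (k) => [|j] /=; ring.
  apply: Rle_trans (Cmod_triangle _ _) _.
  have -> : (P k.+1 / d ^ 2 * Cmod h ^ 2 =
      (x + d) * (P k / d ^ 2 * Cmod h ^ 2) + INR k * x ^ k.-1 * Cmod h ^ 2)%R.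
    by rewrite PS; field; lra.
  apply: Rplus_le_compat.
    rewrite Cmod_mult; apply: Rmult_le_compat => //; try exact: Cmod_ge_0.
    apply: Rle_trans (Cmod_triangle _ _) _; lra.
  rewrite !Cmod_mult Cmod_R Rabs_pos_eq // Cmod_pow.
  have -> : (Cmod h * Cmod h = Cmod h ^ 2)%R by ring.
  apply: Rmult_le_compat_r; first by apply: pow_le; exact: Cmod_ge_0.
  by apply: Rmult_le_compat_l => //; apply: pow_incr; split => //; exact: Cmod_ge_0.
have [hP1 _] := hP; apply: Rle_trans hP1 _.
apply: Rmult_le_compat_r; first by apply: pow_le; exact: Cmod_ge_0.
rewrite /Rdiv; apply: Rmult_le_compat_r.
  by apply/Rlt_le/Rinv_0_lt_compat/pow_lt.
have := Rmult_le_pos _ _ (Rmult_le_pos _ _ (I0 k) (P0 k.-1)) (Rlt_le _ _ d0).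
by rewrite /P; have := P0 k; lra.
Qed.

Lemma INR_pow_le (x d : R) k : (0 < d)%R -> (0 <= x)%R ->
  (INR k.+1 * x ^ k * d <= (x + d) ^ k.+1)%R.
Proof.
move=> d0 x0; elim: k => [|k IH]; first by rewrite /=; lra.
have -> : ((x + d) ^ k.+2 = (x + d) ^ k.+1 * x + (x + d) ^ k.+1 * d)%R by rewrite /=; ring.
have -> : (INR k.+2 * x ^ k.+1 * d = (INR k.+1 * x ^ k * d) * x + x ^ k.+1 * d)%R.
  by rewrite (S_INR k.+1) /=; ring.
apply: Rplus_le_compat; apply: Rmult_le_compat_r => //; try lra.
by apply: pow_incr; lra.
Qed.

(** The radius of convergence of [a] is at least [rho]. *)
Definition converges_below (a : nat -> C) (rho : R) : Prop :=
  forall x, (0 <= x < rho)%R -> ex_series (fun k => Cmod (a k) * x ^ k)%R.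

Definition fps_deriv (a : nat -> C) (k : nat) : C := RtoC (INR k.+1) * a k.+1.

Lemma converges_below_summable a rho z : converges_below a rho -> (Cmod z < rho)%R ->
  abs_summable (fun k => a k * z ^ k).
Proof.
move=> H hz; apply: ex_series_ext (H (Cmod z) _) => [k|]; first by rewrite Cmod_mult Cmod_pow.
by split=> //; exact: Cmod_ge_0.
Qed.

Lemma converges_below_deriv a rho : converges_below a rho -> converges_below (fps_deriv a) rho.
Proof.
move=> H x hx; pose d := ((rho - x) / 2)%R.
have d0 : (0 < d)%R by rewrite /d; lra.
have Hd := proj1 (ex_series_incr_1 _) (H (x + d)%R ltac:(rewrite /d; lra)).
have := ex_series_scal_r (/ d)%R _ Hd.
apply: (@ex_series_le R_AbsRing R_CompleteNormedModule) => k.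
rewrite /norm /= /abs /= Rabs_pos_eq; last first.
  by apply: Rmult_le_pos; [exact: Cmod_ge_0 | apply: pow_le; lra].
rewrite /fps_deriv Cmod_mult Cmod_R Rabs_pos_eq; last exact: pos_INR.
apply: (Rmult_le_reg_r d) => //.
rewrite Rmult_assoc (Rmult_assoc _ (/ d)%R) Rinv_l; last lra.
rewrite Rmult_1_r.
have := Rmult_le_compat_l _ _ _ (Cmod_ge_0 (a k.+1)) (@INR_pow_le x d k d0 ltac:(lra)).
rewrite -[((x + d) * (x + d) ^ k)%R]/((x + d) ^ k.+1)%R; lra.
Qed.

Lemma power_series_derive a rho (f : C -> C) z : converges_below a rho ->
  (forall w, (Cmod w < rho)%R -> is_Cseries (fun k => a k * w ^ k) (f w)) ->
  (Cmod z < rho)%R ->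
  exists2 l, is_Cderive f z l & is_Cseries (fun k => fps_deriv a k * z ^ k) l.
Proof.
move=> Ha Hf hz; pose d := ((rho - Cmod z) / 2)%R.
have d0 : (0 < d)%R by rewrite /d; lra.
have hd : (Cmod z + d < rho)%R by rewrite /d; lra.
have z0 := Cmod_ge_0 z.
have sd := converges_below_summable (converges_below_deriv Ha) hz.
pose v k : C := if k is j.+1 then fps_deriv a j * z ^ j else 0.
have sv : abs_summable v by apply/ex_series_incr_1.
have Hl : is_Cseries (fun k => fps_deriv a k * z ^ k) (CSeries v).
  apply: (@is_series_incr_1 C_AbsRing C_NormedModule v).
  have -> : plus (CSeries v : C_NormedModule) (v 0%N) = CSeries v by exact: Cplus_0_r.
  exact: CSeries_correct.
exists (CSeries v) => //.
apply: (@is_Cderive_series (fun k w => a k * w ^ k) v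
  (fun k => Cmod (a k) * (Cmod z + d) ^ k * / d ^ 2)%R f z d d0).
- move=> w hw; apply: Hf.
  have := Cmod_triangle z (w - z); have -> : z + (w - z) = w by ring.
  lra.
- exact: sv.
- by apply: ex_series_scal_r; apply: Ha; lra.
move=> k w hw.
have -> : a k * w ^ k - a k * z ^ k - v k * (w - z) =
    a k * ((z + (w - z)) ^ k - z ^ k - RtoC (INR k) * z ^ k.-1 * (w - z)).
  have -> : z + (w - z) = w by ring.
  by case: (k) => [|j]; rewrite /v /fps_deriv; [rewrite /=; ring | rewrite -pred_Sn; ring].
rewrite Cmod_mult !Rmult_assoc; apply: Rmult_le_compat_l; first exact: Cmod_ge_0.
have := @pow_remainder_le z (w - z) (Cmod z) d k d0 (Rle_refl _) (Rlt_le _ _ hw).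
by rewrite /Rdiv !Rmult_assoc.
Qed.

Lemma iter_C_derive_power_series a rho (f : C -> C) j : converges_below a rho ->
  (forall w, (Cmod w < rho)%R -> is_Cseries (fun k => a k * w ^ k) (f w)) ->
  converges_below (iter j fps_deriv a) rho /\
  forall z, (Cmod z < rho)%R ->
    is_Cseries (fun k => iter j fps_deriv a k * z ^ k) (iter j C_derive f z).
Proof.
move=> Ha Hf; elim: j => [|j [IH1 IH2]]; first by [].
split; first exact: converges_below_deriv.
move=> z hz; have [l h1 h2] := power_series_derive IH1 IH2 hz.
by rewrite [iter j.+1 C_derive f z](is_C_derive_unique _ _ _ h1).
Qed.

Lemma iter_fps_deriv a j k :
  iter j fps_deriv a k * RtoC (INR k`!) = RtoC (INR (k + j)`!) * a (k + j)%N.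
Proof.
elim: j k => [|j IH] k; first by rewrite addn0 /=; ring.
rewrite iterS /fps_deriv.
have -> : RtoC (INR k.+1) * iter j fps_deriv a k.+1 * RtoC (INR k`!) =
  iter j fps_deriv a k.+1 * RtoC (INR k.+1`!).
  by rewrite factS mult_INR RtoC_mult; ring.
by rewrite IH addnS addSn.
Qed.

Lemma is_Cseries_at0 (a : nat -> C) : is_Cseries (fun k => a k * 0 ^ k) (a 0%N).
Proof.
apply: (@is_series_decr_1 C_AbsRing C_NormedModule).
have -> : plus (a 0%N : C_NormedModule) (opp (a 0%N * 0 ^ 0)) = RtoC 0.
  by change (a 0%N + - (a 0%N * 1) = 0); ring.
apply: (@is_series_ext C_AbsRing C_NormedModule (fun=> RtoC 0)).
  by move=> k; rewrite /=; Ceq; ring.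
apply/is_Cseries_big; apply: filterlim_ext (filterlim_const _) => n.
by rewrite big1.
Qed.

Lemma is_Cseries_unique (u : nat -> C) (l l' : C) : is_Cseries u l -> is_Cseries u l' -> l = l'.
Proof. by move=> /CSeries_unique <- /CSeries_unique <-. Qed.

Lemma taylor_coef_power_series a rho (f : C -> C) j : (0 < rho)%R -> converges_below a rho ->
  (forall w, (Cmod w < rho)%R -> is_Cseries (fun k => a k * w ^ k) (f w)) ->
  taylor_coef f j = a j.
Proof.
move=> rho0 Ha Hf; have [_ H] := iter_C_derive_power_series j Ha Hf.
have {}H := H 0 ltac:(by rewrite Cmod_0).
have fact0 : RtoC (INR j`!) <> 0.
  by move=> /RtoC_inj; apply: not_0_INR; have := fact_gt0 j; lia.
rewrite /taylor_coef (is_Cseries_unique H (@is_Cseries_at0 (iter j fps_deriv a))).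
have h := iter_fps_deriv a j 0; rewrite add0n /= Cmult_1_r in h.
by rewrite h; field.
Qed.

(** For every [R0 < rho] the integrals over the circle of radius [R0] give a
    power series for [f] on [|z| < R0]; by uniqueness of Taylor coefficients
    these series all coincide, whence convergence up to [rho]. *)
Theorem holomorphic_disk_taylor (f : C -> C) (rho : R) : (0 < rho)%R ->
  (forall z, (Cmod z < rho)%R -> complex_derivable f z) ->
  converges_below (taylor_coef f) rho /\
  forall z, (Cmod z < rho)%R -> is_Cseries (fun k => taylor_coef f k * z ^ k) (f z).
Proof.
move=> rho0 fD.
have key R0 : (0 < R0 < rho)%R -> converges_below (cauchy_coef f R0) R0 /\
    forall j, taylor_coef f j = cauchy_coef f R0 j.
  move=> hR.
  have cb : converges_below (cauchy_coef f R0) R0.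
    move=> x hx; have xx : Cmod (RtoC x) = x by rewrite Cmod_R Rabs_pos_eq; lra.
    have := @cauchy_coef_summable f rho R0 ltac:(lra) ltac:(lra) fD (RtoC x) ltac:(rewrite xx; lra).
    by apply: ex_series_ext => k; rewrite Cmod_mult Cmod_pow xx.
  split=> // j; apply: (@taylor_coef_power_series _ R0) => //; first lra.
  by move=> w hw; apply: (@cauchy_taylor f rho R0) => //; lra.
split.
  move=> x hx; pose R0 := ((x + rho) / 2)%R.
  have [h1 h2] := key R0 ltac:(rewrite /R0; lra).
  have := h1 x ltac:(rewrite /R0; lra).
  by apply: ex_series_ext => k; rewrite h2.
move=> z hz; have z0 := Cmod_ge_0 z; pose R0 := ((Cmod z + rho) / 2)%R.
have [h1 h2] := key R0 ltac:(rewrite /R0; lra).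
have := @cauchy_taylor f rho R0 ltac:(rewrite /R0; lra) ltac:(rewrite /R0; lra) fD z ltac:(rewrite /R0; lra).
by apply: is_series_ext => k; rewrite h2.
Qed.

(** * The ring of formal power series and the logarithmic derivative *)

#[local] Arguments fps_pow : simpl never.

Definition fps := nat -> C.
Definition fps_add (a b : fps) : fps := fun m => a m + b m.
Definition fps_opp (a : fps) : fps := fun m => - a m.
Definition fps_const (c : C) : fps := fun m => if m == 0%N then c else RtoC 0.
Definition fps_mult (a b : fps) : fps := fps_mul a b.
(** The Euler derivation [z d/dz], under which products of powers become
    sums: [theta F / F] is additive in [F]. *)
Definition fps_theta (a : fps) : fps := fun m => RtoC (INR m) * a m.

Lemma fps_mulC (a b : fps) : fps_mult a b = fps_mult b a.
Proof.
apply: functional_extensionality => m; rewrite /fps_mult !fps_mulE (reindex_inj rev_ord_inj) /=.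
apply: eq_bigr => i _; rewrite subSS Cmult_comm; congr (b _ * a _).
by have := ltn_ord i; lia.
Qed.

Lemma fps_mulA (a b c : fps) : fps_mult a (fps_mult b c) = fps_mult (fps_mult a b) c.
Proof.
apply: functional_extensionality => m; rewrite /fps_mult !fps_mulE.
transitivity (\big[Cplus/RtoC 0]_(j < m.+1) \big[Cplus/RtoC 0]_(i < m.+1 | (j <= i)%N)
   (a j * (b (i - j)%N * c (m - i)%N))).
  apply: eq_bigr => j _; rewrite fps_mulE big_distrr /=.
  rewrite -(big_geq_mkord j m.+1 xpredT (fun i => a j * (b (i - j)%N * c (m - i)%N))) /=.
  rewrite [RHS](_ : _ = \big[Cplus/RtoC 0]_(0 + j <= i < m.+1) (a j * (b (i - j)%N * c (m - i)%N))) //.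
  rewrite big_addn big_mkord.
  have -> : (m.+1 - j = (m - j).+1)%N by have := ltn_ord j; lia.
  apply: eq_bigr => i _; congr (_ * (b _ * c _)); lia.
rewrite (exchange_big_dep xpredT) //=; apply: eq_bigr => i _.
rewrite fps_mulE big_distrl /=.
rewrite (big_ord_widen_cond m.+1 xpredT (fun j => a j * b (i - j)%N * c (m - i)%N)) //=.
by apply: eq_big => j; [rewrite ltnS | rewrite Cmult_assoc].
Qed.

Lemma fps_mul1 (a : fps) : fps_mult fps_one a = a.
Proof.
apply: functional_extensionality => m; rewrite /fps_mult fps_mulE big_ord_recl /= subn0 /fps_one /=.
by rewrite big1 => [|i _]; ring.
Qed.

Lemma fps_mulDl (a b c : fps) :
  fps_mult (fps_add a b) c = fps_add (fps_mult a c) (fps_mult b c).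
Proof.
apply: functional_extensionality => m; rewrite /fps_add /fps_mult !fps_mulE -big_split /=.
by apply: eq_bigr => i _; ring.
Qed.

Lemma fps_ring_theory : ring_theory (fps_const 0) (fps_one : fps) fps_add fps_mult
  (fun a b => fps_add a (fps_opp b)) fps_opp (@eq fps).
Proof.
split => //.
- by move=> a; apply: functional_extensionality => m; rewrite /fps_add /fps_const; case: eqP => _; ring.
- by move=> a b; apply: functional_extensionality => m; rewrite /fps_add; ring.
- by move=> a b c; apply: functional_extensionality => m; rewrite /fps_add; ring.
- exact: fps_mul1.
- exact: fps_mulC.
- exact: fps_mulA.
- exact: fps_mulDl.
- by move=> a; apply: functional_extensionality => m; rewrite /fps_add /fps_opp /fps_const; case: eqP => _; ring.
Qed.

Add Ring fps_ring : fps_ring_theory.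

Lemma fps_const_mulE c (a : fps) m : fps_mult (fps_const c) a m = c * a m.
Proof.
rewrite /fps_mult fps_mulE big_ord_recl /= subn0 /fps_const /=.
by rewrite big1 => [|i _]; ring.
Qed.

Lemma fps_thetaD (a b : fps) : fps_theta (fps_add a b) = fps_add (fps_theta a) (fps_theta b).
Proof. by apply: functional_extensionality => m; rewrite /fps_theta /fps_add; ring. Qed.

Lemma fps_thetaM (a b : fps) : fps_theta (fps_mult a b) =
  fps_add (fps_mult (fps_theta a) b) (fps_mult a (fps_theta b)).
Proof.
apply: functional_extensionality => m.
rewrite /fps_theta /fps_mult /fps_add !fps_mulE big_distrr /= -big_split /=.
apply: eq_bigr => i _.
have -> : INR m = (INR i + INR (m - i)%N)%R.
  by rewrite -plus_INR; congr INR; have := ltn_ord i; lia.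
by rewrite RtoC_plus; ring.
Qed.

Lemma fps_theta_const c : fps_theta (fps_const c) = fps_const 0.
Proof.
apply: functional_extensionality => -[|m]; rewrite /fps_theta /fps_const /=; ring.
Qed.

Lemma fps_constM c d : fps_const (c * d) = fps_mult (fps_const c) (fps_const d).
Proof.
apply: functional_extensionality => m; rewrite fps_const_mulE /fps_const; case: eqP => _ //; ring.
Qed.

Definition vanishes_below (k : nat) (a : fps) := forall m, (m < k)%N -> a m = 0.

Lemma vanishes_below_mul j k a b : vanishes_below j a -> vanishes_below k b ->
  vanishes_below (j + k) (fps_mult a b).
Proof.
move=> ha hb m hm; rewrite /fps_mult fps_mulE big1 // => i _.
case: (ltnP i j) => hi; first by rewrite ha //; ring.
by rewrite (hb (m - i)%N); [ring | have := ltn_ord i; lia].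
Qed.

Lemma vanishes_below_pow u k : vanishes_below 1 u -> vanishes_below k (fps_pow u k).
Proof.
move=> hu; elim: k => [|k IH]; first by [].
by rewrite /fps_pow iterS -/(fps_pow u k) -add1n; apply: vanishes_below_mul.
Qed.

(** The series [a - 1], for [a] with constant term [1]. *)
Definition fps_pred1 (a : fps) : fps := fun i => if i == 0%N then RtoC 0 else a i.

Lemma vanishes_pred1 a : vanishes_below 1 (fps_pred1 a).
Proof. by case. Qed.

Lemma sum_n_m_1 (f : nat -> C) m :
  sum_n_m (f : nat -> C_AbelianMonoid) 1 m = \big[Cplus/RtoC 0]_(k < m) f k.+1.
Proof.
elim: m => [|m IH]; first by rewrite sum_n_m_zero ?big_ord0 //; lia.
by rewrite sum_n_Sm ?IH ?big_ord_recr //=; lia.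
Qed.

Definition log_coef (k : nat) : C := RtoC ((-1) ^ k.+1 / INR k).

Lemma fps_logE (a : fps) m N : (m <= N)%N -> fps_log a m =
  \big[Cplus/RtoC 0]_(k < N) (log_coef k.+1 * fps_pow (fps_pred1 a) k.+1 m).
Proof.
move=> mN; rewrite /fps_log (sum_n_m_1 (fun k => log_coef k * fps_pow (fps_pred1 a) k m)).
rewrite (big_ord_widen_cond N xpredT (fun k => log_coef k.+1 * fps_pow (fps_pred1 a) k.+1 m)) //=.
apply/esym; rewrite (bigID (fun k : 'I_N => (k < m)%N)) /= [X in _ + X]big1 ?Cplus_0_r //.
move=> k hk; rewrite (@vanishes_below_pow _ k.+1 (@vanishes_pred1 a)); [ring | lia].
Qed.

Definition fps_log_trunc (u : fps) (N : nat) : fps := fun m =>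
  \big[Cplus/RtoC 0]_(k < N) (log_coef k.+1 * fps_pow u k.+1 m).

Lemma fps_powS u k : fps_pow u k.+1 = fps_mult u (fps_pow u k). Proof. by []. Qed.

Lemma fps_theta_pow u k : fps_theta (fps_pow u k.+1) =
  fps_mult (fps_const (RtoC (INR k.+1))) (fps_mult (fps_pow u k) (fps_theta u)).
Proof.
elim: k => [|k IH].
  have -> : fps_pow u 1 = u by rewrite fps_powS fps_mulC fps_mul1.
  have -> : fps_const (INR 1) = fps_one by [].
  by rewrite !fps_mul1.
rewrite fps_powS fps_thetaM IH (S_INR k.+1) RtoC_plus.
have -> : fps_const (RtoC (INR k.+1) + 1) = fps_add (fps_const (INR k.+1)) fps_one.
  by apply: functional_extensionality => m; rewrite /fps_add /fps_const /fps_one; case: eqP => _; ring.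
rewrite fps_powS; ring.
Qed.

Lemma RtoC_pow1S N : RtoC ((-1) ^ N.+1) = - RtoC ((-1) ^ N).
Proof. by rewrite -RtoC_opp; congr RtoC; rewrite /=; ring. Qed.

(** A geometric sum in disguise: [theta (log (1 + u))] is
    [theta u * (1 - u + u^2 - ...)], truncated after [N] terms. *)
Lemma fps_log_trunc_theta u N :
  fps_mult (fps_add fps_one u) (fps_theta (fps_log_trunc u N)) =
  fps_add (fps_theta u)
    (fps_opp (fps_mult (fps_const (RtoC ((-1) ^ N))) (fps_mult (fps_pow u N) (fps_theta u)))).
Proof.
elim: N => [|N IH].
  have -> : fps_log_trunc u 0 = fps_const 0.
    by apply: functional_extensionality => m; rewrite /fps_log_trunc big_ord0 /fps_const; case: eqP.
  rewrite fps_theta_const.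
  have -> : fps_const (RtoC ((-1) ^ 0)) = fps_one by [].
  have -> : fps_pow u 0 = fps_one by [].
  ring.
have -> : fps_log_trunc u N.+1 = fps_add (fps_log_trunc u N)
    (fps_mult (fps_const (log_coef N.+1)) (fps_pow u N.+1)).
  by apply: functional_extensionality => m; rewrite /fps_add fps_const_mulE /fps_log_trunc big_ord_recr.
rewrite fps_thetaD fps_thetaM fps_theta_const fps_theta_pow.
have e : fps_mult (fps_const (log_coef N.+1)) (fps_const (RtoC (INR N.+1))) = fps_const (RtoC ((-1) ^ N)).
  rewrite -fps_constM -RtoC_mult; congr (fps_const (RtoC _)).
  by rewrite /=; field; apply: (not_0_INR N.+1).
have e2 : fps_const (RtoC ((-1) ^ N.+1)) = fps_opp (fps_const (RtoC ((-1) ^ N))).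
  apply: functional_extensionality => m; rewrite /fps_opp /fps_const RtoC_pow1S; case: eqP => _; ring.
transitivity (fps_add (fps_mult (fps_add fps_one u) (fps_theta (fps_log_trunc u N)))
   (fps_mult (fps_mult (fps_const (log_coef N.+1)) (fps_const (RtoC (INR N.+1))))
     (fps_mult (fps_add fps_one u) (fps_mult (fps_pow u N) (fps_theta u))))); first by ring.
by rewrite IH e e2 fps_powS; ring.
Qed.

(** At degree [m] the logarithm may be truncated at [N = m], where the error
    term [u ^ m * theta u] has order at least [m + 1]. *)
Lemma fps_log_theta (a : fps) : a 0%N = 1 ->
  fps_theta a = fps_mult a (fps_theta (fps_log a)).
Proof.
move=> a0; apply: functional_extensionality => m.
set u := fps_pred1 a.
have au : a = fps_add fps_one u.
  apply: functional_extensionality => -[|i]; rewrite /fps_add /u /fps_one /fps_pred1 /= ?a0; ring.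
have -> : fps_mult a (fps_theta (fps_log a)) m = fps_mult a (fps_theta (fps_log_trunc u m)) m.
  rewrite /fps_mult !fps_mulE; apply: eq_bigr => i _; congr (_ * (_ * _)).
  by rewrite (@fps_logE a _ m) //; lia.
rewrite {2}au fps_log_trunc_theta /fps_add /fps_opp fps_const_mulE.
have -> : fps_mult (fps_pow u m) (fps_theta u) m = 0.
  apply: (@vanishes_below_mul m 1) => //; last by lia.
    by apply: vanishes_below_pow; apply: vanishes_pred1.
  by case=> // _; rewrite /fps_theta /=; ring.
by case: (m) => [|i]; rewrite /fps_theta /u /fps_pred1 /=; ring.
Qed.

Lemma fps_log_0 a : fps_log a 0%N = 0.
Proof. by rewrite (@fps_logE _ _ 0%N) // big_ord0. Qed.

Lemma fps_pow_1mXn n k m : (0 < n)%N -> fps_pow (fps_pred1 (fps_1mXn n)) k m =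
  if m == (n * k)%N then RtoC ((-1) ^ k) else 0.
Proof.
move=> n0; elim: k m => [|k IH] m; first by rewrite muln0.
rewrite fps_powS /fps_mult fps_mulE.
have uE i : fps_pred1 (fps_1mXn n) i = if i == n then - RtoC 1 else 0.
  by rewrite /fps_pred1 /fps_1mXn; case: i => [|i] //=; case: eqP => // h; lia.
case: (leqP n m) => nm.
  rewrite (bigD1 (inord n)) //= inordK; last by lia.
  rewrite big1 ?Cplus_0_r; last first.
    move=> i hi; rewrite uE ifN ?Cmult_0_l //.
    by apply: contra hi => /eqP <-; rewrite inord_val.
  rewrite uE eqxx IH mulnS.
  have -> : (m - n == n * k)%N = (m == n + n * k)%N by lia.
  by rewrite RtoC_pow1S; case: eqP => _; ring.
rewrite ifN; last by rewrite mulnS; lia.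
rewrite big1 // => i _; rewrite uE ifN ?Cmult_0_l //; have := ltn_ord i; lia.
Qed.

Lemma fps_log_1mXn n m : (0 < n)%N -> (0 < m)%N -> fps_log (fps_1mXn n) m =
  if (n %| m)%N then - (RtoC (INR n) / RtoC (INR m)) else 0.
Proof.
move=> n0 m0; rewrite (@fps_logE _ _ m) //.
under eq_bigr => k _ do rewrite fps_pow_1mXn //.
case: ifP => [/dvdnP [k mk]|nm]; last first.
  rewrite big1 // => k _; rewrite ifN ?Cmult_0_r //.
  by apply/eqP => h; rewrite h dvdn_mulr in nm.
have k0 : (0 < k)%N by move: m0; rewrite mk; case: (k).
have km : (k.-1 < m)%N by rewrite mk; nia.
rewrite (bigD1 (Ordinal km)) //= big1 ?Cplus_0_r; last first.
  move=> i; rewrite -val_eqE /= => hi; rewrite ifN ?Cmult_0_r //.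
  apply: contra hi => /eqP h; apply/eqP.
  have : (n * i.+1 = n * k)%N by rewrite -h mk mulnC.
  by move/eqP; rewrite eqn_pmul2l // => /eqP <-.
rewrite prednK // ifT; last by rewrite mk mulnC.
have nn : INR n <> 0%R by apply: not_0_INR; lia.
have kk : INR k <> 0%R by apply: not_0_INR; lia.
have -> : INR m = (INR k * INR n)%R by rewrite -mult_INR; congr INR; rewrite mk.
rewrite /log_coef -RtoC_mult -RtoC_div; last by apply: Rmult_integral_contrapositive.
rewrite -RtoC_opp; congr RtoC.
have -> : ((-1) * (-1) ^ k.-1 = (-1) ^ k)%R by rewrite -[in RHS](prednK k0).
have -> : ((-1) ^ k.+1 / INR k * (-1) ^ k = - ((-1) ^ k * (-1) ^ k) / INR k)%R by rewrite /=; field.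
rewrite -Rpow_mult_distr (_ : (-1 * -1 = 1)%R); last ring.
by rewrite pow1; field.
Qed.

(** * Formal factorization into powers of 1 - z^n *)

(** The substitution [a (z ^ n)]. *)
Definition fps_sparse (n : nat) (a : fps) : fps :=
  fun m => if (n %| m)%N then a (m %/ n)%N else RtoC 0.

Lemma sum_sparse n (t : fps) N : (0 < n)%N ->
  \big[Cplus/RtoC 0]_(i < N.+1) fps_sparse n t i = \big[Cplus/RtoC 0]_(j < (N %/ n).+1) t j.
Proof.
move=> n0; elim: N => [|N IH].
  by rewrite div0n !big_ord1 /fps_sparse dvdn0 div0n.
rewrite big_ord_recr /= IH divnS // /fps_sparse divnS //.
case: (n %| N.+1)%N; last by rewrite add0n Cplus_0_r.
by rewrite !add1n [RHS]big_ord_recr.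
Qed.

Lemma fps_sparse_mul n a b : (0 < n)%N ->
  fps_mult (fps_sparse n a) (fps_sparse n b) = fps_sparse n (fps_mult a b).
Proof.
move=> n0; apply: functional_extensionality => m; rewrite /fps_mult [RHS]/fps_sparse !fps_mulE.
case: ifP => [/dvdnP [k ->]|nm].
  rewrite mulnK //.
  have := sum_sparse (fun i => a i * b (k - i)%N) (k * n) n0; rewrite mulnK // => <-.
  apply: eq_bigr => i _.
  rewrite /fps_sparse; case: ifP => [/dvdnP [j ->]|_]; last by ring.
  by rewrite -mulnBl dvdn_mull // !mulnK.
rewrite big1 // => i _; rewrite /fps_sparse; case: ifP => ni; last by ring.
rewrite ifN ?Cmult_0_r //; apply/negP => nmi.
have h := dvdn_add nmi ni; rewrite subnK in h; last by have := ltn_ord i; lia.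
by rewrite nm in h.
Qed.

Lemma fps_theta_sparse n a : (0 < n)%N ->
  fps_theta (fps_sparse n a) = fps_mult (fps_const (INR n)) (fps_sparse n (fps_theta a)).
Proof.
move=> n0; apply: functional_extensionality => m; rewrite fps_const_mulE /fps_theta /fps_sparse.
case: ifP => [/dvdnP [k ->]|_]; last by ring.
by rewrite mulnK // mult_INR RtoC_mult; ring.
Qed.

(** [(1 - z) ^ b]. *)
Definition fps_binom (b : C) : fps := fun k => Cbinom b k * Cpow (- RtoC 1) k.

Lemma CbinomS b k : Cbinom b k.+1 = Cbinom b k * (b - RtoC (INR k)) / RtoC (INR k.+1).
Proof.
have f0 j : RtoC (INR j`!) <> 0.
  by move=> /RtoC_inj; apply: not_0_INR; have := fact_gt0 j; lia.
have k0 : RtoC (INR k.+1) <> 0 by move=> /RtoC_inj; apply: not_0_INR.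
rewrite /Cbinom (_ : \big[Cmult/RtoC 1]_(i < k.+1) (b - RtoC (INR i)) =
  \big[Cmult/RtoC 1]_(i < k) (b - RtoC (INR i)) * (b - RtoC (INR k))); last by rewrite big_ord_recr.
by rewrite factS mult_INR RtoC_mult; field.
Qed.

Lemma Cbinom0 b : Cbinom b 0 = 1.
Proof. by rewrite /Cbinom big_ord0 /=; field; apply: RtoC_neq1. Qed.

(** The logarithmic derivative [theta F / F = - b z / (1 - z)] of
    [F = (1 - z) ^ b]. *)
Definition fps_binom_dlog (b : C) : fps := fun m => if m == 0%N then RtoC 0 else - b.

Lemma fps_theta_binom b :
  fps_theta (fps_binom b) = fps_mult (fps_binom b) (fps_binom_dlog b).
Proof.
apply: functional_extensionality => m; rewrite /fps_mult fps_mulE big_ord_recr /= subnn.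
rewrite /fps_binom_dlog eqxx Cmult_0_r Cplus_0_r.
rewrite (eq_bigr (fun i : 'I_m => fps_binom b i * - b)); last first.
  by move=> i _; rewrite ifN //; have := ltn_ord i; lia.
rewrite /fps_theta; elim: m => [|m IH]; first by rewrite big_ord0 /=; ring.
have k0 : RtoC (INR m.+1) <> 0 by move=> /RtoC_inj; apply: not_0_INR.
rewrite big_ord_recr /= -IH /fps_binom CbinomS.
change (RtoC (INR m.+1) * (Cbinom b m * (b - INR m) / INR m.+1 * ((- RtoC 1) * Cpow (- RtoC 1) m)) =
  INR m * (Cbinom b m * Cpow (- RtoC 1) m) + Cbinom b m * Cpow (- RtoC 1) m * - b).
by field.
Qed.

Lemma fps_theta_sparse_binom n b : (0 < n)%N ->
  fps_theta (fps_sparse n (fps_binom b)) = fps_mult (fps_sparse n (fps_binom b))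
    (fps_mult (fps_const (INR n)) (fps_sparse n (fps_binom_dlog b))).
Proof.
move=> n0; rewrite fps_theta_sparse // fps_theta_binom -fps_sparse_mul //; ring.
Qed.

(** The system is triangular with nonzero diagonal entries [m].  The auxiliary
    [B m] agrees with the solution up to [m] and is [0] beyond, which makes the
    recursion structural. *)
Lemma divisor_sum_solution (g : nat -> C) : exists b : nat -> C,
  forall m, (0 < m)%N -> g m =
    \big[Cplus/RtoC 0]_(1 <= n < m.+1 | (n %| m)%N) (RtoC (INR n) * b n).
Proof.
pose S m (b : nat -> C) := \big[Cplus/RtoC 0]_(1 <= n < m | (n %| m)%N) (RtoC (INR n) * b n).
pose B := fix B m : nat -> C := if m is j.+1 then
  (fun n => if n == m then (g m - S m (B j)) / RtoC (INR m) else B j n) else (fun=> RtoC 0).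
pose b n := B n n.
have Bb j k n : (n <= j)%N -> B (j + k)%N n = B j n.
  by move=> nj; elim: k => [|k IH]; [rewrite addn0 | rewrite addnS /= ifN // neq_ltn; lia].
exists b => -[|j] // _.
have k0 : RtoC (INR j.+1) <> 0 by move=> /RtoC_inj; apply: not_0_INR.
have Sb : S j.+1 (B j) = S j.+1 b.
  rewrite /S big_nat_cond [RHS]big_nat_cond; apply: eq_bigr => n /andP [h _]; congr (_ * _).
  by rewrite /b -{1}(@subnKC n j) ?Bb //; lia.
rewrite big_mkcond big_nat_recr //= -big_mkcond -/(S j.+1 b) dvdnn -Sb.
rewrite /b /= eqxx; field; exact: k0.
Qed.

Lemma fps_mult_0 a b : fps_mult a b 0%N = a 0%N * b 0%N.
Proof. by rewrite /fps_mult fps_mulE big_ord1. Qed.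

(** The hypothesis [b_log] is the comparison of coefficients of [z ^ m] in
    [theta (log a) = sum_n b n * n z^n / (1 - z^n)]. *)
Section FormalFactorization.
Variables (a : fps) (b : nat -> C).
Hypothesis a0 : a 0%N = 1.
Hypothesis b_log : forall m, (0 < m)%N -> RtoC (INR m) * fps_log a m =
    \big[Cplus/RtoC 0]_(1 <= n < m.+1 | (n %| m)%N) (RtoC (INR n) * b n).

Lemma log_fps_sum :
  is_fps_sum (fun n m => Copp (Cmult (b n) (fps_log (fps_1mXn n) m))) (fps_log a).
Proof.
move=> m; exists m => N mN.
rewrite (sum_n_m_1 (fun n => Copp (Cmult (b n) (fps_log (fps_1mXn n) m)))).
case: (posnP m) => [->|m0].
  by rewrite fps_log_0 big1 // => i _; rewrite fps_log_0; ring.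
have m1 : RtoC (INR m) <> 0 by move=> /RtoC_inj; apply: not_0_INR; lia.
have -> : fps_log a m = / RtoC (INR m) * (RtoC (INR m) * fps_log a m) by field.
rewrite b_log // big_distrr /=.
rewrite -(big_mkord xpredT (fun i => - (b i.+1 * fps_log (fps_1mXn i.+1) m))).
rewrite -(big_add1 _ _ 0 N.+1 xpredT (fun n => - (b n * fps_log (fps_1mXn n) m))) /=.
rewrite (@big_cat_nat _ _ _ m.+1) //=; try lia.
rewrite [X in _ + X]big1_seq ?Cplus_0_r; last first.
  move=> i; rewrite mem_index_iota => /andP [_ hi].
  rewrite fps_log_1mXn; [|lia|lia]; rewrite ifN; first by ring.
  by apply/negP => /dvdn_leq; lia.
rewrite [RHS]big_mkcond /=; apply: eq_big_nat => i hi.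
rewrite fps_log_1mXn; [|lia|lia]; case: ifP => _; last by ring.
by field.
Qed.

Fixpoint fps_binom_prod (M : nat) : fps :=
  if M is N.+1 then fps_mult (fps_binom_prod N) (fps_sparse N.+1 (fps_binom (b N.+1)))
  else fps_one.

Lemma fps_binom_prod_0 M : fps_binom_prod M 0%N = 1.
Proof.
elim: M => [//|M IH] /=; rewrite fps_mult_0 IH /fps_sparse dvdn0 div0n /fps_binom Cbinom0 /=; ring.
Qed.

(** [a * prod_(n <= M) (1 - z^n) ^ (b n)]: its logarithm is
    [- sum_(n > M) b n log (1 - z^n)], so that it should be [1 + O(z^(M+1))]. *)
Definition fps_remainder (M : nat) : fps := fps_mult a (fps_binom_prod M).

Definition fps_remainder_dlog (M : nat) : fps := fun m => fps_theta (fps_log a) m +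
  \big[Cplus/RtoC 0]_(1 <= n < M.+1)
     fps_mult (fps_const (INR n)) (fps_sparse n (fps_binom_dlog (b n))) m.

Lemma fps_theta_remainder M : fps_theta (fps_remainder M) =
  fps_mult (fps_remainder M) (fps_remainder_dlog M).
Proof.
elim: M => [|M IH].
  have e : fps_remainder 0 = a by rewrite /fps_remainder /= fps_mulC fps_mul1.
  rewrite e {1}(fps_log_theta a0); congr fps_mult.
  by apply: functional_extensionality => m; rewrite /fps_remainder_dlog big_geq // Cplus_0_r.
have -> : fps_remainder M.+1 =
    fps_mult (fps_remainder M) (fps_sparse M.+1 (fps_binom (b M.+1))).
  by rewrite /fps_remainder /= fps_mulA.
have -> : fps_remainder_dlog M.+1 = fps_add (fps_remainder_dlog M)
    (fps_mult (fps_const (INR M.+1)) (fps_sparse M.+1 (fps_binom_dlog (b M.+1)))).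
  apply: functional_extensionality => m; rewrite /fps_add /fps_remainder_dlog.
  by rewrite big_nat_recr //= Cplus_assoc.
rewrite fps_thetaM IH fps_theta_sparse_binom //; ring.
Qed.

Lemma fps_remainder_0 M : fps_remainder M 0%N = 1.
Proof. by rewrite /fps_remainder fps_mult_0 a0 fps_binom_prod_0; ring. Qed.

(** The logarithmic derivative of the remainder [F] vanishes up to degree [M]
    by the choice of [b], hence so does [theta F = F * theta F / F]. *)
Lemma fps_remainder_vanishes M m : (0 < m <= M)%N -> fps_remainder M m = 0.
Proof.
move=> /andP [m0 mM].
have m1 : RtoC (INR m) <> 0 by move=> /RtoC_inj; apply: not_0_INR; lia.
have dlog0 j : (j <= M)%N -> fps_remainder_dlog M j = 0.
  move=> jM; rewrite /fps_remainder_dlog.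
  case: (posnP j) => [->|j0].
    rewrite big1 => [|n _]; first by rewrite /fps_theta /=; ring.
    by rewrite fps_const_mulE /fps_sparse dvdn0 div0n /fps_binom_dlog /=; ring.
  rewrite [fps_theta _ _]b_log // [X in _ + X](@big_cat_nat _ _ _ j.+1) //=.
  rewrite [X in _ + (_ + X)]big1_seq; last first.
    move=> i; rewrite mem_index_iota => /andP [_ hi].
    rewrite fps_const_mulE /fps_sparse ifN ?Cmult_0_r //.
    by apply/negP => /dvdn_leq; lia.
  rewrite Cplus_0_r big_mkcond -big_split big1_seq //= => i.
  rewrite mem_index_iota => /andP [i0 _].
  rewrite fps_const_mulE /fps_sparse; case: ifP => [d|_]; last by ring.
  rewrite /fps_binom_dlog ifN; first by ring.
  by rewrite -lt0n divn_gt0 //; apply: dvdn_leq.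
have : fps_theta (fps_remainder M) m = 0.
  rewrite fps_theta_remainder /fps_mult fps_mulE big1 // => i _.
  by rewrite dlog0 ?Cmult_0_r //; lia.
rewrite /fps_theta => h.
have -> : fps_remainder M m = / RtoC (INR m) * (RtoC (INR m) * fps_remainder M m) by field.
by rewrite h Cmult_0_r.
Qed.
End FormalFactorization.

(** * Products of convergent power series *)

Lemma sum_f_R0_big (u : nat -> R) m : sum_f_R0 u m = \big[Rplus/0%R]_(i < m.+1) u i.
Proof. by rewrite -sum_n_Reals sum_n_Rbig. Qed.

Lemma is_Cseries_mul (a b : nat -> C) : abs_summable a -> abs_summable b ->
  is_Cseries (fps_mul a b) (CSeries a * CSeries b).
Proof.
move=> sa sb.
have [ra ia] := proj1 (is_Cseries_ReIm _ _) (CSeries_correct sa).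
have [rb ib] := proj1 (is_Cseries_ReIm _ _) (CSeries_correct sb).
have [sra sia] := (abs_summable_Re sa, abs_summable_Im sa).
have [srb sib] := (abs_summable_Re sb, abs_summable_Im sb).
have Rsum_minus n (F G : nat -> R) : (\big[Rplus/0%R]_(i < n) F i - \big[Rplus/0%R]_(i < n) G i =
   \big[Rplus/0%R]_(i < n) (F i - G i))%R.
  elim: n => [|n IH]; first by rewrite !big_ord0; ring.
  rewrite !big_ord_recr /= -IH /Rminus Ropp_plus_distr; set x := bigop _ _ _; set y := bigop _ _ _; ring.
apply/is_Cseries_ReIm; split.
  have := is_series_minus _ _ _ _ (is_series_mult _ _ _ _ ra rb sra srb) (is_series_mult _ _ _ _ ia ib sia sib).
  apply: is_series_ext => m; rewrite fps_mulE Re_sum !sum_f_R0_big /plus /opp /=.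
  exact: (Rsum_minus m.+1 (fun i => Re (a i) * Re (b (m - i)%N))%R (fun i => Im (a i) * Im (b (m - i)%N))%R).
have := is_series_plus _ _ _ _ (is_series_mult _ _ _ _ ra ib sra sib) (is_series_mult _ _ _ _ ia rb sia srb).
apply: is_series_ext => m; rewrite fps_mulE Im_sum !sum_f_R0_big /plus /=.
by rewrite -big_split.
Qed.

Lemma abs_summable_mul (a b : nat -> C) : abs_summable a -> abs_summable b ->
  abs_summable (fps_mul a b).
Proof.
move=> /Series_correct sa /Series_correct sb.
have := is_series_mult_pos _ _ _ _ sa sb (fun n => Cmod_ge_0 _) (fun n => Cmod_ge_0 _).
move=> H; apply: abs_summable_le; last by exists (Series (fun k => Cmod (a k)) * Series (fun k => Cmod (b k)))%R; exact: H.
move=> m /=; rewrite fps_mulE sum_f_R0_big.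
by apply: Rle_trans (Cmod_sum _ _ _) _; apply: Rsum_le => i _; rewrite Cmod_mult; apply: Rle_refl.
Qed.

Lemma fps_mul_scale (a b : nat -> C) (z : C) m :
  fps_mul (fun k => a k * z ^ k) (fun k => b k * z ^ k) m = fps_mul a b m * z ^ m.
Proof.
rewrite !fps_mulE big_distrl /=; apply: eq_bigr => i _.
have -> : z ^ m = z ^ i * z ^ (m - i).
  by rewrite -Cpow_add_r; congr (z ^ _); have := ltn_ord i; lia.
ring.
Qed.

Lemma Cmod_RtoC_pos x : (0 <= x)%R -> Cmod (RtoC x) = x.
Proof. by move=> x0; rewrite Cmod_R Rabs_pos_eq. Qed.

Lemma converges_below_le a rho rho' : (rho' <= rho)%R -> converges_below a rho -> converges_below a rho'.
Proof. by move=> h H x hx; apply: H; lra. Qed.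

Lemma converges_below_mul a b rho : converges_below a rho -> converges_below b rho ->
  converges_below (fps_mul a b) rho.
Proof.
move=> ha hb x hx.
have xx : (Cmod (RtoC x) < rho)%R by rewrite Cmod_RtoC_pos; lra.
have := abs_summable_mul (converges_below_summable ha xx) (converges_below_summable hb xx).
by apply: ex_series_ext => k; rewrite fps_mul_scale Cmod_mult Cmod_pow Cmod_RtoC_pos //; lra.
Qed.

Lemma is_Cseries_mul_power a b rho z la lb : converges_below a rho -> converges_below b rho ->
  (Cmod z < rho)%R ->
  is_Cseries (fun k => a k * z ^ k) la -> is_Cseries (fun k => b k * z ^ k) lb ->
  is_Cseries (fun k => fps_mul a b k * z ^ k) (la * lb).
Proof.
move=> ha hb hz /CSeries_unique <- /CSeries_unique <-.
have := is_Cseries_mul (converges_below_summable ha hz) (converges_below_summable hb hz).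
by apply: is_series_ext => k; exact: fps_mul_scale.
Qed.

Lemma ex_series_ratio (v : nat -> R) (q : R) N : (0 <= q < 1)%R ->
  (forall k, (0 <= v k)%R) -> (forall k, (N <= k)%N -> (v k.+1 <= q * v k)%R) -> ex_series v.
Proof.
move=> hq v0 H; apply/(ex_series_incr_n _ N).
have := ex_series_scal_r (v N) _ (ex_series_geom q ltac:(rewrite Rabs_pos_eq; lra)).
apply: (@ex_series_le R_AbsRing R_CompleteNormedModule) => k.
rewrite /norm /= /abs /= Rabs_pos_eq //.
elim: k => [|k IH]; first by rewrite /= Rmult_1_l Nat.add_0_r; apply: Rle_refl.
rewrite Nat.add_succ_r.
apply: Rle_trans (H _ _) _; first by lia.
rewrite /= Rmult_assoc; apply: Rmult_le_compat_l; [lra | exact: IH].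
Qed.

(** The ratio of consecutive terms is [x |b - k| / (k + 1)], which tends to
    [x < 1]; from [N] on it is below the midpoint [(1 + x) / 2]. *)
Lemma converges_below_binom b : converges_below (fps_binom b) 1.
Proof.
move=> x hx.
have E k : Cmod (fps_binom b k) = Cmod (Cbinom b k).
  by rewrite /fps_binom Cmod_mult Cmod_pow Cmod_opp Cmod_1 pow1 Rmult_1_r.
have [N HN] := INR_archimed 1 (2 * Cmod b / (1 - x)) Rlt_0_1.
have b0 := Cmod_ge_0 b.
apply: (@ex_series_ratio _ ((1 + x) / 2)%R N); first lra.
  by move=> k; apply: Rmult_le_pos; [exact: Cmod_ge_0 | apply: pow_le; lra].
move=> k Nk; rewrite !E CbinomS.
have k1 : (0 < INR k.+1)%R by apply: lt_0_INR; lia.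
have k0 : RtoC (INR k.+1) <> 0 by move=> /RtoC_inj; lra.
rewrite Cmod_div // Cmod_mult Cmod_RtoC_pos; last lra.
have hb : (Cmod (b - INR k) <= Cmod b + INR k)%R.
  apply: Rle_trans (Cmod_triangle _ _) _.
  by rewrite Cmod_opp Cmod_RtoC_pos; [apply: Rle_refl | exact: pos_INR].
have hk : (2 * Cmod b <= (1 - x) * INR k.+1)%R.
  have : (INR N <= INR k.+1)%R by apply: le_INR; lia.
  have -> : (2 * Cmod b = (1 - x) * (2 * Cmod b / (1 - x)))%R by field; lra.
  move=> h; apply: Rmult_le_compat_l; lra.
have hr : (Cmod (b - INR k) * x <= (1 + x) / 2 * INR k.+1)%R.
  apply: (Rle_trans _ ((Cmod b + INR k) * x)); first by apply: Rmult_le_compat_r; lra.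
  have : (Cmod b * x <= Cmod b * 1)%R by apply: Rmult_le_compat_l; lra.
  have := pos_INR k; rewrite S_INR in hk *; nra.
have p0 : (0 <= Cmod (Cbinom b k) * x ^ k / INR k.+1)%R.
  apply: Rmult_le_pos; last by apply/Rlt_le/Rinv_0_lt_compat.
  by apply: Rmult_le_pos; [exact: Cmod_ge_0 | apply: pow_le; lra].
have := Rmult_le_compat_l _ _ _ p0 hr.
have -> : (Cmod (Cbinom b k) * x ^ k / INR k.+1 * (Cmod (b - INR k) * x) =
  Cmod (Cbinom b k) * Cmod (b - INR k) / INR k.+1 * x ^ k.+1)%R by rewrite [(x ^ k.+1)%R]/=; field; lra.
have -> : (Cmod (Cbinom b k) * x ^ k / INR k.+1 * ((1 + x) / 2 * INR k.+1) =
  (1 + x) / 2 * (Cmod (Cbinom b k) * x ^ k))%R by field; lra.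
by [].
Qed.

Lemma is_Cseries_pow1m w b : (Cmod w < 1)%R ->
  is_Cseries (fun k => fps_binom b k * w ^ k) (pow1m w b).
Proof.
move=> hw.
have E k : fps_binom b k * w ^ k = Cbinom b k * Cpow (- w) k.
  have -> : - w = - RtoC 1 * w by ring.
  by rewrite /fps_binom Cpow_mult_l; ring.
rewrite /pow1m (_ : (fun k => Cbinom b k * Cpow (- w) k) = (fun k => fps_binom b k * w ^ k)); last first.
  by apply: functional_extensionality => k.
by apply: CSeries_correct; apply: (@converges_below_summable _ 1%R) => //; exact: converges_below_binom.
Qed.

Lemma fps_sparse_scale n a (z : C) m : (0 < n)%N ->
  fps_sparse n a m * z ^ m = fps_sparse n (fun k => a k * (z ^ n) ^ k) m.
Proof.
move=> n0; rewrite /fps_sparse; case: ifP => [/dvdnP [k ->]|_]; last by ring.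
by rewrite mulnK // -Cpow_mult_r mulnC.
Qed.

Lemma is_Cseries_sparse n (t : fps) l : (0 < n)%N ->
  is_Cseries t l -> is_Cseries (fps_sparse n t) l.
Proof.
move=> n0 H; rewrite /is_series.
apply: (filterlim_ext (fun N => sum_n (t : nat -> C_NormedModule) (N %/ n)%N)).
  by move=> N; rewrite !sum_n_Cbig sum_sparse.
apply: (filterlim_comp _ _ _ (fun N => (N %/ n)%N) _ _ eventually _ _ H).
move=> P [N HN]; exists (N * n)%N => m hm; apply: HN.
by apply/leP; rewrite leq_divRL //; apply/leP.
Qed.

Lemma pow_lt_1 x n : (0 <= x < 1)%R -> (0 < n)%N -> (0 <= x ^ n < 1)%R.
Proof.
move=> hx; case: n => // n _; split; first by apply: pow_le; lra.
elim: n => [|n IH]; first by rewrite /=; lra.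
rewrite -[(x ^ n.+2)%R]/(x * x ^ n.+1)%R.
have : (0 <= x ^ n.+1)%R by apply: pow_le; lra.
nra.
Qed.

Lemma converges_below_sparse n a : (0 < n)%N -> converges_below a 1 ->
  converges_below (fps_sparse n a) 1.
Proof.
move=> n0 H x hx.
have hxn := pow_lt_1 hx n0.
have [l hl] := H _ hxn.
have hC : is_Cseries (fun k => RtoC (Cmod (a k) * (x ^ n) ^ k)) (RtoC l).
  apply/is_Cseries_ReIm; split; first exact: hl.
  rewrite /=; apply/is_series_big; apply: is_lim_seq_ext (is_lim_seq_const 0) => m.
  by rewrite big1.
have /is_Cseries_ReIm [h _] := is_Cseries_sparse n0 hC.
exists (Re (RtoC l)); apply: is_series_ext h => m.
rewrite /fps_sparse; case: ifP => [/dvdnP [k ->]|_]; last by rewrite Cmod_0 /=; ring.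
by rewrite mulnK //= -pow_mult; congr (_ * x ^ _)%R; lia.
Qed.

Lemma is_Cseries_sparse_binom n b (z : C) : (0 < n)%N -> (Cmod z < 1)%R ->
  is_Cseries (fun k => fps_sparse n (fps_binom b) k * z ^ k) (pow1m (z ^ n) b).
Proof.
move=> n0 hz.
have hzn : (Cmod (z ^ n) < 1)%R.
  by rewrite Cmod_pow; apply pow_lt_1 => //; split => //; exact: Cmod_ge_0.
have := is_Cseries_sparse n0 (@is_Cseries_pow1m _ b hzn).
by apply: is_series_ext => k; rewrite fps_sparse_scale.
Qed.

Lemma converges_below_binom_prod b M : converges_below (fps_binom_prod b M) 1.
Proof.
elim: M => [|M IH] /=.
  move=> x hx; apply/(ex_series_incr_1); exists 0%R.
  apply/is_series_big; apply: is_lim_seq_ext (is_lim_seq_const 0) => m.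
  by rewrite big1 // => k _; rewrite /fps_one /= Cmod_0 Rmult_0_l.
by apply: converges_below_mul => //; apply: converges_below_sparse => //; exact: converges_below_binom.
Qed.

Lemma is_Cseries_binom_prod b M (z : C) : (Cmod z < 1)%R ->
  is_Cseries (fun k => fps_binom_prod b M k * z ^ k)
    (\big[Cmult/RtoC 1]_(1 <= n < M.+1) pow1m (z ^ n) (b n)).
Proof.
move=> hz; elim: M => [|M IH].
  rewrite big_geq //; apply: (@is_series_decr_1 C_AbsRing C_NormedModule).
  have -> : plus (RtoC 1 : C_NormedModule) (opp (fps_binom_prod b 0 0%N * z ^ 0)) = RtoC 0.
    by change (RtoC 1 + - (RtoC 1 * 1) = RtoC 0); ring.
  apply/is_Cseries_big; apply: filterlim_ext (filterlim_const _) => n.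
  by rewrite big1 // => k _; rewrite /= /fps_one /=; ring.
rewrite big_nat_recr //=; apply: (@is_Cseries_mul_power _ _ 1%R) => //.
- exact: converges_below_binom_prod.
- by apply: converges_below_sparse => //; exact: converges_below_binom.
- exact: is_Cseries_sparse_binom.
Qed.

(** * Smooth numbers and finite Euler products *)

(** The integers whose prime factors are at most [N] and occur with exponent
    at most [K]; built prime by prime so that expanding a finite Euler product
    is an induction on [N]. *)
Fixpoint smooth_numbers (K N : nat) : seq nat :=
  if N is N'.+1 then
    if prime N then [seq (N ^ k * m)%N | k <- seq.iota 0 K.+1, m <- smooth_numbers K N']
    else smooth_numbers K N'
  else [:: 1%N].

Lemma smooth_numbersS K N : smooth_numbers K N.+1 =
  if prime N.+1 then [seq (N.+1 ^ k * m)%N | k <- seq.iota 0 K.+1, m <- smooth_numbers K N]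
  else smooth_numbers K N.
Proof. by []. Qed.

Lemma smooth_gt0_coprime K N m : m \in smooth_numbers K N ->
  (0 < m)%N /\ forall p, prime p -> (N < p)%N -> ~~ (p %| m)%N.
Proof.
elim: N m => [|N IH] m.
  rewrite inE => /eqP ->; split=> // p pp _; by rewrite dvdn1 neq_ltn prime_gt1 ?orbT.
rewrite smooth_numbersS; case: ifP => pN; last first.
  by move=> /IH [m0 h]; split=> // p pp hp; apply: h => //; lia.
move=> /allpairsP [[k m'] /= [_ /IH [m0 h] ->]]; split.
  by rewrite muln_gt0 m0 expn_gt0.
move=> p pp hp; rewrite Euclid_dvdM // Euclid_dvdX // negb_or h ?andbT //; last by lia.
rewrite negb_and dvdn_prime2 // neq_ltn; apply/orP; left; lia.
Qed.

Lemma logn_smooth_cofactor q k m : prime q -> (0 < m)%N -> ~~ (q %| m)%N ->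
  logn q (q ^ k * m) = k.
Proof.
move=> pq m0 qm; have q0 : (0 < q ^ k)%N by rewrite expn_gt0 prime_gt0.
rewrite lognM // pfactorK //.
by rewrite lognE pq m0 (negbTE qm) addn0.
Qed.

Lemma uniq_smooth_numbers K N : uniq (smooth_numbers K N).
Proof.
elim: N => [//|N IH]; rewrite smooth_numbersS; case: ifP => pN //; apply: allpairs_uniq => //; first exact: seq.iota_uniq.
move=> [k m] [k' m'].
case/allpairsPdep => [x [y [_ hy [-> ->]]]] /allpairsPdep [x' [y' [_ hy' [-> ->]]]] /= e.
have [y0 hyp] := smooth_gt0_coprime hy; have [y0' hyp'] := smooth_gt0_coprime hy'.
have d := hyp _ pN (ltnSn N); have d' := hyp' _ pN (ltnSn N).
have kk : x = x' by rewrite -(logn_smooth_cofactor x pN y0 d) e logn_smooth_cofactor.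
move: e; rewrite kk => /eqP; rewrite eqn_pmul2l ?expn_gt0 ?prime_gt0 //.
by move=> /eqP ->.
Qed.

Lemma mem_smooth_numbers K N n : (0 < n)%N ->
  (forall p, prime p -> (p %| n)%N -> (p <= N)%N) -> (forall p, (logn p n <= K)%N) ->
  n \in smooth_numbers K N.
Proof.
elim: N n => [|N IH] n n0 hp hK.
  rewrite inE; apply/eqP; case: (ltngtP n 1%N) => // h; first by lia.
  have pn : prime (pdiv n) by apply: pdiv_prime.
  have := hp _ pn (pdiv_dvd n); have := prime_gt0 pn; lia.
rewrite smooth_numbersS; case: ifP => pN; last first.
  apply: IH => // p pp pn; have := hp p pp pn; rewrite leq_eqVlt ltnS => /orP [/eqP e|//].
  by rewrite e pN in pp.
have [m cm en] := pfactor_coprime pN n0.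
apply/allpairsP; exists (logn N.+1 n, m); split.
- by rewrite mem_iota add0n ltnS; apply: hK.
- have m0 : (0 < m)%N by move: n0; rewrite en; case: (m).
  apply: IH => //.
    move=> p pp pm; have pn : (p %| n)%N by rewrite en dvdn_mulr.
    have := hp p pp pn; rewrite leq_eqVlt ltnS => /orP [/eqP e|//].
    by move: cm; rewrite -e prime_coprime // pm.
  move=> p; apply: leq_trans (hK p); apply: dvdn_leq_log => //.
  by rewrite en dvdn_mulr.
by rewrite {1}en mulnC.
Qed.

Lemma mem_smooth_le K N n : (0 < n <= N)%N -> (N <= K)%N -> n \in smooth_numbers K N.
Proof.
move=> /andP [n0 nN] NK; apply: mem_smooth_numbers => //.
  by move=> p _ pn; apply: leq_trans nN; apply: dvdn_leq.
move=> p; apply: leq_trans NK; apply: leq_trans nN.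
exact: ltnW (ltn_logl p n0).
Qed.

(** The multiplicative function with value [u p k] at [p ^ k]. *)
Definition multiplicative_ext (u : nat -> nat -> C) (n : nat) : C :=
  \big[Cmult/RtoC 1]_(p < n.+1 | prime p) u p (logn p n).

Section EulerExpansion.
Variable u : nat -> nat -> C.
Hypothesis u0 : forall p, u p 0%N = 1.

Lemma multiplicative_extE B n : (n < B)%N ->
  multiplicative_ext u n = \big[Cmult/RtoC 1]_(p < B | prime p) u p (logn p n).
Proof.
move=> nB; rewrite /multiplicative_ext (big_ord_widen_cond B prime (fun p => u p (logn p n))) //.
apply/esym; rewrite (bigID (fun p : 'I_B => (p < n.+1)%N)) /= [X in _ * X]big1 ?Cmult_1_r //.
move=> p /andP [pp hp]; case: (posnP n) => [->|n0]; first by rewrite logn0 u0.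
have -> : logn p n = 0%N; last by [].
by rewrite lognE pp n0 /=; case: ifP => // /dvdn_leq h; have := h n0; lia.
Qed.

Lemma multiplicative_ext_prime_pow q k m : prime q -> (0 < m)%N -> ~~ (q %| m)%N ->
  multiplicative_ext u (q ^ k * m) = u q k * multiplicative_ext u m.
Proof.
move=> pq m0 qm; have q0 := prime_gt0 pq.
have qk0 : (0 < q ^ k)%N by rewrite expn_gt0 q0.
set B := (q ^ k * m + q).+1.
have qB : (q < B)%N by rewrite /B; lia.
have mB : (m < B)%N by rewrite /B; nia.
rewrite !(@multiplicative_extE B) //; last by rewrite /B; lia.
rewrite (bigD1 (Ordinal qB)) //= [X in _ = _ * X](bigD1 (Ordinal qB)) //=.
rewrite logn_smooth_cofactor // lognE pq m0 (negbTE qm) /= u0 Cmult_1_l; congr (_ * _).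
apply: eq_bigr => p /andP [pp]; rewrite -val_eqE /= => pqn; congr (u _ _).
rewrite lognM // lognX [logn p q]logn_prime //.
by rewrite (negbTE pqn) muln0.
Qed.

(** Unique factorization: the numbers [q ^ k * m] with [m] a product of primes
    below [q] are exactly those produced by multiplying in the factor at [q]. *)
Lemma euler_expansion K N :
  \big[Cmult/RtoC 1]_(p < N.+1 | prime p) \big[Cplus/RtoC 0]_(k < K.+1) u p k =
  \big[Cplus/RtoC 0]_(n <- smooth_numbers K N) multiplicative_ext u n.
Proof.
elim: N => [|N IH].
  rewrite big_mkcond big_ord1 /= big_seq1 /multiplicative_ext big1 // => p pp.
  by rewrite logn1 u0.
rewrite big_mkcond big_ord_recr -big_mkcond [LHS]/= IH smooth_numbersS.
case: ifP => pN; last by rewrite Cmult_1_r.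
rewrite big_allpairs_dep Cmult_comm big_distrl /= -(big_mkord xpredT (fun k => u N.+1 k * _)).
rewrite /index_iota subn0; apply: eq_bigr => k _.
rewrite big_distrr /=; apply: eq_big_seq => m /smooth_gt0_coprime [m0 hm].
by rewrite multiplicative_ext_prime_pow //; apply: hm.
Qed.
End EulerExpansion.

(** * Convergence of Euler products *)

Lemma filterlim_Cmult (f g : nat -> C) (l m : C) :
  filterlim f eventually (locally l) -> filterlim g eventually (locally m) ->
  filterlim (fun n => f n * g n) eventually (locally (l * m)).
Proof.
move=> /filterlim_C_ReIm [f1 f2] /filterlim_C_ReIm [g1 g2].
apply/filterlim_C_ReIm; split.
  exact: (is_lim_seq_minus' _ _ _ _ (is_lim_seq_mult' _ _ _ _ f1 g1) (is_lim_seq_mult' _ _ _ _ f2 g2)).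
exact: (is_lim_seq_plus' _ _ _ _ (is_lim_seq_mult' _ _ _ _ f1 g2) (is_lim_seq_mult' _ _ _ _ f2 g1)).
Qed.

Lemma filterlim_Cprod I (r : seq I) (P : pred I) (f : I -> nat -> C) (l : I -> C) :
  (forall i, P i -> filterlim (f i) eventually (locally (l i))) ->
  filterlim (fun n => \big[Cmult/RtoC 1]_(i <- r | P i) f i n) eventually
    (locally (\big[Cmult/RtoC 1]_(i <- r | P i) l i)).
Proof.
move=> H; elim: r => [|i r IH].
  rewrite big_nil; apply: filterlim_ext (filterlim_const _) => n.
  by rewrite big_nil.
rewrite big_cons; case: ifP => Pi.
  apply: filterlim_ext (filterlim_Cmult (H i Pi) IH) => n.
  by rewrite big_cons Pi.
by apply: filterlim_ext IH => n; rewrite big_cons Pi.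
Qed.

Lemma RtoC_sum I (r : seq I) (P : pred I) (F : I -> R) :
  RtoC (\big[Rplus/0%R]_(i <- r | P i) F i) = \big[Cplus/RtoC 0]_(i <- r | P i) RtoC (F i).
Proof. by apply: (big_morph RtoC) => // x y; rewrite RtoC_plus. Qed.

Lemma RtoC_prod I (r : seq I) (P : pred I) (F : I -> R) :
  RtoC (\big[Rmult/1%R]_(i <- r | P i) F i) = \big[Cmult/RtoC 1]_(i <- r | P i) RtoC (F i).
Proof. by apply: (big_morph RtoC) => // x y; rewrite RtoC_mult. Qed.

Lemma Rprod_le_exp I (r : seq I) (P : pred I) (x t : I -> R) :
  (forall i, P i -> (0 <= x i <= 1 + t i)%R) ->
  (0 <= \big[Rmult/1%R]_(i <- r | P i) x i <= exp (\big[Rplus/0%R]_(i <- r | P i) t i))%R.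
Proof.
move=> H; elim/big_rec2: _ => [|i y z Pi IH]; first by rewrite exp_0; lra.
have hi := H i Pi; have := exp_ineq1_le (t i); rewrite exp_plus => he.
split; first by apply: Rmult_le_pos; lra.
apply: Rmult_le_compat; lra.
Qed.

Lemma Rsum_sub_le (T : eqType) (s s' : seq T) (F : T -> R) :
  uniq s -> {subset s <= s'} -> (forall i, (0 <= F i)%R) ->
  (\big[Rplus/0%R]_(i <- s) F i <= \big[Rplus/0%R]_(i <- s') F i)%R.
Proof.
move=> us ss F0.
elim: s s' us ss => [|x s IH] s' us ss.
  by rewrite big_nil; apply: Rsum_ge0.
have xs' : x \in s' by apply: ss; rewrite inE eqxx.
rewrite big_cons (perm_big _ (perm_to_rem xs')) /= big_cons.
apply: Rplus_le_compat_l; apply: IH; first by case/andP: us.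
move=> y ys; have := ss y; rewrite inE ys orbT => /(_ isT).
rewrite (perm_mem (perm_to_rem xs')) inE => /orP [/eqP e|//].
by move: us; rewrite -e /= ys.
Qed.

Lemma big_iota1_ord T (idx : T) (op : T -> T -> T) X (F : nat -> T) :
  \big[op/idx]_(n <- index_iota 1 X.+1) F n = \big[op/idx]_(n < X) F n.+1.
Proof. by rewrite big_add1 /= big_mkord. Qed.

(** The local factors [sum_k |u p k|] are at most [1 + t p] with [t] summable:
    this bounds all finite Euler products of absolute values at once. *)
Section EulerProduct.
Variables (u : nat -> nat -> C) (t : nat -> R).
Hypothesis u0 : forall p, u p 0%N = 1.
Hypothesis su : forall p, prime p -> abs_summable (u p).
Hypothesis t0 : forall p, (0 <= t p)%R.
Hypothesis st : ex_series t.
Hypothesis ut : forall p, prime p -> (Series (fun k => Cmod (u p k)) <= 1 + t p)%R.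

Let h := multiplicative_ext u.

(** Apply the finite expansion to the nonnegative function [|u p k|], and
    [1 + t <= exp t] to the resulting product. *)
Lemma euler_abs_bound K N :
  (\big[Rplus/0%R]_(n <- smooth_numbers K N) Cmod (h n) <= exp (Series t))%R.
Proof.
pose v p k := RtoC (Cmod (u p k)).
have v0 p : v p 0%N = 1 by rewrite /v u0 Cmod_1.
have hv n : multiplicative_ext v n = RtoC (Cmod (h n)).
  by rewrite /h /multiplicative_ext Cmod_prod RtoC_prod.
have E : \big[Rplus/0%R]_(n <- smooth_numbers K N) Cmod (h n) =
    \big[Rmult/1%R]_(p < N.+1 | prime p) \big[Rplus/0%R]_(k < K.+1) Cmod (u p k).
  apply: RtoC_inj; rewrite RtoC_sum RtoC_prod.
  under eq_bigr => n _ do rewrite -hv.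
  by rewrite -(euler_expansion v0); apply: eq_bigr => p _; rewrite RtoC_sum.
rewrite E.
have [//|_ hle] := @Rprod_le_exp _ (index_enum 'I_N.+1) (fun p : 'I_N.+1 => prime p)
    (fun p => \big[Rplus/0%R]_(k < K.+1) Cmod (u p k)) (fun p => t p).
  move=> p pp; split; first by apply: Rsum_ge0 => k _; exact: Cmod_ge_0.
  apply: Rle_trans (ut pp); apply: Rsum_le_Series; last exact: su.
  by move=> k; exact: Cmod_ge_0.
apply: Rle_trans hle _.
have hs : (\big[Rplus/0%R]_(p < N.+1 | prime p) t p <= Series t)%R.
  apply: (Rle_trans _ (\big[Rplus/0%R]_(p < N.+1) t p)); last exact: Rsum_le_Series.
  rewrite big_mkcond; apply: Rsum_le => p _; case: ifP => _; [exact: Rle_refl | exact: t0].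
case: (Rle_lt_or_eq_dec _ _ hs) => [hlt|->]; [exact/Rlt_le/exp_increasing | exact: Rle_refl].
Qed.

Lemma euler_abs_summable : abs_summable (fun n => h n.+1).
Proof.
apply: (@ex_series_bounded _ (exp (Series t))) => [n|X]; first exact: Cmod_ge_0.
apply: Rle_trans (euler_abs_bound X X).
rewrite -(@big_iota1_ord _ 0%R Rplus X (fun n => Cmod (h n))).
apply: Rsum_sub_le; first exact: seq.iota_uniq; last by move=> i; exact: Cmod_ge_0.
by move=> n; rewrite mem_index_iota => /andP [n0 nX]; apply: mem_smooth_le => //; rewrite n0.
Qed.

Let S := CSeries (fun n => h n.+1).
Let tail N := (Series (fun n => Cmod (h n.+1)) - \big[Rplus/0%R]_(n < N) Cmod (h n.+1))%R.

(** The list of smooth numbers contains [1, ..., N], so the sum over it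
    misses only terms of index greater than [N].  The bound does not depend
    on [K], which allows [K] to tend to infinity before [N]. *)
Lemma smooth_sum_close K N : (N <= K)%N ->
  (Cmod (\big[Cplus/RtoC 0]_(n <- smooth_numbers K N) h n - S) <= tail N)%R.
Proof.
move=> NK; set s := smooth_numbers K N.
have hS := proj1 (is_Cseries_big _ _) (CSeries_correct euler_abs_summable).
have [X0 HX0] : exists X0, forall n, n \in s -> (n <= X0)%N.
  by exists (\max_(n <- s) n) => n ns; apply: leq_bigmax_seq.
set V := \big[Cplus/RtoC 0]_(n <- s) h n.
have lim : filterlim (fun X => V - \big[Cplus/RtoC 0]_(n < X) h n.+1) eventually (locally (V - S)).
  apply/filterlim_C_eps => e e0; have /filterlim_C_eps /(_ e e0) := hS.
  apply: filter_imp => X; have -> : V - \big[Cplus/RtoC 0]_(n < X) h n.+1 - (V - S) =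
    - (\big[Cplus/RtoC 0]_(n < X) h n.+1 - S) by ring.
  by rewrite Cmod_opp.
apply: (filterlim_Cmod_le lim); exists (maxn X0 N) => X /leP; rewrite geq_max => /andP [hX hN].
pose r := index_iota 1 X.+1.
have EV : V = \big[Cplus/RtoC 0]_(n <- r | n \in s) h n.
  rewrite /V -[RHS]big_filter; apply: perm_big; apply: uniq_perm.
  - exact: uniq_smooth_numbers.
  - exact/filter_uniq/seq.iota_uniq.
  move=> n; rewrite mem_filter mem_index_iota; case ns: (n \in s) => //=.
  have [n0 _] := smooth_gt0_coprime ns; rewrite n0 ltnS /=.
  by rewrite (leq_trans (HX0 _ ns)).
rewrite -(@big_iota1_ord _ (RtoC 0) Cplus X h) -/r (bigID (mem s)) /= -EV.
have -> : V - (V + \big[Cplus/RtoC 0]_(n <- r | n \notin s) h n) =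
  - \big[Cplus/RtoC 0]_(n <- r | n \notin s) h n by ring.
rewrite Cmod_opp; apply: Rle_trans (Cmod_sum _ _ _) _.
have le1 : (\big[Rplus/0%R]_(n <- r | n \notin s) Cmod (h n) <=
    \big[Rplus/0%R]_(n <- index_iota N.+1 X.+1) Cmod (h n))%R.
  rewrite -big_filter; apply: Rsum_sub_le; first exact/filter_uniq/seq.iota_uniq;
    last by move=> i; exact: Cmod_ge_0.
  move=> n; rewrite mem_filter !mem_index_iota => /andP [ns /andP [n0 ->]]; rewrite andbT.
  rewrite ltnNge; apply/negP => nN; move/negP: ns; apply.
  by apply: mem_smooth_le => //; rewrite n0.
apply: Rle_trans le1 _; rewrite /tail.
have := @Rsum_le_Series (fun n => Cmod (h n.+1)) X (fun k => Cmod_ge_0 _) euler_abs_summable.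
rewrite -(@big_iota1_ord _ 0%R Rplus X (fun n => Cmod (h n))).
rewrite -(@big_iota1_ord _ 0%R Rplus N (fun n => Cmod (h n))).
rewrite (@big_cat_nat _ _ _ N.+1) //=; lra.
Qed.

Theorem euler_product_converges :
  is_euler_product (fun p => CSeries (u p)) S.
Proof.
have close N : (Cmod (\big[Cmult/RtoC 1]_(p < N.+1 | prime p) CSeries (u p) - S) <= tail N)%R.
  have lim : filterlim (fun K => \big[Cmult/RtoC 1]_(p < N.+1 | prime p)
      \big[Cplus/RtoC 0]_(k < K.+1) u p k) eventually
      (locally (\big[Cmult/RtoC 1]_(p < N.+1 | prime p) CSeries (u p))).
    apply: (filterlim_Cprod (f := fun (p : 'I_N.+1) K => \big[Cplus/RtoC 0]_(k < K.+1) u p k)) => p pp.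
    have := CSeries_correct (su pp); apply: filterlim_ext => K.
    by rewrite sum_n_Cbig.
  have lim2 : filterlim (fun K => \big[Cmult/RtoC 1]_(p < N.+1 | prime p)
      \big[Cplus/RtoC 0]_(k < K.+1) u p k - S) eventually
      (locally (\big[Cmult/RtoC 1]_(p < N.+1 | prime p) CSeries (u p) - S)).
    apply/filterlim_C_eps => e e0; have /filterlim_C_eps /(_ e e0) := lim.
    apply: filter_imp => K; set A := bigop _ _ _; set B := bigop _ _ _.
    by have -> : A - S - (B - S) = A - B by ring.
  apply: (filterlim_Cmod_le lim2); exists N => K /leP NK.
  by rewrite (euler_expansion u0); apply: smooth_sum_close.
have tail0 : is_lim_seq tail 0%R.
  have := proj1 (is_series_big _ _) (Series_correct _ euler_abs_summable) => hl.
  have := is_lim_seq_minus' _ _ _ _ (is_lim_seq_const (Series (fun n => Cmod (h n.+1)))) hl.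
  by rewrite Rminus_diag_eq.
apply/filterlim_C_eps => e e0.
have /is_lim_seq_spec /(_ (mkposreal _ e0)) [N HN] := tail0.
exists N => n /HN /=; rewrite Rminus_0_r => hn.
by apply: Rle_lt_trans (close n) _; apply: Rle_lt_trans (Rle_abs _) hn.
Qed.
End EulerProduct.

(** * Exponentials and Dirichlet series *)

Lemma Cexp_plus a b : Cexp (a + b) = Cexp a * Cexp b.
Proof.
rewrite /Cexp /Cmult /= exp_plus cos_plus sin_plus /Re /Im; congr (_, _); ring.
Qed.

Lemma Cexp_0 : Cexp 0 = 1.
Proof. by rewrite /Cexp /= exp_0 cos_0 sin_0 /RtoC; congr (_, _); ring. Qed.

Lemma Cmod_Cexp z : Cmod (Cexp z) = exp (Re z).
Proof.
have -> : Cexp z = RtoC (exp (Re z)) * (cos (Im z), sin (Im z)).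
  by rewrite /Cexp /Cmult /=; congr (_, _); ring.
rewrite Cmod_mult Cmod_RtoC_pos; last exact/Rlt_le/exp_pos.
have -> : Cmod (cos (Im z), sin (Im z)) = 1%R; last by ring.
rewrite /Cmod /= -[RHS]sqrt_1; congr sqrt.
have := sin2_cos2 (Im z); rewrite /Rsqr; lra.
Qed.

Lemma Cexp_scaled_derive (w : C) t :
  is_derive_RC (fun t => Cexp (RtoC t * w)) t (w * Cexp (RtoC t * w)).
Proof.
case: w => a b.
have E x : Cexp (RtoC x * (a, b)) = (exp (x * a) * cos (x * b), exp (x * a) * sin (x * b))%R.
  rewrite /Cexp /=; have -> : (x * a - 0 * b = x * a)%R by ring.
  by have -> : (x * b + 0 * a = x * b)%R by ring.
rewrite E; apply: (@is_derive_ext _ C_R_NormedModule _ _ _ _ (fun x => esym (E x))).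
apply/is_derive_RC_ReIm; split; rewrite /=.
  by auto_derive => //; ring.
by auto_derive => //; ring.
Qed.

(** Two integrations of [d/dt Cexp (t w) = w * Cexp (t w)] along [[0, 1]]. *)
Lemma Cexp_remainder (w : C) : (Cmod (Cexp w - 1 - w) <= Cmod w ^ 2 * exp (Cmod w))%R.
Proof.
have dE := Cexp_scaled_derive w.
have cE t : continuous_RC (fun t => Cexp (RtoC t * w)) t := is_derive_RC_continuous (dE t).
have w0 := Cmod_ge_0 w; have e0 := exp_pos (Cmod w).
have bE t : (0 <= t <= 1)%R -> (Cmod (Cexp (RtoC t * w)) <= exp (Cmod w))%R.
  move=> ht; rewrite Cmod_Cexp.
  have : (Re (RtoC t * w) <= Cmod w)%R.
    apply: Rle_trans (Rle_abs _) _; apply: Rle_trans (re_le_Cmod _) _.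
    by rewrite Cmod_mult Cmod_RtoC_pos; nra.
  case/Rle_lt_or_eq_dec => [h|->]; [exact/Rlt_le/exp_increasing | exact: Rle_refl].
have E1 t : (0 <= t <= 1)%R -> (Cmod (Cexp (RtoC t * w) - 1) <= Cmod w * exp (Cmod w))%R.
  move=> ht.
  have := @RIntC_derive (fun t => Cexp (RtoC t * w)) (fun t => w * Cexp (RtoC t * w)) 0 t ltac:(lra)
    (fun x _ => dE x) (fun x _ => continuous_RC_mult (@continuous_RC_const w x) (cE x)).
  rewrite Cmult_0_l Cexp_0 => <-.
  apply: Rle_trans (Cmod_RInt_le (M := (Cmod w * exp (Cmod w))%R) _ _ _) _; first lra.
  - move=> x hx; rewrite Cmod_mult; apply: Rmult_le_compat_l => //; apply: bE; lra.
  - by move=> x _; apply: continuous_RC_mult; [exact: continuous_RC_const | exact: cE].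
  have : (0 <= Cmod w * exp (Cmod w))%R by apply: Rmult_le_pos; lra.
  nra.
pose G t := Cexp (RtoC t * w) + - (1) * (1 + RtoC t * w).
have dG t : is_derive_RC G t (w * (Cexp (RtoC t * w) - 1)).
  have h := is_derive_RC_plus (dE t) (is_derive_RC_mult (is_derive_RC_const (- (1)) t)
    (is_derive_RC_plus (is_derive_RC_const 1 t) (is_derive_RC_mult (is_derive_RtoC t) (is_derive_RC_const w t)))).
  set l := (X in is_derive_RC _ _ X) in h.
  suff -> : w * (Cexp (RtoC t * w) - 1) = l by [].
  by rewrite /l; ring.
have cG t : continuous_RC (fun t => w * (Cexp (RtoC t * w) - 1)) t.
  apply: continuous_RC_mult; first exact: continuous_RC_const.
  by apply: (@continuous_minus _ _ C_R_NormedModule); [exact: cE | exact: continuous_RC_const].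
have := @RIntC_derive G (fun t => w * (Cexp (RtoC t * w) - 1)) 0 1 ltac:(lra) (fun x _ => dG x) (fun x _ => cG x).
have -> : G 1%R - G 0%R = Cexp w - 1 - w.
  by rewrite /G Cmult_0_l Cexp_0 Cmult_1_l; ring.
move=> <-.
apply: Rle_trans (Cmod_RInt_le (M := (Cmod w ^ 2 * exp (Cmod w))%R) _ _ _) _; first lra.
- move=> x hx; rewrite Cmod_mult.
  have := Rmult_le_compat_l _ _ _ w0 (E1 x hx); rewrite /= Rmult_1_r; lra.
- by move=> x _; exact: cG.
by rewrite Rminus_0_r Rmult_1_r; apply: Rle_refl.
Qed.

Lemma INR_gt0 n : (0 < n)%N -> (0 < INR n)%R.
Proof. by move=> n0; apply: lt_0_INR; lia. Qed.

Lemma nat_cpowM m n s : (0 < m)%N -> (0 < n)%N ->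
  nat_cpow (m * n) s = nat_cpow m s * nat_cpow n s.
Proof.
move=> m0 n0; rewrite /nat_cpow -Cexp_plus mult_INR ln_mult; try exact: INR_gt0.
by rewrite RtoC_plus; congr Cexp; ring.
Qed.

Lemma nat_cpow1 s : nat_cpow 1 s = 1.
Proof. by rewrite /nat_cpow /= ln_1 Cmult_0_r Cexp_0. Qed.

Lemma nat_cpowX p k s : (0 < p)%N -> nat_cpow (p ^ k) s = nat_cpow p s ^ k.
Proof.
move=> p0; elim: k => [|k IH]; first by rewrite expn0 nat_cpow1.
by rewrite expnS nat_cpowM ?expn_gt0 ?p0 // IH.
Qed.

Lemma nat_cpow_Cmult p k s : nat_cpow p (RtoC (INR k) * s) = nat_cpow p s ^ k.
Proof.
elim: k => [|k IH]; first by rewrite /nat_cpow Cmult_0_l Cmult_0_l Cexp_0.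
rewrite S_INR RtoC_plus [RHS]/= -IH /nat_cpow -Cexp_plus; congr Cexp; ring.
Qed.

Lemma Cmod_nat_cpow n s : Cmod (nat_cpow n s) = Rpower (INR n) (Re s).
Proof. by rewrite /nat_cpow Cmod_Cexp /Rpower; congr exp; case: s => a b /=; ring. Qed.

Lemma nat_cpow_prime_powers n s : (0 < n)%N ->
  nat_cpow n s = \big[Cmult/RtoC 1]_(p < n.+1 | prime p) nat_cpow p s ^ logn p n.
Proof.
move=> n0.
have E : n = \big[muln/1%N]_(p < n.+1 | prime p) (p ^ logn p n)%N.
  rewrite -{1}(partnT n0) /partn big_mkord big_mkcond [RHS]big_mkcond /=.
  by apply: eq_bigr => p _; case: ifP => // pp; rewrite lognE pp /= expn0.
rewrite {1}E.
have [] : (0 < \big[muln/1%N]_(p < n.+1 | prime p) (p ^ logn p n)%N)%N /\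
  nat_cpow (\big[muln/1%N]_(p < n.+1 | prime p) (p ^ logn p n)%N) s =
  \big[Cmult/RtoC 1]_(p < n.+1 | prime p) nat_cpow p s ^ logn p n; last by [].
elim/big_rec2: _ => [|p y x pp [y0 IH]]; first by rewrite nat_cpow1.
have q0 : (0 < p ^ logn p n)%N by rewrite expn_gt0 prime_gt0.
split; first by rewrite muln_gt0 q0.
by rewrite nat_cpowM // IH nat_cpowX ?prime_gt0.
Qed.

Lemma multiplicative_ext_dirichlet a s n : (0 < n)%N ->
  multiplicative_ext (fun p k => a p k * nat_cpow p s ^ k) n =
  multiplicative_ext a n * nat_cpow n s.
Proof. by move=> n0; rewrite /multiplicative_ext big_split /= -nat_cpow_prime_powers. Qed.

Lemma ln_S_minus n : (0 < n)%N -> (/ INR n.+1 <= ln (INR n.+1) - ln (INR n))%R.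
Proof.
move=> n0; have h0 := INR_gt0 n0; have h1 : (0 < INR n.+1)%R by exact: INR_gt0.
have := exp_ineq1_le (ln (INR n / INR n.+1)).
rewrite exp_ln; last exact: Rdiv_lt_0_compat.
rewrite ln_div // => h.
have : (INR n / INR n.+1 = 1 - / INR n.+1)%R by rewrite S_INR; field; lra.
lra.
Qed.

(** With [d = x - 1], the term [d (n+1)^(-x)] is at most
    [n^(-d) - (n+1)^(-d)], whose sum telescopes; for the first term this
    comparison starts at [n = 1], hence the extra [d] in the bound. *)
Lemma ex_series_Rpower x : (1 < x)%R -> ex_series (fun n => Rpower (INR n.+1) (- x)).
Proof.
move=> x1; pose d := (x - 1)%R; have d0 : (0 < d)%R by rewrite /d; lra.
have pos n y : (0 < Rpower (INR n) y)%R by exact: exp_pos.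
have step n : (0 < n)%N ->
    (d * Rpower (INR n.+1) (- x) <= Rpower (INR n) (- d) - Rpower (INR n.+1) (- d))%R.
  move=> n0; have h1 : (0 < INR n.+1)%R by exact: INR_gt0.
  have -> : (Rpower (INR n.+1) (- x) = Rpower (INR n.+1) (- d) * / INR n.+1)%R.
    by rewrite -{3}(Rpower_1 _ h1) -Rpower_Ropp -Rpower_plus; congr Rpower; rewrite /d; ring.
  have -> : (Rpower (INR n) (- d) = Rpower (INR n.+1) (- d) * exp (d * (ln (INR n.+1) - ln (INR n))))%R.
    by rewrite /Rpower -exp_plus; congr exp; ring.
  have h2 := exp_ineq1_le (d * (ln (INR n.+1) - ln (INR n))).
  have h3 := Rmult_le_compat_l _ _ _ (Rlt_le _ _ d0) (ln_S_minus n0).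
  have := Rmult_le_compat_l _ _ _ (Rlt_le _ _ (pos n.+1 (- d)%R)) h2.
  have := Rmult_le_compat_l _ _ _ (Rlt_le _ _ (pos n.+1 (- d)%R)) h3.
  lra.
have b n : (d * \big[Rplus/0%R]_(k < n.+1) Rpower (INR k.+1) (- x) <= d + (1 - Rpower (INR n.+1) (- d)))%R.
  elim: n => [|n IH].
    by rewrite big_ord1 /= /Rpower ln_1 !Rmult_0_r exp_0; lra.
  rewrite big_ord_recr Rmult_plus_distr_l; have := step n.+1 isT; move: IH; set A := bigop _ _ _.
  rewrite [nat_of_ord _]/=; lra.
apply: (@ex_series_bounded _ ((d + 1) / d)%R) => [n|n]; first exact/Rlt_le/pos.
have := b n; rewrite big_ord_recr Rmult_plus_distr_l [nat_of_ord _]/=.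
have := pos n.+1 (- d)%R; have := Rmult_lt_0_compat _ _ d0 (pos n.+1 (- x)%R).
set A := bigop _ _ _ => h1 h2 h3.
apply: (Rmult_le_reg_l d) => //.
have -> : (d * ((d + 1) / d) = d + 1)%R by field; lra.
by change (d * A <= d + 1)%R; move: h3; change (d * A + d * Rpower (INR n.+1) (- x) <= d + (1 - Rpower (INR n.+1) (- d)) -> d * A <= d + 1)%R; lra.
Qed.

Section DirichletHolomorphic.
Variables (c : nat -> C) (eps : R).
Hypothesis sc : forall s, (eps < Re s)%R -> abs_summable (dirichlet_term c s).

(** A factor [log n] costs at most [n ^ d / d].  The second-order remainder
    involves two of them and a factor [n ^ |w - s|], so moving the abscissa by
    [3 d], with [d] a quarter of the available room, pays for everything. *)
Lemma dirichlet_series_derivable s : (eps < Re s)%R ->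
  complex_derivable (fun s => CSeries (dirichlet_term c s)) s.
Proof.
move=> hs; pose d := ((Re s - eps) / 4)%R; have d0 : (0 < d)%R by rewrite /d; lra.
pose L k := ln (INR k.+1).
have L0 k : (0 <= L k)%R.
  rewrite /L -ln_1; have : (1 <= INR k.+1)%R by rewrite S_INR; have := pos_INR k; lra.
  case/Rle_lt_or_eq_dec => [h|<-]; [apply/Rlt_le/ln_increasing; lra | exact: Rle_refl].
have LE k : (d * L k <= exp (d * L k))%R by have := exp_ineq1_le (d * L k); lra.
have shift j k : (Cmod (dirichlet_term c s k) * exp (j * (d * L k)) =
    Cmod (dirichlet_term c (s - RtoC (j * d)) k))%R.
  rewrite /dirichlet_term !Cmod_mult !Cmod_nat_cpow Rmult_assoc /Rpower -exp_plus -/(L k).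
  congr (_ * exp _)%R; case: (s) => a b /=; ring.
have sj j : (j <= 3)%R -> ex_series (fun k => Cmod (dirichlet_term c s k) * exp (j * (d * L k)))%R.
  move=> hj.
  have h : (eps < Re (s - RtoC (j * d)))%R.
    have -> : Re (s - RtoC (j * d)) = (Re s - j * d)%R by case: (s).
    have : (j * d <= 3 * d)%R by apply: Rmult_le_compat_r; lra.
    rewrite /d in d0 *; lra.
  by apply: ex_series_ext (sc h) => k; rewrite shift.
have dL0 k : (0 <= d * L k)%R by apply: Rmult_le_pos; [lra | exact: L0].
pose v k := - RtoC (L k) * dirichlet_term c s k.
exists (CSeries v).
apply: (@is_Cderive_series (fun k w => dirichlet_term c w k) v
  (fun k => Cmod (dirichlet_term c s k) * exp (3 * (d * L k)) * / d ^ 2)%R _ _ d d0).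
- move=> w hw; apply/CSeries_correct/sc.
  have := Rle_trans _ _ _ (Rle_abs _) (re_le_Cmod (s - w)).
  have -> : Re (s - w) = (Re s - Re w)%R by case: (s) (w) => ? ? [].
  have -> : s - w = - (w - s) by ring.
  rewrite Cmod_opp; rewrite /d in hw; lra.
- apply: (@abs_summable_le _ (fun k => Cmod (dirichlet_term c s k) * exp (1 * (d * L k)) * / d)%R); last first.
    by apply: ex_series_scal_r; apply: sj; lra.
  move=> k; rewrite /v Cmod_mult Cmod_opp Cmod_RtoC_pos //.
  apply: (Rmult_le_reg_r d) => //; rewrite [X in (_ <= X)%R]Rmult_assoc Rinv_l ?Rmult_1_r ?Rmult_1_l; last lra.
  have := Rmult_le_compat_l _ _ _ (Cmod_ge_0 (dirichlet_term c s k)) (LE k); lra.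
- by apply: ex_series_scal_r; apply: sj; lra.
move=> k w hw; pose xi := - (w - s) * RtoC (L k).
have Ew : dirichlet_term c w k = dirichlet_term c s k * Cexp xi.
  rewrite /dirichlet_term /nat_cpow -Cmult_assoc -Cexp_plus; congr (_ * Cexp _).
  by rewrite /xi /L; ring.
have -> : dirichlet_term c w k - dirichlet_term c s k - v k * (w - s) =
    dirichlet_term c s k * (Cexp xi - 1 - xi) by rewrite Ew /v /xi; ring.
have hxi : Cmod xi = (Cmod (w - s) * L k)%R.
  by rewrite /xi Cmod_mult Cmod_opp Cmod_RtoC_pos.
have w0 := Cmod_ge_0 (w - s).
rewrite Cmod_mult (Rmult_assoc (Cmod (dirichlet_term c s k))) (Rmult_assoc (Cmod (dirichlet_term c s k))).
rewrite (Rmult_assoc (exp (3 * (d * L k)))); apply: Rmult_le_compat_l; first exact: Cmod_ge_0.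
apply: Rle_trans (Cexp_remainder xi) _; rewrite hxi.
have e1 : (exp (Cmod (w - s) * L k) <= exp (d * L k))%R.
  have : (Cmod (w - s) * L k <= d * L k)%R by apply: Rmult_le_compat_r => //; lra.
  case/Rle_lt_or_eq_dec => [h|->]; [exact/Rlt_le/exp_increasing | exact: Rle_refl].
have e2 : ((d * L k) ^ 2 <= exp (d * L k) ^ 2)%R by apply: pow_incr.
have e3 : (exp (3 * (d * L k)) = exp (d * L k) ^ 2 * exp (d * L k))%R.
  by rewrite /= Rmult_1_r -!exp_plus; congr exp; ring.
have -> : ((Cmod (w - s) * L k) ^ 2 * exp (Cmod (w - s) * L k) =
  Cmod (w - s) ^ 2 * / d ^ 2 * ((d * L k) ^ 2 * exp (Cmod (w - s) * L k)))%R by field; lra.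
have -> : (exp (3 * (d * L k)) * (/ d ^ 2 * Cmod (w - s) ^ 2) =
  Cmod (w - s) ^ 2 * / d ^ 2 * exp (3 * (d * L k)))%R by ring.
apply: Rmult_le_compat_l.
  by apply: Rmult_le_pos; [exact: pow_le | apply/Rlt_le/Rinv_0_lt_compat/pow_lt].
rewrite e3; apply: Rmult_le_compat => //; first exact: pow_le.
exact/Rlt_le/exp_pos.
Qed.
End DirichletHolomorphic.

(** * The Euler product of Q with zeta factors removed *)

(** Cuts start at singularities and run outward, so they stay out of the disk
    [|z| < r]. *)
Lemma holomorphic_below_singularities Q Sing cuts r :
  holomorphic_on_cut_disk Q Sing cuts -> smallest_magnitude Sing r ->
  forall z, (Cmod z < Rmin r 1)%R -> complex_derivable Q z.
Proof.
move=> [S1 _ hcut hol] hr z hz.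
have z1 : (Cmod z < 1)%R by apply: Rlt_le_trans hz (Rmin_r _ _).
have zr : (Cmod z < r)%R by apply: Rlt_le_trans hz (Rmin_l _ _).
have Sr w : Sing w -> (r <= Cmod w)%R.
  by case: hr => [[z0 [_ _ h]]|[h _]] Sw; [exact: h | case: (h w)].
apply: hol; split=> //; first by move=> /Sr; lra.
move=> gamma /hcut [S0 _ out] t t0 e.
by have := out t t0; have := Sr _ S0; rewrite -e; lra.
Qed.

Lemma smallest_magnitude_gt0 (Sing : C -> Prop) r :
  ~ Sing 0 -> smallest_magnitude Sing r -> (0 < r)%R.
Proof.
move=> S0 [[z [Sz <- _]]|[_ h]]; last lra.
by apply/Cmod_gt_0 => z0; apply: S0; rewrite -z0.
Qed.

Lemma exists_log_exponents (a : fps) : exists b : nat -> C, forall m, (0 < m)%N ->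
  RtoC (INR m) * fps_log a m =
    \big[Cplus/RtoC 0]_(1 <= n < m.+1 | (n %| m)%N) (RtoC (INR n) * b n).
Proof. exact: (divisor_sum_solution (fun m => RtoC (INR m) * fps_log a m)). Qed.

(** Passing from [y] down to [Y], a term of degree [k >= m] shrinks by
    [(Y / y) ^ k], which is at most [(Y / y) ^ m]. *)
Lemma Series_high_order_le (a : fps) (m : nat) (Y y : R) :
  a 0%N = 1 -> (forall k, (0 < k < m)%N -> a k = 0) -> (0 <= Y <= y)%R -> (0 < y)%R ->
  ex_series (fun k => Cmod (a k) * y ^ k)%R ->
  (Series (fun k => Cmod (a k) * Y ^ k) <=
     1 + Series (fun k => Cmod (a k) * y ^ k) / y ^ m * Y ^ m)%R.
Proof.
move=> a0 av hY y0 ha.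
(* The constant term 1 does not shrink; it is counted separately. *)
pose e k : R := if k == 0%N then 1%R else 0%R.
have he : is_series e 1%R.
  apply: is_series_decr_1.
  have -> : plus 1%R (opp (e 0%N)) = 0%R by rewrite /plus /opp /e /=; ring.
  apply/is_series_big; apply: is_lim_seq_ext (is_lim_seq_const 0) => n.
  by rewrite big1.
have q0 : (0 <= Y / y)%R by apply: Rmult_le_pos; [lra | apply/Rlt_le/Rinv_0_lt_compat].
have q1 : (Y / y <= 1)%R.
  by apply: (Rmult_le_reg_r y) => //; rewrite /Rdiv Rmult_assoc Rinv_l; lra.
have hs := ex_series_scal_r ((Y / y) ^ m)%R _ ha.
have -> : (1 + Series (fun k => Cmod (a k) * y ^ k) / y ^ m * Y ^ m =
   Series (fun k => e k + (Cmod (a k) * y ^ k) * (Y / y) ^ m))%R.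
  rewrite Series_plus //; last by exists 1%R.
  rewrite (is_series_unique _ _ he) Series_scal_r /Rdiv Rpow_mult_distr pow_inv.
  by ring.
apply: Series_le; last first.
  apply: (@ex_series_plus R_AbsRing R_NormedModule) => //; by exists 1%R.
move=> k; have c0 := Cmod_ge_0 (a k).
have Yk : (0 <= Y ^ k)%R by apply: pow_le; lra.
have yk : (0 <= y ^ k)%R by apply: pow_le; lra.
have qm : (0 <= (Y / y) ^ m)%R by exact: pow_le.
split; first by exact: Rmult_le_pos.
have p0 : (0 <= Cmod (a k) * y ^ k * (Y / y) ^ m)%R.
  by apply: Rmult_le_pos => //; exact: Rmult_le_pos.
case: k c0 Yk yk p0 => [|k] c0 Yk yk p0.
  by rewrite /e /= a0 Cmod_1; rewrite /= a0 Cmod_1 in p0; lra.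
rewrite /e /= Rplus_0_l; case: (ltnP k.+1 m) => km.
  by rewrite av // Cmod_0; lra.
rewrite -[(y * y ^ k)%R]/(y ^ k.+1)%R -[(Y * Y ^ k)%R]/(Y ^ k.+1)%R Rmult_assoc.
apply: Rmult_le_compat_l => //.
have -> : (Y ^ k.+1 = y ^ k.+1 * (Y / y) ^ k.+1)%R.
  by rewrite -Rpow_mult_distr; congr pow; field; lra.
apply: Rmult_le_compat_l => //.
have -> : k.+1 = (m + (k.+1 - m))%N by lia.
rewrite pow_add -{2}(Rmult_1_r ((Y / y) ^ m)); apply: Rmult_le_compat_l => //.
by rewrite -(pow1 (k.+1 - m)); apply: pow_incr.
Qed.

Lemma floor_inv_lt eps : (0 < eps)%R ->
  (1 < INR (Z.to_nat (Int_part (1 / eps))).+1 * eps)%R.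
Proof.
move=> e0; have [h1 h2] := base_Int_part (1 / eps).
have i0 : (0 < 1 / eps)%R by apply: Rdiv_lt_0_compat; lra.
have z0 : (0 <= Int_part (1 / eps))%Z.
  have : (-1 < Int_part (1 / eps))%Z by apply: lt_IZR; lra.
  lia.
apply: (Rle_lt_trans _ (1 / eps * eps)); first by apply: Req_le; field; lra.
apply: Rmult_lt_compat_r => //.
rewrite S_INR INR_IZR_INZ Znat.Z2Nat.id //; lra.
Qed.

Lemma Rpower_neg_lt1 p s : (1 < p)%N -> (0 < s)%R -> (Rpower (INR p) (- s) < 1)%R.
Proof.
move=> p1 s0; rewrite /Rpower -exp_0; apply: exp_increasing.
have : (0 < ln (INR p))%R.
  by rewrite -ln_1; apply: ln_increasing; [lra | apply: (lt_INR 1); lia].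
nra.
Qed.

Lemma Rpower_neg_lt_radius p r eps s : (0 < r)%R -> (0 < eps < s)%R ->
  (1 < p)%N -> (Rpower r (- (1 / eps)) < INR p)%R -> (Rpower (INR p) (- s) < r)%R.
Proof.
move=> r0 hs p1 hp.
have lp : (0 < ln (INR p))%R.
  by rewrite -ln_1; apply: ln_increasing; [lra | apply: (lt_INR 1); lia].
have hl : (- (1 / eps) * ln r < ln (INR p))%R.
  have := ln_increasing _ _ (exp_pos _) hp; by rewrite /Rpower ln_exp.
have hl2 : (- ln r < eps * ln (INR p))%R.
  have := Rmult_lt_compat_l eps _ _ ltac:(lra) hl.
  by have -> : (eps * (- (1 / eps) * ln r) = - ln r)%R by field; lra.
rewrite -(exp_ln r r0) /Rpower; apply: exp_increasing; nra.
Qed.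

Lemma Rpower_pow_nat x y n : (Rpower x y ^ n = Rpower x (INR n * y))%R.
Proof. by rewrite -Rpower_pow ?Rpower_mult; [congr Rpower; ring | exact: exp_pos]. Qed.

(** [thr] is the bound [r^(-1/eps)] below which the factor [Q(p^-s)] is
    cancelled, and [M] the number of zeta factors. *)
Section FactoredProduct.
Variables (Q : C -> C) (r : R) (b : nat -> C) (eps : R).
Hypothesis r0 : (0 < r)%R.
Hypothesis eps0 : (0 < eps)%R.
Hypothesis Q0 : Q 0 = 1.
Hypothesis QD : forall z, (Cmod z < Rmin r 1)%R -> complex_derivable Q z.
Hypothesis b_log : forall m, (0 < m)%N -> RtoC (INR m) * fps_log (taylor_coef Q) m =
    \big[Cplus/RtoC 0]_(1 <= n < m.+1 | (n %| m)%N) (RtoC (INR n) * b n).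

Let M := Z.to_nat (Int_part (1 / eps)).
Let thr := Rpower r (- (1 / eps)).
Let q : fps := taylor_coef Q.

Let q0 : q 0%N = 1.
Proof. by rewrite /q /taylor_coef /= Q0; field; exact: RtoC_neq1. Qed.

(** The power series in [p^-s] of the factor at [p]; it does not depend on
    [s], and therefore gives the coefficients of a Dirichlet series. *)
Definition local_coef (p : nat) : fps :=
  if Rle_dec (INR p) thr then fps_binom_prod b M else fps_remainder q b M.

Let rho0 : (0 < Rmin r 1)%R. Proof. by apply: Rmin_pos; lra. Qed.

Let remainder_conv : converges_below (fps_remainder q b M) (Rmin r 1).
Proof.
have [cq _] := holomorphic_disk_taylor rho0 QD.
apply: (converges_below_mul cq).
exact: (converges_below_le (Rmin_r _ _) (converges_below_binom_prod b M)).
Qed.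

Let local_coef_0 p : local_coef p 0%N = 1.
Proof.
rewrite /local_coef; case: (Rle_dec _ _) => h; first exact: fps_binom_prod_0.
exact: fps_remainder_0.
Qed.

Section AtPoint.
Variable s : C.
Hypothesis hs : (eps < Re s)%R.
Let z p := nat_cpow p (- s).
Let u p k := local_coef p k * z p ^ k.

Let Cmod_z p : Cmod (z p) = Rpower (INR p) (- Re s).
Proof. by rewrite /z Cmod_nat_cpow; congr Rpower; case: (s). Qed.

Let z_lt1 p : (1 < p)%N -> (Cmod (z p) < 1)%R.
Proof. by move=> p1; rewrite Cmod_z; apply: Rpower_neg_lt1 => //; lra. Qed.

Let z_lt_rho p : (1 < p)%N -> ~ (INR p <= thr)%R -> (Cmod (z p) < Rmin r 1)%R.
Proof.
move=> p1 hp; apply: Rmin_glb_lt; last exact: z_lt1.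
by rewrite Cmod_z; apply: (@Rpower_neg_lt_radius _ _ eps) => //; exact: Rnot_le_lt.
Qed.

Let local_summable p : (1 < p)%N -> abs_summable (u p).
Proof.
move=> p1; rewrite /u /local_coef; case: (Rle_dec _ _) => hp.
  by apply: (converges_below_summable (converges_below_binom_prod b M)); exact: z_lt1.
by apply: (converges_below_summable remainder_conv); exact: z_lt_rho.
Qed.

Lemma zeta_pow_factorE n p : zeta_pow_factor n (b n) s p = pow1m (z p ^ n) (b n).
Proof.
rewrite /zeta_pow_factor /z -nat_cpow_Cmult; congr (pow1m (nat_cpow p _) _); ring.
Qed.

Lemma euler_factor_local p : (1 < p)%N -> CSeries (u p) = euler_factor Q r b eps s p.
Proof.
move=> p1; apply: CSeries_unique; rewrite /euler_factor /u /local_coef -/thr -/M -/(z p).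
under eq_bigr => n _ do rewrite zeta_pow_factorE.
case: (Rle_dec _ _) => hp.
  by rewrite Cmult_1_l; apply: is_Cseries_binom_prod; exact: z_lt1.
have hz := z_lt_rho p1 hp; have [cq eq] := holomorphic_disk_taylor rho0 QD.
apply: (@is_Cseries_mul_power _ _ (Rmin r 1)) => //.
- exact: (converges_below_le (Rmin_r _ _) (converges_below_binom_prod b M)).
- exact: eq.
- by apply: is_Cseries_binom_prod; exact: z_lt1.
Qed.

(** Beyond [thr] the factor at [p] is [1 + O(p^(-(M+1) s))], with a constant
    governed by the value at a fixed integer [N] above [thr]; and
    [(M + 1) Re s > (M + 1) eps > 1] makes these errors summable.  The finitely
    many factors before [N] are harmless; the absolute value there only
    ensures [0 <= t p] when [p] is not a prime. *)
Lemma local_excess_bound : exists t : nat -> R, [/\ forall p, (0 <= t p)%R, ex_series t &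
  forall p, prime p -> (Series (fun k => Cmod (u p k)) <= 1 + t p)%R].
Proof.
have [N0 HN0] := INR_archimed 1 thr Rlt_0_1.
pose N := N0.+2.
have N1 : (1 < N)%N by [].
have hN p : (N <= p)%N -> ~ (INR p <= thr)%R.
  move=> hp; have : (INR N0 <= INR p)%R by apply: le_INR; rewrite /N in hp; lia.
  lra.
pose y := Cmod (z N).
have y0 : (0 < y)%R by rewrite /y Cmod_z; exact: exp_pos.
pose Sy := Series (fun k => Cmod (fps_remainder q b M k) * y ^ k)%R.
have ey : ex_series (fun k => Cmod (fps_remainder q b M k) * y ^ k)%R.
  by apply: remainder_conv; split; [lra | apply: z_lt_rho => //; exact: hN].
have Sy0 : (0 <= Sy)%R.
  apply: (Rle_trans _ _ _ _ (@Rsum_le_Series _ 0 _ ey)); first by rewrite big_ord0; apply: Rle_refl.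
  by move=> k; apply: Rmult_le_pos; [exact: Cmod_ge_0 | apply: pow_le; lra].
pose x := (INR M.+1 * Re s)%R.
have x1 : (1 < x)%R.
  apply: Rlt_trans (floor_inv_lt eps0) _; apply: Rmult_lt_compat_l => //; exact: INR_gt0.
pose K := (Sy / y ^ M.+1)%R.
have K0 : (0 <= K)%R by apply: Rmult_le_pos => //; apply/Rlt_le/Rinv_0_lt_compat/pow_lt.
pose t p := if (p < N)%N then Rabs (Series (fun k => Cmod (u p k))) else (K * Rpower (INR p) (- x))%R.
exists t; split.
- move=> p; rewrite /t; case: ifP => _; first exact: Rabs_pos.
  by apply: Rmult_le_pos => //; exact/Rlt_le/exp_pos.
- apply/(ex_series_incr_n _ N).
  have h := proj1 (ex_series_incr_n _ N.-1) (ex_series_Rpower x1).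
  apply: ex_series_ext (@ex_series_scal R_AbsRing R_NormedModule K _ h) => k.
  have -> : (N.-1 + k)%coq_nat.+1 = (N + k)%coq_nat by rewrite /N; lia.
  by rewrite /t ifN //; lia.
move=> p pp; rewrite /t; have p1 := prime_gt1 pp; case: (ltnP p N) => hp.
  by have := Rle_abs (Series (fun k => Cmod (u p k))); lra.
have E : Series (fun k => Cmod (u p k)) =
    Series (fun k => Cmod (fps_remainder q b M k) * Cmod (z p) ^ k)%R.
  apply: Series_ext => k; rewrite /u /local_coef.
  by case: (Rle_dec _ _) => h; [case: (hN p hp) | rewrite Cmod_mult Cmod_pow].
rewrite E; apply: Rle_trans (@Series_high_order_le _ M.+1 _ y _ _ _ _ ey) _ => //.
- by apply: fps_remainder_0.
- by move=> k hk; apply: (fps_remainder_vanishes q0 b_log); lia.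
- split; first exact: Cmod_ge_0.
  rewrite /y !Cmod_z /Rpower.
  have h : (ln (INR N) <= ln (INR p))%R.
    have : (INR N <= INR p)%R by apply: le_INR; lia.
    by case/Rle_lt_or_eq_dec => [h|->]; [apply/Rlt_le/ln_increasing => //; exact: INR_gt0 | exact: Rle_refl].
  have : (- Re s * ln (INR p) <= - Re s * ln (INR N))%R by nra.
  by case/Rle_lt_or_eq_dec => [h'|->]; [exact/Rlt_le/exp_increasing | exact: Rle_refl].
rewrite -/Sy -/K Cmod_z Rpower_pow_nat; apply: Req_le; congr (1 + K * Rpower _ _)%R.
by rewrite /x; ring.
Qed.

Let c := multiplicative_ext local_coef.

Lemma dirichlet_term_local n : dirichlet_term c s n = multiplicative_ext u n.+1.
Proof. by rewrite /dirichlet_term /c /u /z multiplicative_ext_dirichlet. Qed.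

Let u0 p : u p 0%N = 1.
Proof. by rewrite /u local_coef_0 Cmult_1_l. Qed.

Lemma factored_product_summable : abs_summable (dirichlet_term c s).
Proof.
have [t [t0 st ut]] := local_excess_bound.
have := euler_abs_summable u0 (fun p pp => local_summable (prime_gt1 pp)) t0 st ut.
by apply: ex_series_ext => n; rewrite dirichlet_term_local.
Qed.

Lemma factored_product_euler :
  is_euler_product (euler_factor Q r b eps s) (CSeries (dirichlet_term c s)).
Proof.
have [t [t0 st ut]] := local_excess_bound.
have := euler_product_converges u0 (fun p pp => local_summable (prime_gt1 pp)) t0 st ut.
have -> : (fun n => multiplicative_ext u n.+1) = dirichlet_term c s.
  by apply: functional_extensionality => n; rewrite dirichlet_term_local.
apply: filterlim_ext => N; apply: eq_bigr => p pp.
by rewrite euler_factor_local // prime_gt1.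
Qed.
End AtPoint.
End FactoredProduct.

Theorem theorem10p1 :
  forall (Q : C -> C) (Sing : C -> Prop) (cuts : (R -> C) -> Prop) (r : R),
    holomorphic_on_cut_disk Q Sing cuts ->
    ~ Sing (RtoC 0) ->
    holomorphic_at Q (RtoC 0) ->
    Q (RtoC 0) = RtoC 1 ->
    smallest_magnitude Sing r ->
    exists b : nat -> C,
      is_fps_sum (fun n m => Copp (Cmult (b n) (fps_log (fps_1mXn n) m)))
        (fps_log (taylor_coef Q))
      /\
      forall eps : R, (0 < eps)%R ->
        exists D : C -> C,
          [/\ forall s : C, (eps < Re s)%R ->
                is_euler_product (euler_factor Q r b eps s) (D s),
              abs_convergent_dirichlet_series_on
                (fun s => (eps < Re s)%R) D
            & holomorphic_on (fun s => (eps < Re s)%R) D].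
Proof.
move=> Q Sing cuts r hol S0 _ Q0 hr.
have QD := holomorphic_below_singularities hol hr.
have r0 := smallest_magnitude_gt0 S0 hr.
have [b hb] := exists_log_exponents (taylor_coef Q).
exists b; split; first exact: log_fps_sum.
move=> eps eps0.
pose c := multiplicative_ext (local_coef Q r b eps).
have sc s : (eps < Re s)%R -> abs_summable (dirichlet_term c s).
  by move=> hs; apply: factored_product_summable.
exists (fun s => CSeries (dirichlet_term c s)); split.
- by move=> s hs; apply: factored_product_euler.
- by exists c => s hs; split; [exact: sc | apply: CSeries_correct; exact: sc].
- by move=> s hs; apply: dirichlet_series_derivable hs.
Qed.
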